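(* Let $n\ge 2$, let $K\subset\mathbb{R}^n$ be a convex body containing the origin in its interior with $V(K)=1$, let $u\in S^{n-1}$, and suppose that $V_K(\{u\})=\alpha>0$ and $V_K(\{-u\})=\beta>0$. Then $$\varphi(\alpha,\beta,n)\le 1,$$ with equality if and only if the following three conditions all hold: $F(K,u)$ and $F(K,-u)$ are homothetic; $K$ is the convex hull of $F(K,u)\cup F(K,-u)$; and $$\frac{h_K(u)}{h_K(-u)}=\frac{\alpha}{\beta}\cdot\varrho_0\left(\frac{\alpha}{\beta},n\right)^{-2(n-1)}.$$
   Context: A convex body in $\mathbb{R}^n$ is a compact convex set with non-empty interior; $V(\cdot)$ is $n$-dimensional volume; $S^{n-1}$ is the Euclidean unit sphere; $h_K(u)=\max_{x\in K}\langle x,u\rangle$ is the support function. For $u\in S^{n-1}$, the face of $K$ with exterior normal $u$ is $F(K,u)=\{x\in K:\langle x,u\rangle=h_K(u)\}$. Two sets are homothetic if one is a translate of a positive multiple of the other. For a convex body $K$ with the origin in its interior, the cone volume measure $V_K$ is the Borel measure on $S^{n-1}$ given by $V_K(\omega)=\int_\omega \frac{h_K(u)}{n}\,dS_K(u)$, where $S_K$ is the surface area measure of $K$. In particular $V_K(\{u\})=\frac{h_K(u)}{n}\mathcal{H}_{n-1}(F(K,u))$, the volume of the convex hull of the origin and $F(K,u)$, where $\mathcal{H}_{n-1}$ is $(n-1)$-dimensional Hausdorff measure. For $\alpha,\beta>0$ and an integer $n\ge2$, $$\varphi(\alpha,\beta,n)=\min_{\varrho>0}\left(\frac{\alpha}{\varrho^{n-1}}+\beta\varrho^{n-1}\right)\sum_{i=0}^{n-1}\varrho^{n-1-2i}=\alpha+\beta+\min_{\varrho>0}\sum_{i=1}^{n-1}\left(\alpha\varrho^{-2i}+\beta\varrho^{2i}\right).$$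 The minimum is attained at a unique $\varrho>0$, which depends only on $\alpha/\beta$ and $n$ and is denoted $\varrho_0(\alpha/\beta,n)$. *)

(* Defs.v *)
From HB Require Import structures.
From mathcomp Require Import all_boot all_order all_algebra.
From mathcomp Require Import all_classical all_reals all_analysis.

Set Implicit Arguments.
Unset Strict Implicit.
Unset Printing Implicit Defensive.

Import Order.TTheory GRing.Theory Num.Theory.
Import numFieldNormedType.Exports.

Local Open Scope classical_set_scope.
Local Open Scope ring_scope.

Section euclidean_space.
Context {R : realType} {n : nat}.
Implicit Types (x y u v : 'rV[R]_n) (A B K : set 'rV[R]_n).

Definition dot x y : R := \sum_i x ord0 i * y ord0 i.

(* The library norm `|x| on 'rV[R]_n is the sup norm (same topology). *)
Definition enorm x : R := Num.sqrt (dot x x).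

Definition unit_sphere : set 'rV[R]_n := [set u | enorm u = 1].

Definition convex_hull A : set 'rV[R]_n :=
  smallest (@convex_set R 'rV[R]_n) A.

Definition homothetic A B : Prop :=
  exists (lambda : R) (v : 'rV[R]_n),
    0 < lambda /\ A = [set lambda *: x + v | x in B].

Definition convex_body K : Prop :=
  [/\ @convex_set R 'rV[R]_n K, compact K & interior K !=set0].

(* For compact nonempty K the supremum is attained. *)
Definition support_fun K u : R := sup [set dot x u | x in K].

Definition face K u : set 'rV[R]_n :=
  [set x | K x /\ dot x u = support_fun K u].

Definition box (a b : 'rV[R]_n) : set 'rV[R]_n :=
  [set x | forall i, a ord0 i <= x ord0 i <= b ord0 i].

(* Lebesgue outer measure, from countable coverings by boxes with ordered
   corners; it is n-dimensional volume on all Lebesgue measurable sets, in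
   particular on compact sets. *)
Definition volume A : \bar R :=
  ereal_inf
    [set (\sum_(k <oo)
            (\prod_i ((ab k).2 ord0 i - (ab k).1 ord0 i))%:E)%E
    | ab in [set ab : ('rV[R]_n * 'rV[R]_n)^nat |
        (forall k i, (ab k).1 ord0 i <= (ab k).2 ord0 i) /\
        A `<=` \bigcup_k box (ab k).1 (ab k).2]].

(* The element 0 is added so that the diameter of the empty set is 0. *)
Definition diam A : \bar R :=
  ereal_sup (0%E |` [set (enorm (x.1 - x.2))%:E | x in A `*` A]).

(* Unnormalized d-dimensional Hausdorff measure (0 < d). *)
Definition hausdorff_delta (d : nat) (delta : R) A : \bar R :=
  ereal_inf
    [set (\sum_(k <oo) (diam (E k) ^+ d))%E
    | E in [set E : (set 'rV[R]_n)^nat |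
        A `<=` \bigcup_k E k /\ forall k, (diam (E k) <= delta%:E)%E]].

Definition hausdorff_raw (d : nat) A : \bar R :=
  ereal_sup [set hausdorff_delta d delta A | delta in [set delta : R | 0 < delta]].

Definition unit_cube (d : nat) : set 'rV[R]_n :=
  [set x | forall i : 'I_n,
     if (i < d)%N then 0 <= x ord0 i <= 1 else x ord0 i == 0].

(* Normalized, as usual, so as to agree with d-dimensional Lebesgue measure on
   d-dimensional subspaces: a d-dimensional unit cube has measure 1. *)
Definition hausdorff (d : nat) A : \bar R :=
  ((fine (hausdorff_raw d (unit_cube d)))^-1%:E * hausdorff_raw d A)%E.

(* 'rV[R]_n with its Borel sigma-algebra. *)
Definition borel_rV := g_sigma_algebraType (@open 'rV[R]_n).

(* The set of the points of K having an exterior unit normal in omega. *)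
Definition reverse_spherical_image K (omega : set 'rV[R]_n) : set 'rV[R]_n :=
  \bigcup_(u in omega `&` unit_sphere) face K u.

(* Surface area measure, regarded as a Borel measure on R^n carried by the
   unit sphere. *)
Definition surface_area_measure K (omega : set borel_rV) : \bar R :=
  hausdorff n.-1 (reverse_spherical_image K omega).

Definition cone_volume_measure K (omega : set borel_rV) : \bar R :=
  (\int[surface_area_measure K]_(u in omega) (support_fun K u / n%:R)%:E)%E.

End euclidean_space.

Section phi.
Context {R : realType}.
Implicit Types (alpha beta t rho : R) (n : nat).

Definition phi_objective alpha beta n rho : R :=
  (alpha / rho ^+ n.-1 + beta * rho ^+ n.-1) *
  \sum_(i < n) rho ^ ((n.-1)%:Z - (2 * i)%:Z).

Definition phi_argmin alpha beta n : set R :=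
  [set rho | 0 < rho /\ forall rho', 0 < rho' ->
     phi_objective alpha beta n rho <= phi_objective alpha beta n rho'].

(* For alpha, beta > 0 and n >= 2 the infimum is attained, at a unique rho. *)
Definition phi alpha beta n : R :=
  inf [set phi_objective alpha beta n rho | rho in [set rho | 0 < rho]].

(* The minimizer for (alpha, beta) is rho0 (alpha / beta) n, because
   phi_objective is homogeneous of degree 1 in (alpha, beta). *)
Definition rho0 t n : R := xget 0 (phi_argmin t 1 n).

End phi.

(* Main.v *)
(** Cut [K] by the hyperplanes orthogonal to [u]. By the Brunn-Minkowski
    inequality the section at relative height [t] between [F(K,-u)] and
    [F(K,u)] has volume at least [((1 - t) g + t f)^(n-1)], where [f^(n-1)] and
    [g^(n-1)] are the volumes of [F(K,u)] and [F(K,-u)]. Integrating over the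
    height gives [1 >= (h_K(u) + h_K(-u)) / n * sum_i f^(n-1-i) g^i], and the
    right-hand side is the value at [rho = sqrt (f / g)] of the function that
    [phi] minimizes. Equality forces equality in Brunn-Minkowski, hence
    homothetic faces, and sections that are Minkowski combinations of the
    faces.

    The Brunn-Minkowski inequality and its equality case are proved by induction
    on the dimension, following Kneser and Suess: for bodies of volume one,
    transport the heights of the first to those of the second so that the
    volumes below agree, and compare the volumes of the sections of the
    Minkowski combination. In the equality case corresponding sections are
    translates of each other by the induction hypothesis, and a midpoint
    inequality for a coordinate of the translation vector telescopes along
    arithmetic progressions, which makes this vector constant.

    Hausdorff measure is compared with volume by coverings: in dimension [d] it
    is at most a constant times the volume, for all sets, with equality for
    cubes; passing to complements in a cube gives equality for compact sets. As
    Hausdorff measure is invariant under isometries, so is volume. *)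

Require Import Defs.
From HB Require Import structures.
From mathcomp Require Import all_boot all_order all_algebra.
From mathcomp Require Import all_classical all_reals all_analysis.
From mathcomp Require Import measurable_realfun ring lra.

Set Implicit Arguments.
Unset Strict Implicit.
Unset Printing Implicit Defensive.

Import Order.TTheory GRing.Theory Num.Theory.
Import numFieldNormedType.Exports.

Local Open Scope classical_set_scope.
Local Open Scope ring_scope.

(** * Outer measures from coverings *)

(** Since volume is an outer measure built from boxes, Fubini enters only through two inequalities,
    for constant bounds on the sections. They suffice because the volume below a height is
    differentiated rather than computed as an integral: where the section volume is continuous, it
    is the derivative. Continuity on the open range of heights comes from Brunn-Minkowski one
    dimension lower, which makes a root of the section volume concave. Comparisons of integrals thus
    become monotonicity of a difference of two functions, and equality becomes constancy of that
    difference. The equality case of Brunn-Minkowski is carried only for the midpoint of two bodies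
    of equal volume: for the faces of [K], one height is chosen at which the section is such a
    midpoint of rescaled faces. A reflection exchanging [u] with the first basis vector makes the
    cutting direction vertical; being a linear involution, it moves faces and hulls back and forth
    by one formula. Dimensions are written [d.+1] or [d.+2] because covering by boxes degenerates in
    dimension zero. *)

Section cover_outer.
Context {R : realType} {T J : Type} (P : set J) (g : J -> \bar R)
  (S : J -> set T).
Hypothesis g_ge0 : forall j, P j -> (0 <= g j)%E.

(** Common form of [volume] (boxes with ordered corners) and of [hausdorff_delta] (sets of small
    diameter), so that countable subadditivity is proved once. *)
Definition cover_outer (A : set T) : \bar R :=
  ereal_inf [set (\sum_(k <oo) g (j k))%E
    | j in [set j : nat -> J |
        (forall k, P (j k)) /\ A `<=` \bigcup_k S (j k)]].

Lemma cover_outer_ge0 A : (0 <= cover_outer A)%E.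
Proof.
apply: le_ereal_inf_tmp => _ [j [Pj _] <-].
by apply: nneseries_ge0 => k _ _; exact: g_ge0.
Qed.

Lemma le_cover_outer A B : A `<=` B -> (cover_outer A <= cover_outer B)%E.
Proof.
move=> AB; apply: ereal_inf_le_tmp => _ [j [Pj BS] <-].
by exists j => //; split => //; exact: subset_trans AB BS.
Qed.

Lemma cover_outer_le (j : nat -> J) A : (forall k, P (j k)) ->
  A `<=` \bigcup_k S (j k) -> (cover_outer A <= \sum_(k <oo) g (j k))%E.
Proof. by move=> Pj AS; apply: ereal_inf_lbound; exists j. Qed.

Lemma cover_outer_sigma_subadditive (A : set T) (F : (set T)^nat) :
  A `<=` \bigcup_n F n ->
  (cover_outer A <= \sum_(n <oo) cover_outer (F n))%E.
Proof.
move=> AF; apply: (le_trans (le_cover_outer AF)) => {A AF}.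
(* A covering within a prescribed error exists only for a finite infimum, so an infinite term is
   treated apart. *)
have [[i ioo]|] := pselect (exists i, cover_outer (F i) = +oo%E).
  rewrite (eseries_pinfty _ _ ioo) ?leey// => n _.
  by rewrite -ltNye (lt_le_trans _ (cover_outer_ge0 _)).
rewrite -forallNE => Foo.
apply/lee_addgt0Pr => _/posnumP[e].
rewrite (le_trans _ (epsilon_trick _ _ _))//; last first.
  by move=> n; exact: cover_outer_ge0.
pose Q n (j : nat -> J) := [/\ forall k, P (j k), F n `<=` \bigcup_k S (j k) &
  (\sum_(k <oo) g (j k) <=
     cover_outer (F n) + (e%:num / (2 ^ n.+1)%:R)%:E)%E].
have [G PG] : {G : nat -> nat -> J & forall n, Q n (G n)}.
  apply: (@choice _ _ Q) => n.
  have en1 : (0 < e%:num / (2 ^ n.+1)%:R)%R by [].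
  have fF : cover_outer (F n) \is a fin_num.
    rewrite fin_numE; apply/andP; split; apply/eqP => F0; last exact: Foo F0.
    by have := cover_outer_ge0 (F n); rewrite F0.
  have [_ [j [Pj Fj] <-] jF] := lb_ereal_inf_adherent en1 fF.
  by exists j; split => //; exact/ltW.
have G_ge0 x : (0 <= (g \o uncurry G) x)%E.
  by case: x => a b; apply: g_ge0; have [Pa _ _] := PG a; exact: Pa.
apply: (@le_trans _ _ (\esum_(i in setT) (g \o uncurry G) i)).
  (* The chosen coverings form a family indexed by pairs, enumerated along a bijection of [nat] with
     [nat * nat]. *)
  have /card_esym/ppcard_eqP[f] := card_nat2.
  have -> : \esum_(i in setT) (g \o uncurry G) i =
      (\sum_(k <oo) g ((uncurry G \o f) k))%E.
    apply/esym.
    rewrite -(esum_pred_image (g \o uncurry G) _ xpredT) ?[fun=> _]set_true//.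
    by rewrite image_eq.
  apply: cover_outer_le => [k|t [i _ Fit]].
    by rewrite /=; case: (f k) => a b /=; have [Pa _ _] := PG a; exact: Pa.
  have [_ /(_ _ Fit)[k _ Skt] _] := PG i.
  by exists (f^-1%FUN (i, k)) => //=; rewrite invK ?inE.
rewrite (_ : esum _ _ = (\sum_(i <oo) \sum_(j <oo ) g (G i j))%E); last first.
  pose I : nat -> set (nat * nat) := fun i => [set (i, j) | j in setT].
  rewrite (_ : setT = \bigcup_k I k); last first.
    by rewrite predeqE => -[a b]; split => // _; exists a => //; exists b.
  rewrite esum_bigcupT /=; last 2 first.
    - apply/trivIsetP => i j _ _ ij.
      rewrite predeqE => -[n m] /=; split => //= -[] [_] _ [<-{n} _].
      by move=> [m' _] [] /esym/eqP; rewrite (negbTE ij).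
    - by move=> x; apply: G_ge0.
  rewrite -(image_id [set: nat]) -fun_true esum_pred_image//; last first.
    by move=> n _; apply: esum_ge0 => x _; exact: G_ge0.
  apply: eq_eseriesr => /= j _.
  rewrite -(esum_pred_image (g \o uncurry G) (pair j) predT)//=; last 2 first.
    by move=> n _; exact: (G_ge0 (j, n)).
    by move=> ? ? _ _; exact: (@can_inj _ _ _ snd).
  by congr esum; rewrite predeqE => -[a b]; split; move=> [i _ <-]; exists i.
apply: lee_nneseries => [n _ _|n _].
  by apply: nneseries_ge0 => m _ _; exact: (G_ge0 (n, m)).
by have [_ _] := PG n.
Qed.

End cover_outer.

(** * Volume *)

Definition ordered_corners {R : realType} {n} : set ('rV[R]_n * 'rV[R]_n) :=
  [set ab : 'rV[R]_n * 'rV[R]_n | forall i, ab.1 ord0 i <= ab.2 ord0 i].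

Definition box_size {R : realType} {n} (ab : 'rV[R]_n * 'rV[R]_n) : R :=
  \prod_i (ab.2 ord0 i - ab.1 ord0 i).

Definition set_coord {R : realType} {n} (a : 'rV[R]_n) (i : 'I_n) (c : R)
  : 'rV[R]_n := \row_j if j == i then c else a ord0 j.

Section volume_theory.
Context {R : realType}.

Lemma box_size_ge0 n (ab : 'rV[R]_n * 'rV[R]_n) :
  ordered_corners ab -> (0 <= (box_size ab)%:E)%E.
Proof. by move=> o; rewrite lee_fin prodr_ge0// => i _; rewrite subr_ge0. Qed.

Lemma volumeE n : @volume R n = cover_outer ordered_corners
  (fun ab => (box_size ab)%:E) (fun ab => box ab.1 ab.2).
Proof. by []. Qed.

Lemma volume_le n (ab : ('rV[R]_n * 'rV[R]_n)^nat) A :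
  (forall k, ordered_corners (ab k)) ->
  A `<=` \bigcup_k box (ab k).1 (ab k).2 ->
  (volume A <= \sum_(k <oo) (box_size (ab k))%:E)%E.
Proof. by rewrite volumeE; exact: cover_outer_le. Qed.

Lemma volume_ge n (x : \bar R) (A : set 'rV[R]_n) :
  (forall ab : ('rV[R]_n * 'rV[R]_n)^nat, (forall k, ordered_corners (ab k)) ->
    A `<=` \bigcup_k box (ab k).1 (ab k).2 ->
    (x <= \sum_(k <oo) (box_size (ab k))%:E)%E) -> (x <= volume A)%E.
Proof. by move=> H; apply: le_ereal_inf_tmp => _ [ab [oab Aab] <-]; exact: H. Qed.

Lemma volume_ge0 n (A : set 'rV[R]_n) : (0 <= volume A)%E.
Proof. by rewrite volumeE; apply: cover_outer_ge0; exact: box_size_ge0. Qed.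

Lemma le_volume n (A B : set 'rV[R]_n) :
  A `<=` B -> (volume A <= volume B)%E.
Proof. by rewrite !volumeE; exact: le_cover_outer. Qed.

Lemma volume_sigma_subadditive n (A : set 'rV[R]_n) (F : (set 'rV[R]_n)^nat) :
  A `<=` \bigcup_k F k -> (volume A <= \sum_(k <oo) volume (F k))%E.
Proof. by rewrite volumeE; apply: cover_outer_sigma_subadditive; exact: box_size_ge0. Qed.

Lemma nneseries_head (f : nat -> \bar R) : (0 <= f 0%N)%E ->
  (forall k, f k.+1 = 0%E) -> (\sum_(k <oo) f k = f 0%N)%E.
Proof.
move=> f0 fS; rewrite nneseries_recl//; last by case=> // k _; rewrite fS.
by rewrite eseries0 ?adde0// => -[//|k] _ _.
Qed.

(* False in dimension [0]: every box is then a point of box size [1], so that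
   [volume] is [+oo] everywhere. *)
Lemma volume_box_le d (a b : 'rV[R]_d.+1) : ordered_corners (a, b) ->
  (volume (box a b) <= (box_size (a, b))%:E)%E.
Proof.
(* A covering is an infinite sequence: the box is followed by copies of the degenerate box [(a, a)],
   of size zero. *)
move=> ab; pose F k := if k is 0%N then (a, b) else (a, a).
rewrite -[leRHS](@nneseries_head (fun k => (box_size (F k))%:E)); last 2 first.
- exact: box_size_ge0.
- by move=> k; rewrite /box_size big_ord_recl/= subrr mul0r.
apply: volume_le => [[]//|x abx]; last by exists 0%N.
by move=> k i /=.
Qed.

Lemma volume0 d : volume (set0 : set 'rV[R]_d.+1) = 0%E.
Proof.
apply/eqP; rewrite eq_le volume_ge0 andbT.
apply: le_trans (le_volume (sub0set (box 0 0))) _.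
apply: le_trans (volume_box_le _) _ => [i //|].
by rewrite /box_size big_ord_recl/= subrr mul0r.
Qed.

HB.instance Definition _ d := isOuterMeasure.Build R 'rV[R]_d.+1 (@volume R d.+1)
  (@volume0 d) (@volume_ge0 d.+1) (@le_volume d.+1)
  (fun F => @volume_sigma_subadditive d.+1 _ F (@subset_refl _ _)).

Lemma volume_image_le n (A : set 'rV[R]_n) (r : R) (x : 'rV[R]_n) : 0 < r ->
  (volume [set (r *: y + x)%R | y in A] <= (r ^+ n)%:E * volume A)%E.
Proof.
move=> r0; rewrite -lee_pdivrMl ?exprn_gt0//.
apply: volume_ge => ab oab Aab; rewrite lee_pdivrMl ?exprn_gt0//.
rewrite -nneseriesZl; last by move=> k _; exact: box_size_ge0.
pose F k := (r *: (ab k).1 + x, r *: (ab k).2 + x).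
rewrite [leRHS](_ : _ = (\sum_(k <oo) (box_size (F k))%:E)%E).
  apply: volume_le => [k i|_ [y Ay <-]].
    by rewrite /= !mxE lerD2r ler_wpM2l ?(ltW r0)//; exact: oab.
  have [k _ ky] := Aab _ Ay; exists k => // i; rewrite /= !mxE !lerD2r.
  by rewrite !ler_pM2l//; exact: ky.
apply: eq_eseriesr => k _; rewrite -EFinM; congr EFin.
rewrite /box_size -[X in r ^+ X]card_ord -prodr_const -big_split/=.
by apply: eq_bigr => i _; rewrite /= !mxE; ring.
Qed.

Lemma image_homothetyK n (A : set 'rV[R]_n) (r : R) (x : 'rV[R]_n) : r != 0 ->
  [set r^-1 *: y + - (r^-1 *: x) | y in [set r *: y + x | y in A]] = A.
Proof.
move=> r0; rewrite image_comp (_ : _ \o _ = id) ?image_id//.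
by apply/funext => y /=; rewrite scalerDr scalerA mulVf// scale1r addrK.
Qed.

(** The reverse inequality is [volume_image_le] for the inverse homothety. *)
Lemma volume_homothety n (A : set 'rV[R]_n) (r : R) (x : 'rV[R]_n) : 0 < r ->
  volume [set r *: y + x | y in A] = ((r ^+ n)%:E * volume A)%E.
Proof.
move=> r0; apply/eqP; rewrite eq_le volume_image_le//=.
rewrite -lee_pdivlMl ?exprn_gt0// -exprVn.
rewrite -[X in (volume X <= _)%E](image_homothetyK _ x (lt0r_neq0 r0)).
by apply: volume_image_le; rewrite invr_gt0.
Qed.

Lemma halfspace_caratheodory d (i : 'I_d.+1) (c : R) :
  (@volume R d.+1).-caratheodory [set x : 'rV[R]_d.+1 | x ord0 i <= c].
Proof.
apply: le_caratheodory_measurable => X.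
apply: volume_ge => ab oab Xab.
(* Each covering box is cut at height [c], clamped to the box: if the hyperplane misses it, one of
   the two parts is degenerate and has size zero. *)
pose m k := Num.max ((ab k).1 ord0 i) (Num.min ((ab k).2 ord0 i) c).
pose l k := ((ab k).1, set_coord (ab k).2 i (m k)).
pose r k := (set_coord (ab k).1 i (m k), (ab k).2).
have ol k : ordered_corners (l k).
  move=> j; rewrite /= !mxE; case: eqP => [->|_]; last exact: oab.
  by rewrite /m le_max lexx.
have or k : ordered_corners (r k).
  move=> j; rewrite /= !mxE; case: eqP => [->|_]; last exact: oab.
  by rewrite /m ge_max oab/= ge_min lexx.
have lr k : box_size (ab k) = box_size (l k) + box_size (r k).
  have bD (p : 'rV[R]_d.+1 * 'rV[R]_d.+1) : box_size p =
      (p.2 ord0 i - p.1 ord0 i) *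
      \prod_(j | j != i) (p.2 ord0 j - p.1 ord0 j).
    by rewrite /box_size (bigD1 i).
  have eqD (p q : 'rV[R]_d.+1 * 'rV[R]_d.+1) :
      (forall j, j != i -> p.1 ord0 j = q.1 ord0 j /\
        p.2 ord0 j = q.2 ord0 j) ->
      \prod_(j | j != i) (p.2 ord0 j - p.1 ord0 j) =
      \prod_(j | j != i) (q.2 ord0 j - q.1 ord0 j).
    by move=> pq; apply: eq_bigr => j /pq[-> ->].
  rewrite !bD (eqD (l k) (ab k)); last first.
    by move=> j /negbTE ji; rewrite !mxE ji.
  rewrite (eqD (r k) (ab k)); last first.
    by move=> j /negbTE ji; rewrite !mxE ji.
  rewrite /= !mxE eqxx; ring.
under eq_eseriesr do rewrite lr EFinD.
rewrite nneseriesD; last 2 first.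
- by move=> k _ _; exact: box_size_ge0.
- by move=> k _ _; exact: box_size_ge0.
apply: leeD; apply: volume_le => // x [Xx /= xc]; have [k _ kx] := Xab _ Xx;
  exists k => // j; rewrite /= mxE; case: eqP => [->|_]; try exact: kx.
- have /andP[-> xb] := kx i; rewrite /=.
  by rewrite /m le_max le_min xb xc orbT.
- have /andP[xa ->] := kx i; rewrite andbT.
  move/negP: xc; rewrite -ltNge => /ltW xc.
  by rewrite /m ge_max xa/= ge_min xc orbT.
Qed.

Lemma halfspace_ge_caratheodory d (i : 'I_d.+1) (c : R) :
  (@volume R d.+1).-caratheodory [set x : 'rV[R]_d.+1 | c <= x ord0 i].
Proof.
have -> : [set x : 'rV[R]_d.+1 | c <= x ord0 i] =
    \bigcap_k [set x : 'rV[R]_d.+1 | c - k.+1%:R^-1 < x ord0 i].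
  apply/seteqP; split => x /=.
    by move=> cx k _ /=; rewrite ltrBlDr (le_lt_trans cx)// ltrDl.
  move=> cx; rewrite leNgt; apply/negP => xc.
  have e0 : 0 < c - x ord0 i by rewrite subr_gt0.
  have [k _ /(_ k (leqnn _))/= ke] := near_infty_natSinv_lt (PosNum e0).
  have /= := cx k I; rewrite ltrBlDr -ltrBlDl => /(lt_trans ke).
  by rewrite ltxx.
rewrite -[X in _.-caratheodory X]setCK; apply: caratheodory_measurable_setC.
rewrite setC_bigcap; apply: caratheodory_measurable_bigcup => k.
rewrite (_ : ~` _ = [set x : 'rV[R]_d.+1 | x ord0 i <= c - k.+1%:R^-1]).
  exact: halfspace_caratheodory.
by apply/seteqP; split => x /=; rewrite leNgt => /negP.
Qed.

Lemma slab_caratheodory d (i : 'I_d.+1) (a b : R) :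
  (@volume R d.+1).-caratheodory [set x : 'rV[R]_d.+1 | a <= x ord0 i <= b].
Proof.
rewrite (_ : mkset _ =
    [set x : 'rV[R]_d.+1 | a <= x ord0 i] `&` [set x | x ord0 i <= b]); last first.
  by apply/seteqP; split => x /= => [/andP[]//|[-> ->]].
apply: caratheodory_measurable_setI; first exact: halfspace_ge_caratheodory.
exact: halfspace_caratheodory.
Qed.

Lemma box_caratheodory d (a b : 'rV[R]_d.+1) :
  (@volume R d.+1).-caratheodory (box a b).
Proof.
(* The finite intersection of slabs is written as a countable one, padded with [setT]. *)
pose F (k : nat) : set 'rV[R]_d.+1 :=
  if insub k is Some i then [set x : 'rV[R]_d.+1 | a ord0 i <= x ord0 i <= b ord0 i]
  else setT.
have -> : box a b = \bigcap_k F k.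
  apply/seteqP; split => x /= xab.
    by move=> k _; rewrite /F; case: insubP => [i _ _|//]; exact: xab.
  by move=> i; have := xab i I; rewrite /F valK.
rewrite -[X in _.-caratheodory X]setCK; apply: caratheodory_measurable_setC.
rewrite setC_bigcap; apply: caratheodory_measurable_bigcup => k.
apply: caratheodory_measurable_setC; rewrite /F; case: insub => [i|].
  exact: slab_caratheodory.
by rewrite -setC0; apply: caratheodory_measurable_setC;
  exact: caratheodory_measurable_set0.
Qed.

(** An open set is the union of the countably many cubes with rational centre and radius
    [k.+1%:R^-1] that it contains. *)
Lemma open_caratheodory d (U : set 'rV[R]_d.+1) : open U ->
  (@volume R d.+1).-caratheodory U.
Proof.
move=> oU.
pose B (p : 'rV[rat]_d.+1 * nat) : set 'rV[R]_d.+1 :=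
  box (\row_i (ratr (p.1 ord0 i) - p.2.+1%:R^-1))
      (\row_i (ratr (p.1 ord0 i) + p.2.+1%:R^-1)).
pose F k : set 'rV[R]_d.+1 := if unpickle k is Some p then
  (if pselect (B p `<=` U) then B p else set0) else set0.
have -> : U = \bigcup_k F k.
  apply/seteqP; split => x; last first.
    move=> [k _]; rewrite /F; case: unpickle => // p.
    by case: pselect => // BU /BU.
  move=> Ux; have /nbhs_ballP[e /= e0 eU] := open_nbhs_nbhs (conj oU Ux).
  (* Half of [e], because the radius of the cube and the distance from its centre to [x] add up. *)
  have [k _ /(_ k (leqnn _))/= ke] :=
    near_infty_natSinv_lt (PosNum (divr_gt0 e0 (ltr0Sn R 1))).
  have k0 : 0 < k.+1%:R^-1 :> R by [].
  have /choice[q qx] i : exists q : rat, `|ratr q - x ord0 i| < k.+1%:R^-1.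
    have [] := @rat_in_itvoo R (x ord0 i) (x ord0 i + k.+1%:R^-1).
      by rewrite ltrDl.
    move=> q; rewrite in_itv/= => /andP[q1 q2]; exists q.
    by rewrite ger0_norm ?subr_ge0 ?(ltW q1)// ltrBlDl.
  exists (pickle (\row_i q i : 'rV[rat]_d.+1, k)) => //.
  rewrite /F pickleK; case: pselect => [_ i|].
    rewrite !mxE/=; have := qx i; rewrite ltr_norml.
    by move: (ratr _) (_^-1) => r s /andP[q1 q2]; apply/andP; split; lra.
  move=> /= nBU; exfalso; apply: nBU => y By; apply: eU; split => // i j.
  rewrite (_ : i = ord0); last by rewrite [LHS]ord1.
  have := By j; rewrite !mxE/= => /andP[y1 y2].
  have := qx j; rewrite ltr_norml; move: (ratr _) (_^-1) ke y1 y2 => r s.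
  move=> /= ke y1 y2 /andP[q1 q2].
  by rewrite /ball/= ltr_norml; apply/andP; split; lra.
apply: caratheodory_measurable_bigcup => k; rewrite /F.
case: unpickle => [p|]; last exact: caratheodory_measurable_set0.
case: pselect => ? /=; last exact: caratheodory_measurable_set0.
exact: box_caratheodory.
Qed.

Lemma closed_caratheodory d (A : set 'rV[R]_d.+1) : closed A ->
  (@volume R d.+1).-caratheodory A.
Proof.
move=> cA; rewrite -[A]setCK; apply: caratheodory_measurable_setC.
by apply: open_caratheodory; exact: closed_openC.
Qed.

End volume_theory.

(** * Sections and Fubini inequalities *)

Section sections.
Context {R : realType} {d : nat}.
Implicit Types (t : R) (y : 'rV[R]_d) (x : 'rV[R]_d.+1) (A : set 'rV[R]_d.+1).

(** The first coordinate serves as the height throughout. *)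
Definition vcons t y : 'rV[R]_d.+1 := \row_i
  (if unlift ord0 i is Some j then y ord0 j else t).

Definition vtail x : 'rV[R]_d := \row_j x ord0 (lift ord0 j).

Definition sect A t : set 'rV[R]_d := [set y | A (vcons t y)].

Lemma vcons0E t y : vcons t y ord0 ord0 = t.
Proof. by rewrite mxE unlift_none. Qed.

Lemma vconsSE t y (j : 'I_d) : vcons t y ord0 (lift ord0 j) = y ord0 j.
Proof. by rewrite mxE liftK. Qed.

Lemma vcons_tail x : vcons (x ord0 ord0) (vtail x) = x.
Proof.
apply/rowP => i; case: (unliftP ord0 i) => [j|] ->; last by rewrite vcons0E.
by rewrite vconsSE mxE.
Qed.

Lemma vtail_cons t y : vtail (vcons t y) = y.
Proof. by apply/rowP => j; rewrite mxE vconsSE. Qed.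

Lemma vcons_add t y t' y' : vcons (t + t') (y + y') = vcons t y + vcons t' y'.
Proof.
apply/rowP => i; case: (unliftP ord0 i) => [j|] ->; rewrite !mxE.
  by rewrite liftK mxE.
by rewrite unlift_none.
Qed.

Lemma vcons_scale (r : R) t y : vcons (r * t) (r *: y) = r *: vcons t y.
Proof.
apply/rowP => i; case: (unliftP ord0 i) => [j|] ->; rewrite !mxE.
  by rewrite liftK mxE.
by rewrite unlift_none.
Qed.

Lemma vtail_add x x' : vtail (x + x') = vtail x + vtail x'.
Proof. by apply/rowP => j; rewrite !mxE. Qed.

Lemma vtail_scale (r : R) x : vtail (r *: x) = r *: vtail x.
Proof. by apply/rowP => j; rewrite !mxE. Qed.

Lemma sectP A x : sect A (x ord0 ord0) (vtail x) <-> A x.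
Proof. by rewrite /sect/= vcons_tail. Qed.

Lemma box_consP (a b x : 'rV[R]_d.+1) : box a b x <->
  a ord0 ord0 <= x ord0 ord0 <= b ord0 ord0 /\
  box (vtail a) (vtail b) (vtail x).
Proof.
split=> [abx|[x0 xS] i]; first by split => [|j]; rewrite ?mxE; exact: abx.
case: (unliftP ord0 i) => [j|] ->//.
by have := xS j; rewrite !mxE.
Qed.

Lemma box_sizeS (a b : 'rV[R]_d.+1) : box_size (a, b) =
  (b ord0 ord0 - a ord0 ord0) * box_size (vtail a, vtail b).
Proof.
rewrite /box_size big_ord_recl; congr (_ * _).
by apply: eq_bigr => j _; rewrite !mxE.
Qed.

End sections.

Section fubini.
Context {R : realType}.
Local Notation leb := (@lebesgue_measure R).

Lemma lebesgue_segment (a b : R) : a <= b -> leb `[a, b]%classic = (b - a)%:E.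
Proof.
move=> ab; rewrite lebesgue_measure_itv/= lte_fin; case: ltP => // ba.
by rewrite (_ : b = a) ?subrr//; apply/eqP; rewrite eq_le ba ab.
Qed.

Lemma box_sizeS_ge0 d (ab : 'rV[R]_d.+1 * 'rV[R]_d.+1) : ordered_corners ab ->
  0 <= box_size (vtail ab.1, vtail ab.2).
Proof.
move=> oab; rewrite -lee_fin; apply: box_size_ge0 => j.
by rewrite !mxE; exact: oab.
Qed.

(** The half of Fubini that coverings give directly: the boxes met at height [t] cover the section,
    so [c] is at most a sum of weighted indicators of intervals, and this sum is integrated over the
    heights. *)
Lemma volume_sect_ge d (A : set 'rV[R]_d.+2) (c s s' : R) : 0 <= c -> s <= s' ->
  (forall t, s <= t <= s' -> (c%:E <= volume (sect A t))%E) ->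
  ((c * (s' - s))%:E <= volume A)%E.
Proof.
move=> c0 ss' cA; apply: volume_ge => ab oab Aab.
pose q k := box_size (vtail (ab k).1, vtail (ab k).2).
pose I k := `[(ab k).1 ord0 ord0, (ab k).2 ord0 ord0]%classic.
have q0 k : 0 <= q k by exact: box_sizeS_ge0.
pose g k t := ((q k)%:E * (\1_(I k) t)%:E)%E.
have g0 k t : (0 <= g k t)%E by rewrite mule_ge0 ?lee_fin.
have mI k : measurable (I k) by exact: measurable_itv.
have m1 k (D : set R) : measurable_fun D (fun t : R => (\1_(I k) t)%:E).
  by apply/measurable_EFinP; exact: measurable_indic.
have mg k (D : set R) : measurable_fun D (g k) by exact: measurable_funeM.
have cg t : s <= t <= s' -> (c%:E <= \sum_(k <oo) g k t)%E.
  move=> /cA /le_trans; apply.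
  (* Boxes not met at height [t] are collapsed to a corner, which has size zero because sections
     have positive dimension. *)
  pose F k := (vtail (ab k).1,
    if t \in I k then vtail (ab k).2 else vtail (ab k).1).
  rewrite [leRHS](_ : _ = (\sum_(k <oo) (box_size (F k))%:E)%E).
    apply: volume_le => [k j|y Ay].
      by rewrite /=; case: ifP => // _; rewrite !mxE; exact: oab.
    have [k _ /box_consP[]] := Aab _ Ay.
    rewrite vcons0E vtail_cons => tk yk; exists k => //=.
    by rewrite mem_set.
  apply: eq_eseriesr => k _; rewrite /g -EFinM; congr EFin.
  rewrite indicE /F; case: ifP => _; first by rewrite mulr1.
  by rewrite mulr0 /box_size big_ord_recl/= subrr mul0r.
apply: (@le_trans _ _ (\int[leb]_(t in `[s, s']%classic)
    (\sum_(k <oo) g k t))%E).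
  rewrite EFinM -(lebesgue_segment ss') -integral_cst//.
  apply: ge0_le_integral => //.
  by apply: (@ge0_emeasurable_sum _ _ _ _ g) => // k t _ _; exact: g0.
rewrite integral_nneseries//.
apply: lee_nneseries => [k _ _|k _]; first exact: integral_ge0.
rewrite ge0_integralZl_EFin//; last first.
  exact: m1.
have -> : box_size (ab k) = q k *
    ((ab k).2 ord0 ord0 - (ab k).1 ord0 ord0).
  by rewrite mulrC /q -box_sizeS -surjective_pairing.
rewrite integral_indic//; last exact: mI.
rewrite EFinM.
apply: lee_wpmul2l; first by rewrite lee_fin.
rewrite -lebesgue_segment; last exact: oab.
apply: (@le_measure _ _ _ leb _ _ _ _ (@subIsetl _ (I k) _)).
  rewrite inE; apply: measurableI; [exact: mI | exact: measurable_itv].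
  by rewrite inE; exact: mI.
by move=> k; exact: mg.
Qed.

(** In dimension one this is countable subadditivity of Lebesgue measure on the line; it starts the
    induction of [volume_box]. *)
Lemma volume_box1_ge (a b : 'rV[R]_1) : ordered_corners (a, b) ->
  ((b ord0 ord0 - a ord0 ord0)%:E <= volume (box a b))%E.
Proof.
move=> oab; apply: volume_ge => cd ocd abcd.
rewrite -lebesgue_segment; last exact: oab.
pose F k := `[(cd k).1 ord0 ord0, (cd k).2 ord0 ord0]%classic.
apply: (@le_trans _ _ (\sum_(k <oo) leb (F k))%E).
  apply: measure_sigma_subadditive; try by move=> *; exact: measurable_itv.
  move=> t /=; rewrite in_itv/= => tab.
  have : box a b (const_mx t).
    by move=> i; rewrite mxE (ord1 i); exact: tab.
  by move=> /abcd[k _ /(_ ord0)]; rewrite mxE => tk; exists k.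
rewrite le_eqVlt; apply/orP; left; apply/eqP; apply: eq_eseriesr => k _.
by rewrite lebesgue_segment ?/box_size ?big_ord1//; exact: ocd.
Qed.

Lemma sect_box d (a b : 'rV[R]_d.+1) t :
  a ord0 ord0 <= t <= b ord0 ord0 -> sect (box a b) t = box (vtail a) (vtail b).
Proof.
move=> tab; apply/seteqP; split => y.
  by move=> /box_consP[_]; rewrite vtail_cons.
by move=> yab; apply/box_consP; rewrite vcons0E vtail_cons.
Qed.

Lemma volume_box d (a b : 'rV[R]_d.+1) : ordered_corners (a, b) ->
  volume (box a b) = (box_size (a, b))%:E.
Proof.
move=> oab; apply/eqP; rewrite eq_le volume_box_le//=.
elim: d => [|d IH] in a b oab *.
  by rewrite {1}/box_size big_ord1/=; exact: volume_box1_ge.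
rewrite box_sizeS mulrC; apply: volume_sect_ge.
- exact: (@box_sizeS_ge0 _ (a, b)).
- exact: oab.
- move=> t tab; rewrite sect_box//; apply: IH => j.
  by rewrite /= !mxE; exact: oab.
Qed.

End fubini.

(** * Compact sets, real-valued volume and the upper Fubini inequality *)

Definition cube {R : realType} n (M : R) : set 'rV[R]_n :=
  box (const_mx (- M)) (const_mx M).
Arguments cube {R} n M _.

Section compact_sets.
Context {R : realType}.

Lemma rV_norm_le n (x : 'rV[R]_n) e : 0 <= e ->
  (forall i, `|x ord0 i| <= e) -> `|x| <= e.
Proof.
move=> e0 xe; rewrite -[leLHS]/(mx_norm x) mx_normrE; apply/bigmax_leP; split => // -[i j] _.
by rewrite /= (ord1 i); exact: xe.
Qed.

Lemma coord_le_norm n (x : 'rV[R]_n) i : `|x ord0 i| <= `|x|.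
Proof.
rewrite -[leRHS]/(mx_norm x) mx_normrE; apply/bigmax_geP; right => /=.
by exists (ord0, i).
Qed.

Lemma lipschitz_continuous (V W : normedModType R) (f : V -> W) (C : R) :
  (forall x y, `|f x - f y| <= C * `|x - y|) -> continuous f.
Proof.
move=> fC x; apply/cvgrPdist_le => e e0.
have C0 : 0 < `|C| + 1 by rewrite ltr_wpDl.
near=> y; apply: le_trans (fC x y) _.
apply: (@le_trans _ _ ((`|C| + 1) * `|x - y|)).
  by rewrite ler_wpM2r// (le_trans (ler_norm C))// lerDl.
rewrite -ler_pdivlMl//; near: y.
by apply: cvgr_dist_le; [exact: cvg_id | rewrite mulr_gt0// invr_gt0].
Unshelve. all: by end_near. Qed.

Lemma coord_continuous n (i : 'I_n) : continuous (fun x : 'rV[R]_n => x ord0 i).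
Proof.
apply: (@lipschitz_continuous _ R^o _ 1) => x y; rewrite mul1r.
by apply: le_trans (coord_le_norm _ i); rewrite !mxE.
Qed.

Lemma vcons_continuous d t : continuous (@vcons R d t).
Proof.
apply: (@lipschitz_continuous _ _ _ 1) => x y; rewrite mul1r.
apply: rV_norm_le => // i; case: (unliftP ord0 i) => [j|] ->; rewrite !mxE.
  by rewrite liftK; apply: le_trans (coord_le_norm _ j); rewrite !mxE.
by rewrite unlift_none subrr normr0.
Qed.

Lemma compact_rV_closed n (A : set 'rV[R]_n) : compact A -> closed A.
Proof. by apply: compact_closed; exact: norm_hausdorff. Qed.

Lemma compact_sub_cube n (A : set 'rV[R]_n) : compact A ->
  exists2 M, 0 < M & A `<=` cube n M.
Proof.
move=> /compact_bounded[M [_ AM]]; exists (`|M| + 1); first by rewrite ltr_wpDl.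
move=> x Ax i; rewrite !mxE -ler_norml.
apply: le_trans (coord_le_norm _ _) _; apply: AM Ax.
by rewrite (le_lt_trans (ler_norm M))// ltrDl.
Qed.

Lemma sub_cube_compact n (A : set 'rV[R]_n) M :
  closed A -> A `<=` cube n M -> compact A.
Proof.
move=> cA AM; apply: bounded_closed_compact => //.
exists `|M|; split; first exact: num_real.
move=> e Me x /AM xM; apply: rV_norm_le => [|i].
  by rewrite (le_trans _ (ltW Me)).
apply: le_trans (ltW Me); apply: le_trans (ler_norm M).
by have := xM i; rewrite !mxE ler_norml.
Qed.

Lemma closed_coord_le n (i : 'I_n) (c : R) : closed [set x : 'rV[R]_n | x ord0 i <= c].
Proof.
have /continuous_closedP := @coord_continuous n i.
by move=> /(_ _ (@closed_le R c)); exact.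
Qed.

Lemma closed_coord_ge n (i : 'I_n) (c : R) : closed [set x : 'rV[R]_n | c <= x ord0 i].
Proof.
have /continuous_closedP := @coord_continuous n i.
by move=> /(_ _ (@closed_ge R c)); exact.
Qed.

Lemma sect_closed d (A : set 'rV[R]_d.+1) t : closed A -> closed (sect A t).
Proof. by move: A; apply/continuous_closedP; exact: vcons_continuous. Qed.

Lemma sect_sub_cube d (A : set 'rV[R]_d.+1) t M :
  A `<=` cube d.+1 M -> sect A t `<=` cube d M.
Proof.
by move=> AM y /AM /box_consP[_]; rewrite vtail_cons => yM i; have := yM i;
  rewrite !mxE.
Qed.

Lemma sect_compact d (A : set 'rV[R]_d.+1) t : compact A -> compact (sect A t).
Proof.
move=> cA; have [M _ AM] := compact_sub_cube cA.
apply: (@sub_cube_compact _ _ M); last exact: sect_sub_cube.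
by apply: sect_closed; exact: compact_rV_closed.
Qed.

(** Real-valued volume, faithful on bounded sets by [sub_cube_volE]; an infinite volume would be
    sent to 0 by [fine]. *)
Definition vol n (A : set 'rV[R]_n) : R := fine (volume A).

Lemma vol_ge0 n (A : set 'rV[R]_n) : 0 <= vol A.
Proof. by rewrite /vol fine_ge0// volume_ge0. Qed.

Lemma volume_cube d (M : R) : 0 <= M -> volume (@cube R d.+1 M) = ((2 * M) ^+ d.+1)%:E.
Proof.
move=> M0; rewrite volume_box; last first.
  by move=> i; rewrite !mxE; lra.
congr EFin; rewrite /box_size -[X in _ ^+ X]card_ord -prodr_const.
by apply: eq_bigr => i _; rewrite !mxE; ring.
Qed.

Lemma sub_cube_volE d (A : set 'rV[R]_d.+1) M : 0 <= M -> A `<=` cube d.+1 M ->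
  volume A = (vol A)%:E.
Proof.
move=> M0 AM; rewrite /vol fineK// ge0_fin_numE ?volume_ge0//.
by apply: le_lt_trans (le_volume AM) _; rewrite volume_cube// ltry.
Qed.

Lemma volE d (A : set 'rV[R]_d.+1) : compact A -> volume A = (vol A)%:E.
Proof.
by move=> /compact_sub_cube[M M0]; apply: sub_cube_volE; exact: ltW.
Qed.

Lemma vol_split d (A X : set 'rV[R]_d.+1) : closed A ->
  volume X = (volume (X `&` A) + volume (X `\` A))%E.
Proof. by move=> cA; exact: (closed_caratheodory cA). Qed.

(** The lower inequality applied to the complement of [A] in a box [B], whose sections have volume
    at least [V - c]; additivity in [B] comes from the measurability of [A]. *)
Lemma volume_sect_le d (A : set 'rV[R]_d.+2) (c s s' : R) : compact A ->
  s <= s' -> (forall x, A x -> s <= x ord0 ord0 <= s') ->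
  (forall t, s <= t <= s' -> (volume (sect A t) <= c%:E)%E) ->
  (volume A <= (c * (s' - s))%:E)%E.
Proof.
move=> cA ss' Ass' Ac; have [M M0 AM] := compact_sub_cube cA.
pose a : 'rV[R]_d.+1 := const_mx (- M); pose b : 'rV[R]_d.+1 := const_mx M.
pose B := box (vcons s a) (vcons s' b).
have oB : ordered_corners (vcons s a, vcons s' b).
  move=> i; case: (unliftP ord0 i) => [j|] ->; rewrite !mxE ?liftK ?mxE.
    by lra.
  by rewrite unlift_none.
have AB : A `<=` B.
  move=> x Ax; apply/box_consP; rewrite !vcons0E !vtail_cons; split.
    exact: Ass'.
  by have /box_consP[_] := AM _ Ax => xM i; have := xM i; rewrite !mxE.
pose V := (2 * M) ^+ d.+1.
have VB : volume B = (V * (s' - s))%:E.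
  rewrite volume_box// box_sizeS !vcons0E !vtail_cons mulrC; congr (_ * _)%:E.
  apply: EFin_inj; rewrite -volume_box; first by rewrite volume_cube// ltW.
  by move=> i; rewrite !mxE; lra.
have VA : volume A = (vol A)%:E by exact: volE.
pose W := volume (B `\` A).
have WE : W = (vol (B `\` A))%:E.
  rewrite /vol fineK// ge0_fin_numE ?volume_ge0//.
  apply: (@le_lt_trans _ _ (volume B)); first by apply: le_volume => x [].
  by rewrite VB ltry.
have VBE : volume B = (volume A + W)%E.
  by rewrite (vol_split _ (compact_rV_closed cA)) setIidr.
(* The maximum with 0 meets the sign condition of [volume_sect_ge]. *)
have WV : ((Num.max 0 (V - c) * (s' - s))%:E <= W)%E.
  apply: volume_sect_ge => //; first by rewrite le_max lexx.
  move=> t tss; rewrite maxEle; case: ifP => _; last exact: volume_ge0.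
  rewrite EFinB leeBlDr//.
  have -> : V%:E = volume (cube d.+1 M) by rewrite volume_cube// ltW.
  rewrite (@vol_split _ (sect A t)); last first.
    by apply: sect_closed; exact: compact_rV_closed.
  rewrite addeC; apply: leeD.
    apply: le_volume => y [yM yA]; split => //.
    apply/box_consP; rewrite !vcons0E !vtail_cons; split => //.
  by apply: le_trans (Ac t tss); apply: le_volume => y [].
move: WV VBE; rewrite VB VA WE -EFinD !lee_fin => WV -[VBE].
have : (V - c) * (s' - s) <= Num.max 0 (V - c) * (s' - s).
  by rewrite ler_wpM2r ?subr_ge0// le_max lexx orbT.
by lra.
Qed.

Definition slab {n} (A : set 'rV[R]_n.+1) (s s' : R) : set 'rV[R]_n.+1 :=
  [set x | A x /\ s <= x ord0 ord0 <= s'].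

Definition below {n} (A : set 'rV[R]_n.+1) (t : R) : set 'rV[R]_n.+1 :=
  [set x | A x /\ x ord0 ord0 <= t].

Lemma slab_compact n (A : set 'rV[R]_n.+1) s s' : compact A -> compact (slab A s s').
Proof.
move=> cA; apply: subclosed_compact (cA) _ => [|x []//].
rewrite (_ : slab _ _ _ = A `&` ([set x | s <= x ord0 ord0] `&`
    [set x | x ord0 ord0 <= s'])).
  apply: closedI; first exact: compact_rV_closed.
  by apply: closedI; [exact: closed_coord_ge | exact: closed_coord_le].
by apply/seteqP; split => x /= [? /andP].
Qed.

Lemma below_compact n (A : set 'rV[R]_n.+1) t : compact A -> compact (below A t).
Proof.
move=> cA; apply: subclosed_compact (cA) _ => [|x []//].
by apply: closedI; [exact: compact_rV_closed | exact: closed_coord_le].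
Qed.

Lemma sect_slab n (A : set 'rV[R]_n.+1) s s' t : s <= t <= s' ->
  sect (slab A s s') t = sect A t.
Proof.
by move=> tss; apply/seteqP; split => y; rewrite /sect/slab/= vcons0E => // -[].
Qed.

Lemma vol_below_slab d (A : set 'rV[R]_d.+2) s s' : compact A -> s <= s' ->
  vol (below A s') - vol (below A s) = vol (slab A s s').
Proof.
move=> cA ss'; pose h := [set x : 'rV[R]_d.+2 | x ord0 ord0 <= s].
have ch : closed h by exact: closed_coord_le.
(* The two pieces overlap in a single section, which is a slab of thickness zero. *)
have h0 : volume (slab A s s' `&` h) = 0%E.
  apply/eqP; rewrite eq_le volume_ge0 andbT.
  have [M M0 AM] := compact_sub_cube cA.
  have -> : 0%E = ((2 * M) ^+ d.+1 * (s - s))%:E by rewrite subrr mulr0.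
  apply: volume_sect_le => //.
  - apply: (@subclosed_compact _ _ (slab A s s')); last by move=> x [].
      apply: closedI => //; apply: compact_rV_closed; exact: slab_compact.
    exact: slab_compact.
  - by move=> x [[_ /andP[-> _]]].
  - move=> t _; rewrite -volume_cube ?(ltW M0)//; apply: le_volume.
    by apply: sect_sub_cube => x [[/AM]].
have E1 := vol_split (below A s') ch.
have E2 := vol_split (slab A s s') ch.
have e1 : below A s' `&` h = below A s.
  apply/seteqP; split => [x [[? ?] ?]//|x [? xs]]; split => //.
  by split => //; exact: le_trans ss'.
have e2 : below A s' `\` h = slab A s s' `\` h.
  apply/seteqP; split => x [[xA xs] xh]; split => //; split => //.
    by rewrite xs andbT ltW// ltNge; apply/negP.
  by case/andP: xs.
move: E1 E2; rewrite e1 e2 h0 add0e /vol => -> <-.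
rewrite (volE (below_compact (t := s) cA)) (volE (slab_compact (s := s) (s' := s') cA))/=.
by rewrite addrAC subrr add0r.
Qed.

End compact_sets.

(** * Transport of heights *)

Section calculus.
Context {R : realType}.
Implicit Types (f g F : R -> R) (a b c s t x : R).

Lemma near_itvoo a b x : a < x < b -> \forall y \near x, a < y < b.
Proof.
move=> /andP[ax xb]; near=> y; apply/andP; split; near: y.
  exact: lt_nbhsr.
exact: lt_nbhsl.
Unshelve. all: by end_near. Qed.

Lemma is_derive_continuous f x d : is_derive x 1 f d -> {for x, continuous f}.
Proof. by case=> /derivable1_diffP/differentiable_continuous. Qed.

Lemma is_derive_ge0_ndecr f (df : R -> R) a b :
  (forall x, a < x < b -> is_derive x 1 f (df x)) ->
  (forall x, a < x < b -> 0 <= df x) ->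
  forall s t, a < s -> s <= t -> t < b -> f s <= f t.
Proof.
move=> fd d0 s t as_ st tb.
have fd' x : x \in `]a, b[ -> is_derive x 1 f (df x).
  by rewrite in_itv/= => /fd.
apply: (@ger0_derive1_le_oo _ f a b) => //; rewrite ?in_itv/=.
- by move=> x /fd' [].
- by move=> x xab; rewrite derive1E (@derive_val _ _ _ _ _ _ _ (fd' _ xab)) d0//;
    move: xab; rewrite in_itv.
- by move=> x /set_mem xab; exact: is_derive_continuous (fd' _ xab).
- by rewrite as_ (le_lt_trans st).
- by rewrite tb (lt_le_trans as_).
Qed.

Lemma is_derive_affine f x d a b : is_derive x 1 f d ->
  is_derive x 1 (fun y => a * y + b * f y) (a + b * d).
Proof.
move=> fd; have := is_deriveD (is_deriveZ a (is_derive_id x (1 : R)))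
  (is_deriveZ b fd).
by rewrite /GRing.scale/= mulr1.
Qed.

Lemma is_derive_sandwich F x v :
  (forall e, 0 < e ->
    \forall y \near x, `|F y - F x - v * (y - x)| <= e * `|y - x|) ->
  is_derive x 1 F v.
Proof.
move=> Fv.
have cF : h^-1 *: (F (h *: 1 + x) - F x) @[h --> 0^'] --> v.
  apply/cvgrPdist_le => e e0.
  have /nbhs_ballP[r /= r0 rF] := Fv _ e0.
  near=> h.
  have h0 : h != 0 by near: h; exact: nbhs_dnbhs_neq.
  have hr : `|h| < r.
    near: h; apply: dnbhs0_lt => //.
  rewrite /GRing.scale/= mulr1.
  have := rF (h + x); rewrite /ball/= opprD addrCA subrr addr0 normrN => /(_ hr).
  rewrite addrK => H.
  rewrite -(ler_pM2r (_ : 0 < `|h|)) ?normr_gt0// -normrM.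
  rewrite mulrBl mulrAC mulVf// mul1r distrC.
  by rewrite (_ : v * h = v * h).
apply: DeriveDef; first by apply/cvg_ex; exists v.
exact: cvg_lim cF.
Unshelve. all: by end_near. Qed.

End calculus.

Section transport.
Context {R : realType}.

(** This is [transport_jacobian_ge] for [x = 1] and [y = t], multiplied by [t ^+ p]. In the
    inductive step the two sides differ by a positive multiple of
    [l * (1 - l) * (t - 1) * (t ^+ p.+1 - 1)], whose last two factors have the same sign. *)
Lemma mean_power_ge (l t : R) p : 0 < l < 1 -> 0 < t ->
  t ^+ p <= (1 - l + l * t) ^+ p * ((1 - l) * t ^+ p + l).
Proof.
move=> /andP[l0 l1] t0; elim: p => [|p IH]; first by rewrite !expr0; lra.
have m0 : 0 < 1 - l + l * t by have := mulr_gt0 l0 t0; lra.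
rewrite 2!exprS; apply: le_trans (_ : t * ((1 - l + l * t) ^+ p *
  ((1 - l) * t ^+ p + l)) <= _); first by rewrite ler_pM2l.
rewrite mulrCA -mulrA (mulrCA (1 - l + _)) ler_pM2l ?exprn_gt0//.
rewrite -subr_ge0; set u := t ^+ p.
rewrite (_ : _ - _ = l * (1 - l) * ((t - 1) * (t * u - 1))); last by ring.
rewrite mulr_ge0//; first by rewrite mulr_ge0 ?ltW// subr_gt0.
rewrite /u -exprS; have [t1|/ltW t1] := leP 1 t.
  by rewrite mulr_ge0// subr_ge0// exprn_ege1.
by rewrite mulr_le0// subr_le0// exprn_ile1// ltW.
Qed.

(** Strictness is already present for exponent one, where the difference is
    [l * (1 - l) * (t - 1) ^+ 2]; the inductive step only preserves it. *)
Lemma mean_power_gt (l t : R) p : 0 < l < 1 -> 0 < t -> t != 1 ->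
  t ^+ p.+1 < (1 - l + l * t) ^+ p.+1 * ((1 - l) * t ^+ p.+1 + l).
Proof.
move=> l01 t0 t1; have /andP[l0 l1] := l01.
have m0 : 0 < 1 - l + l * t by have := mulr_gt0 l0 t0; lra.
have l10 : 0 < l * (1 - l) by rewrite mulr_gt0// subr_gt0.
elim: p => [|p IH].
  rewrite !expr1 -subr_gt0 (_ : _ - _ = l * (1 - l) * (t - 1) ^+ 2); last by ring.
  by rewrite mulr_gt0// exprn_even_gt0//= subr_eq0.
rewrite 2!(exprS _ p.+1); apply: lt_le_trans (_ : t * ((1 - l + l * t) ^+ p.+1 *
  ((1 - l) * t ^+ p.+1 + l)) <= _); first by rewrite ltr_pM2l.
rewrite mulrCA -mulrA (mulrCA (1 - l + _)) ler_pM2l ?exprn_gt0//.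
rewrite -subr_ge0; set u := t ^+ p.+1.
rewrite (_ : _ - _ = l * (1 - l) * ((t - 1) * (t * u - 1))); last by ring.
rewrite mulr_ge0 ?(ltW l10)//.
rewrite /u -exprS; have [t1'|/ltW t1'] := leP 1 t.
  by rewrite mulr_ge0// subr_ge0// exprn_ege1.
by rewrite mulr_le0// subr_le0// exprn_ile1// ltW.
Qed.

(* The Jacobian bound of the transport map [s |-> (1 - l) s + l T s] with
   [T' = (x / y) ^ p]. *)
Lemma transport_jacobian_ge (l x y : R) p : 0 < l < 1 -> 0 < x -> 0 < y ->
  x ^+ p <= ((1 - l) * x + l * y) ^+ p * (1 - l + l * (x ^+ p / y ^+ p)).
Proof.
move=> l01 x0 y0; have := mean_power_ge p l01 (divr_gt0 y0 x0).
have -> : (1 - l) * x + l * y = x * (1 - l + l * (y / x)).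
  by field; rewrite gt_eqF.
rewrite exprMn exprMn exprVn.
have xp : 0 < x ^+ p by rewrite exprn_gt0.
have yp : 0 < y ^+ p by rewrite exprn_gt0.
move: (x ^+ p) xp (y ^+ p) yp ((1 - l + l * (y / x)) ^+ p) => X X0 Y Y0 Z H.
rewrite [leRHS](_ : _ = X * (X / Y) * (Z * ((1 - l) * (Y / X) + l))); last first.
  by field; rewrite !gt_eqF.
rewrite -mulrA -{1}[X]mulr1 ler_pM2l// -(ler_pM2l (divr_gt0 Y0 X0)) mulr1.
by rewrite mulrA (_ : Y / X * (X / Y) = 1) ?mul1r//; field; rewrite !gt_eqF.
Qed.

Lemma transport_jacobian_eq (l x y : R) p : 0 < l < 1 -> 0 < x -> 0 < y ->
  ((1 - l) * x + l * y) ^+ p.+1 * (1 - l + l * (x ^+ p.+1 / y ^+ p.+1)) <=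
    x ^+ p.+1 -> x = y.
Proof.
move=> l01 x0 y0; apply: contraPeq => xy; apply/negP; rewrite -ltNge.
have yx : y / x != 1.
  by apply: contra_neq xy => E; rewrite -[y](@divfK _ x) ?E ?mul1r// gt_eqF.
have := mean_power_gt p l01 (divr_gt0 y0 x0) yx.
have -> : (1 - l) * x + l * y = x * (1 - l + l * (y / x)).
  by field; rewrite gt_eqF.
rewrite exprMn exprMn exprVn.
have xp : 0 < x ^+ p.+1 by rewrite exprn_gt0.
have yp : 0 < y ^+ p.+1 by rewrite exprn_gt0.
move: (x ^+ p.+1) xp (y ^+ p.+1) yp ((1 - l + l * (y / x)) ^+ p.+1) => X X0 Y Y0 Z H.
rewrite [ltRHS](_ : _ = X * (X / Y) * (Z * ((1 - l) * (Y / X) + l))); last first.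
  by field; rewrite !gt_eqF.
rewrite -mulrA -{1}[X]mulr1 ltr_pM2l// -(ltr_pM2l (divr_gt0 Y0 X0)) mulr1.
by rewrite mulrA (_ : Y / X * (X / Y) = 1) ?mul1r//; field; rewrite !gt_eqF.
Qed.

(** [F0], [F1] and [Fl] stand for the volume below a height in two bodies of volume one and in their
    combination with weight [l]. The roots of the section volumes of the two bodies are [f] and [g],
    sections having dimension [p.+1], and [m] is the section volume of the combination. *)
Variables (l a0 b0 a1 b1 : R) (p : nat) (F0 F1 Fl f g m : R -> R).
Hypotheses (l01 : 0 < l < 1) (ab0 : a0 < b0) (ab1 : a1 < b1).
Hypotheses (cF0 : continuous F0) (cF1 : continuous F1).
Hypotheses (F0a : F0 a0 = 0) (F0b : F0 b0 = 1).
Hypotheses (F1a : F1 a1 = 0) (F1b : F1 b1 = 1).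
Hypotheses (f_gt0 : forall s, a0 < s < b0 -> 0 < f s).
Hypotheses (g_gt0 : forall t, a1 < t < b1 -> 0 < g t).
Hypothesis dF0 : forall s, a0 < s < b0 -> is_derive s 1 F0 (f s ^+ p.+1).
Hypothesis dF1 : forall t, a1 < t < b1 -> is_derive t 1 F1 (g t ^+ p.+1).
Let al := (1 - l) * a0 + l * a1.
Let bl := (1 - l) * b0 + l * b1.
Hypothesis Fl_ndecr : {homo Fl : s t / s <= t}.
Hypothesis dFl : forall r, al < r < bl -> is_derive r 1 Fl (m r).
Hypothesis m_ge : forall s t, a0 < s < b0 -> a1 < t < b1 ->
  ((1 - l) * f s + l * g t) ^+ p.+1 <= m ((1 - l) * s + l * t).

Let F_incr (a b : R) (F h : R -> R) : continuous F ->
  (forall s, a < s < b -> 0 < h s) ->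
  (forall s, a < s < b -> is_derive s 1 F (h s ^+ p.+1)) ->
  forall s t, a <= s -> s < t -> t <= b -> F s < F t.
Proof.
move=> cF h0 dF s t; apply: gtr0_derive1_incr.
- by move=> x; rewrite in_itv/= => /dF [].
- move=> x; rewrite in_itv/= => xab.
  by rewrite derive1E (@derive_val _ _ _ _ _ _ _ (dF _ xab)) exprn_gt0// h0.
- exact: continuous_subspaceT.
Qed.

Let F0_incr := F_incr cF0 f_gt0 dF0.
Let F1_incr := F_incr cF1 g_gt0 dF1.

Let F_onto (a b : R) (F : R -> R) y : a < b -> continuous F ->
  F a = 0 -> F b = 1 -> 0 < y < 1 -> exists2 x, a < x < b & F x = y.
Proof.
move=> ab cF Fa Fb /andP[y0 y1].
have [|||x] := @IVT _ F a b y; first exact: ltW.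
- exact: continuous_subspaceT.
- by rewrite Fa Fb min_l ?max_r ?ler01// !ltW.
rewrite in_itv/= !le_eqVlt => /andP[/predU1P[ax|ax]].
  by move=> _ xy; move: y0; rewrite -xy -ax Fa ltxx.
case/predU1P => [->|xb] xy; first by move: y1; rewrite -xy Fb ltxx.
by exists x => //; rewrite ax.
Qed.

Let F0_01 s : a0 < s < b0 -> 0 < F0 s < 1.
Proof.
by move=> /andP[as_ sb]; rewrite -F0a -F0b !F0_incr// ltW.
Qed.

Let F1_inj s t : a1 < s < b1 -> a1 < t < b1 -> F1 s = F1 t -> s = t.
Proof.
move=> /andP[s1 s2] /andP[t1 t2] E; case: (ltgtP s t) => // st.
  by have := F1_incr (ltW s1) st (ltW t2); rewrite E ltxx.
by have := F1_incr (ltW t1) st (ltW s2); rewrite E ltxx.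
Qed.

(** Inverse of [F1] on the open interval, with default value 0 where there is no preimage; [T] then
    matches heights with equal volume below. *)
Let G y := xget 0 [set x | a1 < x < b1 /\ F1 x = y].
Let T s := G (F0 s).

Let G_F1 t : a1 < t < b1 -> G (F1 t) = t.
Proof.
move=> t1; rewrite /G; case: xgetP => [x _ [x1 xt]|/(_ t)]; last by case.
exact: F1_inj.
Qed.

Let T_spec s : a0 < s < b0 -> a1 < T s < b1 /\ F1 (T s) = F0 s.
Proof.
move=> s0; rewrite /T /G; case: xgetP => [x _ //|nex].
have [x x1 xs] := F_onto ab1 cF1 F1a F1b (F0_01 s0).
by case: (nex x).
Qed.

Let dT s : a0 < s < b0 -> is_derive s 1 T (f s ^+ p.+1 / g (T s) ^+ p.+1).
Proof.
move=> s0; have [T1 FT] := T_spec s0; rewrite mulrC.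
apply: (@is_derive1_comp _ G F0); last exact: dF0.
rewrite -FT; apply: (@is_derive_inverse _ F1).
- by near=> x; apply: G_F1; near: x; exact: near_itvoo.
- by near=> x; exact: cF1.
- exact: dF1.
- by rewrite expf_eq0/= gt_eqF// g_gt0.
Unshelve. all: by end_near. Qed.

Let S s := (1 - l) * s + l * T s.

Let S_in s : a0 < s < b0 -> al < S s < bl.
Proof.
move=> s0; have [/andP[T1 T2] _] := T_spec s0; have /andP[s1 s2] := s0.
have /andP[l0 l1] := l01; have l1' : 0 < 1 - l by rewrite subr_gt0.
by rewrite /al /bl /S !ltrD// ltr_pM2l.
Qed.

(** Excess of the volume of the combination below [S s] over that of the first body below [s]; by
    [m_ge] and the Jacobian bound it is nondecreasing. *)
Let H s := Fl (S s) - F0 s.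
Let dHs s := m (S s) * (1 - l + l * (f s ^+ p.+1 / g (T s) ^+ p.+1)) -
  f s ^+ p.+1.

Let dH s : a0 < s < b0 -> is_derive s 1 H (dHs s).
Proof.
move=> s0; apply: (@is_deriveB _ _ _ (Fl \o S) F0); last exact: dF0.
apply: is_derive1_comp; first exact/dFl/S_in.
by apply: is_derive_affine; exact: dT.
Qed.

Let jac_gt0 s : a0 < s < b0 ->
  0 < 1 - l + l * (f s ^+ p.+1 / g (T s) ^+ p.+1).
Proof.
move=> s0; have [T1 _] := T_spec s0; have /andP[l0 l1] := l01.
by rewrite addr_gt0 ?subr_gt0// mulr_gt0// divr_gt0// exprn_gt0 ?f_gt0 ?g_gt0.
Qed.

Let dH_ge0 s : a0 < s < b0 -> 0 <= dHs s.
Proof.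
move=> s0; have [T1 _] := T_spec s0; rewrite subr_ge0.
apply: le_trans (transport_jacobian_ge _ l01 (f_gt0 s0) (g_gt0 T1)) _.
by apply: ler_wpM2r; [rewrite ltW// jac_gt0 | exact: m_ge s0 T1].
Qed.

Let H_ndecr := is_derive_ge0_ndecr dH dH_ge0.

(** The derivatives live on open intervals, so the ends are approached up to an error [e], with
    monotonicity of [Fl] bridging the gap. Keeping the increment of [H] in the bound is what makes
    [H] constant in the equality case. *)
Let H_incr s t : a0 < s -> s <= t -> t < b0 ->
  1 + (H t - H s) <= Fl bl - Fl al.
Proof.
move=> as_ st tb; apply/ler_addgt0Pr => e e0.
have s0 : a0 < s < b0 by rewrite as_ (le_lt_trans st).
have t0 : a0 < t < b0 by rewrite tb (lt_le_trans as_).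
have /andP[Fs0 Fs1] := F0_01 s0; have /andP[Ft0 Ft1] := F0_01 t0.
(* The minimum with [F0 s] puts [r] to the left of [s]; the maximum for [q] puts it to the right of
   [t]. *)
have [|r r0 rE] := @F_onto a0 b0 F0 (Num.min (F0 s) (e / 2)) ab0 cF0 F0a F0b.
  by rewrite lt_min Fs0 divr_gt0//= gt_min Fs1.
have [|q q0 qE] := @F_onto a0 b0 F0 (Num.max (F0 t) (1 - e / 2)) ab0 cF0 F0a F0b.
  by rewrite lt_max Ft0 gt_max Ft1/= gtrBl divr_gt0.
have rs : r <= s.
  rewrite leNgt; apply/negP => sr.
  have := F0_incr (ltW as_) sr (ltW (andP r0).2).
  by rewrite rE lt_min ltxx.
have tq : t <= q.
  rewrite leNgt; apply/negP => qt.
  have := F0_incr (ltW (andP q0).1) qt (ltW tb).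
  by rewrite qE gt_max ltxx.
have Hrs := H_ndecr (andP r0).1 rs (andP s0).2.
have Htq := H_ndecr (andP t0).1 tq (andP q0).2.
have HSr : Fl al <= Fl (S r) by apply: Fl_ndecr; rewrite ltW// (andP (S_in r0)).1.
have HSq : Fl (S q) <= Fl bl by apply: Fl_ndecr; rewrite ltW// (andP (S_in q0)).2.
have r2 : F0 r <= e / 2 by rewrite rE ge_min lexx orbT.
have q2 : 1 - e / 2 <= F0 q by rewrite qE le_max lexx orbT.
by move: Hrs Htq; rewrite /H; lra.
Qed.

Let mid0 : a0 < (a0 + b0) / 2 < b0.
Proof. by rewrite !midf_lt. Qed.

Lemma transport_ge1 : 1 <= Fl bl - Fl al.
Proof.
have /andP[m1 m2] := mid0.
by have := H_incr m1 (lexx _) m2; rewrite subrr addr0.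
Qed.

Section equality.
Hypothesis Fl_le1 : Fl bl - Fl al <= 1.

Let H_cst s t : a0 < s -> s <= t -> t < b0 -> H t = H s.
Proof.
move=> as_ st tb; apply/eqP; rewrite eq_le (H_ndecr as_ st tb) andbT.
by have := le_trans (H_incr as_ st tb) Fl_le1; rewrite gerDl subr_le0.
Qed.

Let dHs0 s : a0 < s < b0 -> dHs s = 0.
Proof.
move=> s0; have /andP[s1 s2] := s0.
have : is_derive s 1 H 0.
  apply: near_eq_is_derive (is_derive_cst (H s) s (1 : R)).
  near=> t; have /andP[t1 t2] : a0 < t < b0 by near: t; exact: near_itvoo.
  by case: (leP s t) => [st|/ltW ts]; [rewrite (H_cst s1 st) | rewrite (H_cst t1 ts)].
by move=> [_ <-]; have [_ ->] := dH s0.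
Unshelve. all: by end_near. Qed.

Let f_g_T s : a0 < s < b0 -> f s = g (T s).
Proof.
move=> s0; have [T1 _] := T_spec s0.
apply: (transport_jacobian_eq l01 (f_gt0 s0) (g_gt0 T1) (p := p)).
rewrite -[leRHS](subr0_eq (dHs0 s0)).
by apply: ler_wpM2r; [rewrite ltW// jac_gt0 | exact: m_ge s0 T1].
Qed.

Let jac1 s : a0 < s < b0 -> f s ^+ p.+1 / g (T s) ^+ p.+1 = 1.
Proof. by move=> s0; rewrite f_g_T// divff// expf_eq0/= gt_eqF// -f_g_T// f_gt0. Qed.

Let c := T ((a0 + b0) / 2) - (a0 + b0) / 2.

Let T_shift s : a0 < s < b0 -> T s = s + c.
Proof.
move=> s0.
have dB x : a0 < x < b0 -> is_derive x 1 (fun y => (- 1) * y + 1 * T y) 0.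
  move=> x0; have := is_derive_affine (- 1) 1 (dT x0).
  by rewrite jac1// mulr1 addNr.
have dB' x : a0 < x < b0 -> is_derive x 1 (fun y => 1 * y + (- 1) * T y) 0.
  move=> x0; have := is_derive_affine 1 (- 1) (dT x0).
  by rewrite jac1// mulr1 subrr.
have cst x y : a0 < x -> x <= y -> y < b0 -> T y - y = T x - x.
  move=> x1 xy y1.
  have := is_derive_ge0_ndecr dB (fun _ _ => lexx 0) x1 xy y1.
  have := is_derive_ge0_ndecr dB' (fun _ _ => lexx 0) x1 xy y1.
  by lra.
have /andP[m1 m2] := mid0; have /andP[s1 s2] := s0; rewrite /c.
by case: (leP s ((a0 + b0) / 2)) => [sm|/ltW ms];
  [rewrite (cst _ _ s1 sm m2) | rewrite -(cst _ _ m1 ms s2)]; ring.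
Qed.

(** With this the two intervals are shifts of each other; otherwise one would only be known to embed
    into the other. *)
Let T_onto t : a1 < t < b1 -> a0 < t - c < b0.
Proof.
move=> t1; have F01 : 0 < F1 t < 1.
  by case/andP: t1 => t1 t2; rewrite -F1a -F1b !F1_incr// ltW.
have [s s0 sE] := F_onto ab0 cF0 F0a F0b F01.
have [T1 TE] := T_spec s0.
have -> : t = T s by apply: F1_inj => //; rewrite TE.
by rewrite T_shift// addrK.
Qed.

Lemma transport_eq1 : exists c, [/\ a1 = a0 + c, b1 = b0 + c &
  forall s, a0 < s < b0 -> f s = g (s + c) /\ m (s + l * c) = f s ^+ p.+1].
Proof.
have fwd s : a0 < s < b0 -> a1 < s + c < b1.
  by move=> s0; rewrite -T_shift//; have [] := T_spec s0.
have itv_le (a b a' b' k : R) : a < b ->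
    (forall s, a < s < b -> a' < s + k < b') -> a' <= a + k /\ b + k <= b'.
  move=> ab sub; split; rewrite leNgt; apply/negP => lt_.
    have := sub (Num.min ((a + (a' - k)) / 2) ((a + b) / 2)).
    by rewrite lt_min gt_min minElt; case: ifP => ?; lra.
  have := sub (Num.max ((b + (b' - k)) / 2) ((a + b) / 2)).
  by rewrite lt_max gt_max maxElt; case: ifP => ?; lra.
have [A1 B1] := itv_le _ _ _ _ _ ab0 fwd.
have [A2 B2] := itv_le _ _ _ _ (- c) ab1 T_onto.
exists c; split; [lra|lra|move=> s s0].
split; first by rewrite -T_shift// f_g_T.
have := dHs0 s0; rewrite /dHs jac1// mulr1 subrK mulr1 => /eqP.
rewrite subr_eq0 => /eqP <-; congr m; rewrite /S T_shift//; ring.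
Qed.

End equality.

Lemma transport : 1 <= Fl bl - Fl al /\ (Fl bl - Fl al <= 1 ->
  exists c, [/\ a1 = a0 + c, b1 = b0 + c & forall s, a0 < s < b0 ->
    f s = g (s + c) /\ m (s + l * c) = f s ^+ p.+1]).
Proof. exact: conj transport_ge1 transport_eq1. Qed.

End transport.

(** * Volume below a height; concave functions *)

Section below_derivative.
Context {R : realType} {d : nat}.
Implicit Types (A : set 'rV[R]_d.+2) (s t c : R).

Lemma vol_slab_le A s s' c : compact A -> s <= s' ->
  (forall t, s <= t <= s' -> vol (sect A t) <= c) ->
  vol (slab A s s') <= c * (s' - s).
Proof.
move=> cA ss' Ac; have cS := @slab_compact _ _ A s s' cA.
rewrite -lee_fin -volE//; apply: volume_sect_le => // [x []//|t tss].
by rewrite sect_slab// volE ?lee_fin; [exact: Ac | exact: sect_compact].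
Qed.

Lemma vol_slab_ge A s s' c : compact A -> s <= s' -> 0 <= c ->
  (forall t, s <= t <= s' -> c <= vol (sect A t)) ->
  c * (s' - s) <= vol (slab A s s').
Proof.
move=> cA ss' c0 Ac; have cS := @slab_compact _ _ A s s' cA.
rewrite -lee_fin -volE//; apply: volume_sect_ge => // t tss.
by rewrite sect_slab// volE ?lee_fin; [exact: Ac | exact: sect_compact].
Qed.

Lemma le_vol n (A B : set 'rV[R]_n.+1) : compact A -> compact B -> A `<=` B ->
  vol A <= vol B.
Proof. by move=> cA cB AB; rewrite -lee_fin -!volE//; exact: le_volume. Qed.

Lemma below_homo A : compact A -> {homo (fun t => vol (below A t)) : s t / s <= t}.
Proof.
move=> cA s t st; apply: le_vol; try exact: below_compact.
by move=> x [Ax xs]; split => //; exact: le_trans st.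
Qed.

Lemma vol_sect_bounded A : compact A ->
  exists2 C, 0 <= C & forall t, vol (sect A t) <= C.
Proof.
move=> cA; have [M M0 AM] := compact_sub_cube cA.
exists ((2 * M) ^+ d.+1) => [|t]; first by rewrite exprn_ge0// mulr_ge0// ltW.
rewrite -lee_fin -volE; last exact: sect_compact.
by rewrite -volume_cube ?(ltW M0)//; apply: le_volume; exact: sect_sub_cube.
Qed.

Lemma below_continuous A : compact A -> continuous (fun t => vol (below A t)).
Proof.
move=> cA; have [C C0 AC] := vol_sect_bounded cA.
apply: (@lipschitz_continuous _ R^o R^o _ C).
have H s t : s <= t -> `|vol (below A s) - vol (below A t)| <= C * `|s - t|.
  move=> st; rewrite distrC [in leRHS]distrC !ger0_norm ?subr_ge0//.
    by rewrite vol_below_slab//; apply: vol_slab_le => // r _.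
  exact: below_homo.
move=> s t; case: (leP s t) => [|/ltW] st; first exact: H.
by rewrite distrC [in leRHS]distrC; exact: H.
Qed.

(** Near [t], the two Fubini inequalities place the volume of a thin slab between [v t - e] and
    [v t + e] times its thickness. *)
Lemma below_is_derive A t : compact A ->
  {for t, continuous (fun s => vol (sect A s))} ->
  is_derive t 1 (fun s => vol (below A s)) (vol (sect A t)).
Proof.
move=> cA ct; apply: is_derive_sandwich => e e0.
have /cvgrPdist_le/(_ _ e0)/nbhs_ballP[r /= r0 rv] := ct.
set v := fun s => vol (sect A s).
have vr s : `|t - s| < r -> v t - e <= v s <= v t + e.
  by move=> /rv; rewrite ler_norml /v => ?; apply/andP; split; lra.
have H (a b : R) : a <= b -> (forall s, a <= s <= b -> `|t - s| < r) ->
    `|vol (below A b) - vol (below A a) - v t * (b - a)| <= e * (b - a).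
  move=> ab abr; rewrite vol_below_slab//.
  have U : vol (slab A a b) <= (v t + e) * (b - a).
    by apply: vol_slab_le => // s /abr/vr /andP[].
  have L : Num.max 0 (v t - e) * (b - a) <= vol (slab A a b).
    apply: vol_slab_ge => //; first by rewrite le_max lexx.
    by move=> s /abr/vr /andP[? _]; rewrite ge_max vol_ge0.
  have : (v t - e) * (b - a) <= Num.max 0 (v t - e) * (b - a).
    by rewrite ler_wpM2r ?subr_ge0// le_max lexx orbT.
  by rewrite ler_norml => ?; apply/andP; split; lra.
near=> y.
have : `|t - y| < r by near: y; exact: nbhsx_ballx.
case: (leP t y) => [ty|/ltW yt] yr.
  rewrite (ger0_norm (_ : 0 <= y - t)) ?subr_ge0//; apply: H => // s /andP[ts sy].
  by apply: le_lt_trans yr; rewrite distrC [leRHS]distrC !ger0_norm ?subr_ge0//; lra.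
rewrite (ler0_norm (_ : y - t <= 0)) ?subr_le0// opprB.
rewrite (_ : vol _ - vol _ - _ =
  - (vol (below A t) - vol (below A y) - v t * (t - y))); last first.
  by rewrite /v; ring.
rewrite normrN; apply: H => // s /andP[ys st].
by apply: le_lt_trans yr; rewrite !ger0_norm ?subr_ge0//; lra.
Unshelve. all: by end_near. Qed.

End below_derivative.

Section concave.
Context {R : realType}.
Implicit Types (f g h w : R -> R) (a b s t x y : R).

Definition concave_oo a b f := forall s t l, a < s < b -> a < t < b ->
  0 < l < 1 -> (1 - l) * f s + l * f t <= f ((1 - l) * s + l * t).

Lemma concave_slope a b f x y z : concave_oo a b f ->
  a < x -> x < y -> y < z -> z < b ->
  f x * (z - y) + f z * (y - x) <= f y * (z - x).
Proof.
move=> cf ax xy yz zb; have xz : 0 < z - x by lra.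
pose l := (y - x) / (z - x).
have l01 : 0 < l < 1.
  by rewrite /l divr_gt0 ?subr_gt0//= ?ltr_pdivrMr// ?mul1r; lra.
have lE : l * (z - x) = y - x by rewrite divfK// gt_eqF.
have yE : (1 - l) * x + l * z = y by rewrite -[RHS](subrK x) -lE; ring.
have xab : a < x < b by apply/andP; split; lra.
have zab : a < z < b by apply/andP; split; lra.
have := cf x z l xab zab l01; rewrite yE -(ler_pM2r xz).
apply: le_trans; rewrite -lE.
have -> : z - y = (1 - l) * (z - x) by rewrite mulrBl lE mul1r; ring.
by rewrite le_eqVlt; apply/orP; left; apply/eqP; ring.
Qed.

Lemma concave_slope_le a b f x y z : concave_oo a b f ->
  a < x -> x < y -> y < z -> z < b ->
  (f z - f y) / (z - y) <= (f y - f x) / (y - x).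
Proof.
move=> cf ax xy yz zb; have := concave_slope cf ax xy yz zb.
rewrite ler_pdivrMr ?subr_gt0// mulrAC ler_pdivlMr ?subr_gt0//.
by nra.
Qed.

Lemma concave_lipschitz a b f s t : concave_oo a b f -> a < s -> t < b ->
  exists L, forall x y, s <= x <= t -> s <= y <= t ->
    `|f x - f y| <= L * `|x - y|.
Proof.
move=> cf as_ tb.
(* Slopes of a concave function decrease, so the chords over [[s2, s1]] and [[t1, t2]], on either
   side of [[s, t]], bound the slopes inside from above and from below. *)
pose s1 := (a + s) / 2; pose s2 := (a + s1) / 2.
pose t1 := (t + b) / 2; pose t2 := (t1 + b) / 2.
have [as1 s1s] : a < s1 /\ s1 < s by rewrite !midf_lt.
have [as2 s2s] : a < s2 /\ s2 < s1 by rewrite !midf_lt.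
have [tt1 t1b] : t < t1 /\ t1 < b by rewrite !midf_lt.
have [tt2 t2b] : t1 < t2 /\ t2 < b by rewrite !midf_lt.
pose L1 := (f s1 - f s2) / (s1 - s2); pose L2 := (f t2 - f t1) / (t2 - t1).
have H x y : s <= x <= t -> s <= y <= t -> x < y ->
    `|f x - f y| <= (`|L1| + `|L2|) * `|x - y|.
  move=> /andP[sx xt] /andP[sy yt] xy.
  have s1x := lt_le_trans s1s sx; have yt1 := le_lt_trans yt tt1.
  have xb := le_lt_trans xt tb; have yb := le_lt_trans yt tb.
  have ax := lt_le_trans as_ sx; have ay := lt_le_trans as_ sy.
  have A1 := concave_slope_le cf as2 s2s s1x xb.
  have A2 := concave_slope_le cf as1 s1x xy yb.
  have B1 := concave_slope_le cf ax xy yt1 t1b.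
  have B2 := concave_slope_le cf ay yt1 tt2 t2b.
  have xy0 : 0 < y - x by rewrite subr_gt0.
  rewrite distrC [in leRHS]distrC (gtr0_norm xy0).
  rewrite -[f y - f x](divfK (lt0r_neq0 xy0)) normrM (gtr0_norm xy0).
  rewrite ler_pM2r// ler_norml; apply/andP; split.
    apply: le_trans (le_trans B2 B1); apply: le_trans (_ : - `|L2| <= _).
      by rewrite lerN2 lerDr.
    by rewrite lerNl (le_trans (ler_norm _))// normrN.
  by apply: le_trans (le_trans A2 A1) _; rewrite (le_trans (ler_norm _))// lerDl.
exists (`|L1| + `|L2|) => x y xst yst; case: (ltgtP x y) => [|yx|->].
- exact: H.
- by rewrite distrC [in leRHS]distrC; exact: H.
- by rewrite !subrr normr0 mulr0.
Qed.

Lemma concave_continuous a b f x : concave_oo a b f -> a < x < b ->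
  {for x, continuous f}.
Proof.
move=> cf /andP[ax xb]; pose s := (a + x) / 2; pose t := (x + b) / 2.
have [as_ sx] : a < s /\ s < x by rewrite !midf_lt.
have [xt tb] : x < t /\ t < b by rewrite !midf_lt.
have [L HL] := concave_lipschitz cf as_ tb.
apply/cvgrPdist_le => e e0.
have L0 : 0 < `|L| + 1 by rewrite ltr_wpDl.
near=> y; have /andP[sy yt] : s < y < t by near: y; apply: near_itvoo; rewrite sx.
apply: le_trans (HL _ _ _ _) _; try by rewrite !ltW.
apply: (@le_trans _ _ ((`|L| + 1) * `|x - y|)).
  by rewrite ler_wpM2r// (le_trans (ler_norm L))// lerDl.
rewrite -ler_pdivlMl//; near: y.
by apply: cvgr_dist_le; [exact: cvg_id | rewrite mulr_gt0// invr_gt0].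
Unshelve. all: by end_near. Qed.

(* The midpoint inequality bounds the increments of [w] along an arithmetic
   progression by second differences of [h], whose sum telescopes. *)
Lemma midpoint_nincr a b h w s t : concave_oo a b h ->
  (forall x y, a < x < b -> a < y < b ->
    w y - w ((x + y) / 2) <= 2 * h ((x + y) / 2) - h x - h y) ->
  a < s -> s < t -> t < b -> w t <= w s.
Proof.
move=> ch hw as_ st tb; pose s1 := (a + s) / 2.
have [as1 s1s] : a < s1 /\ s1 < s by rewrite !midf_lt.
have [L HL] := concave_lipschitz ch as1 tb.
have ts0 : 0 < t - s by rewrite subr_gt0.
have step N : (t - s) / N.+1%:R < s - s1 ->
    w t - w s <= 2 * L * ((t - s) / N.+1%:R).
  set e := (t - s) / N.+1%:R => es.
  have e0 : 0 < e by rewrite divr_gt0.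
  pose x k : R := s + k%:R * e.
  have xN : x N.+1 = t by rewrite /x /e mulrCA divff ?pnatr_eq0// mulr1; ring.
  have x0 : x 0 = s by rewrite /x mul0r addr0.
  have xb k : (k <= N.+1)%N -> s <= x k <= t.
    move=> kN; rewrite -xN /x lerDl mulr_ge0 ?(ltW e0)//=.
    by rewrite lerD2l ler_pM2r// ler_nat.
  have tel k : (k <= N.+1)%N ->
      w (x k) - w s <= (h s - h (s - e)) - (h (x k) - h (x k - e)).
    elim: k => [_|k IH kN]; first by rewrite x0 !subrr.
    have {IH} := IH (ltnW kN).
    have /andP[xk1 xk2] := xb _ (ltnW kN); have /andP[yk1 yk2] := xb _ kN.
    have xS : x k.+1 = x k + e by rewrite /x -natr1; ring.
    have := hw (x k - e) (x k.+1).
    have -> : (x k - e + x k.+1) / 2 = x k by rewrite xS; field.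
    have -> : x k.+1 - e = x k by rewrite xS addrK.
    have -> : a < x k - e < b by apply/andP; split; lra.
    have -> : a < x k.+1 < b by apply/andP; split; lra.
    by move=> /(_ isT isT); lra.
  have := tel _ (leqnn _); rewrite xN.
  have /ler_normlP[_] := HL s (s - e) ltac:(lra) ltac:(lra).
  have /ler_normlP[] := HL t (t - e) ltac:(lra) ltac:(lra).
  by rewrite !subKr (gtr0_norm e0); lra.
rewrite -subr_le0; apply/ler_addgt0Pr => r r0; rewrite add0r.
(* The number of steps is so large that the progression, moved back by one step, stays to the right
   of [s1], and that the error [2 * L] times the step is below [r]. *)
have m0 : 0 < Num.min (s - s1) (r / (2 * `|L| + 1)) / (t - s).
  rewrite divr_gt0// lt_min subr_gt0 s1s/= divr_gt0// ltr_wpDl// mulr_ge0//.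
have [N _ /(_ N (leqnn _))/= HN] := near_infty_natSinv_lt (PosNum m0).
move: HN; rewrite ltr_pdivlMr// mulrC lt_min => /andP[N1 N2].
apply: le_trans (step _ N1) _.
move: N2; rewrite ltr_pdivlMr; last by rewrite ltr_wpDl// mulr_ge0.
set e := (t - s) / _ => N2.
have e0 : 0 < e by rewrite divr_gt0.
apply: le_trans (ltW N2); rewrite mulrC ler_pM2l//.
by have := ler_norm L; lra.
Qed.

(** Concavity and the midpoint inequality survive the change of variable [x] to [- x], so [w] is
    monotone in both senses. *)
Lemma midpoint_cst a b h w : concave_oo a b h ->
  (forall x y, a < x < b -> a < y < b ->
    w y - w ((x + y) / 2) <= 2 * h ((x + y) / 2) - h x - h y) ->
  forall s t, a < s < b -> a < t < b -> w s = w t.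
Proof.
move=> ch hw.
suff H s t : a < s -> s < t -> t < b -> w s = w t.
  move=> s t /andP[as_ sb] /andP[at_ tb]; case: (ltgtP s t) => [st|ts|->//].
    exact: H.
  by apply/esym/H.
move=> as_ st tb; apply/eqP; rewrite eq_le (midpoint_nincr ch hw as_ st tb) andbT.
have := @midpoint_nincr (- b) (- a) (h \o -%R) (w \o -%R) (- t) (- s).
rewrite /= !opprK !ltrN2; apply => //.
  move=> x y l xab yab l01; rewrite /= opprD -!mulrN; apply: ch => //; lra.
move=> x y xab yab; have := hw (- x) (- y).
rewrite (_ : (- x - y) / 2 = - ((x + y) / 2)); last by field.
by apply; lra.
Qed.

End concave.

(** * Convex sets *)

Definition cvx {R : realType} {V : lmodType R} (A : set V) : Prop :=
  forall x y (l : R), A x -> A y -> 0 <= l <= 1 -> A ((1 - l) *: x + l *: y).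

(** The Minkowski combination of [A] and [B] with coefficients [a] and [b]. *)
Definition mix {R : realType} {V : lmodType R} (a b : R) (A B : set V) : set V :=
  [set z | exists x y, [/\ A x, B y & z = a *: x + b *: y]].

Section convex_sets.
Context {R : realType}.

Lemma convex_setP (V : lmodType R) (A : set V) : convex_set A <-> cvx A.
Proof.
split=> [cA x y l Ax Ay /andP[l0 l1]|cA x y l /set_mem Ax /set_mem Ay].
  have l'0 : 0 <= 1 - l by rewrite subr_ge0.
  have l'1 : 1 - l <= 1 by rewrite gerBl.
  have := cA x y (Itv01 l'0 l'1) (mem_set Ax) (mem_set Ay).
  by move=> /set_mem; rewrite /conv/= /unstable.onem subKr.
apply/mem_set; have := cA y x l%:num Ay Ax.
rewrite /conv/= addrC; apply; apply/andP; split.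
  exact: ge0.
exact: le1.
Qed.

Lemma mix_cvx (V : lmodType R) (a b : R) (A B : set V) :
  cvx A -> cvx B -> cvx (mix a b A B).
Proof.
move=> cA cB _ _ l [x [y [Ax By ->]]] [x' [y' [Ax' By' ->]]] l01.
exists ((1 - l) *: x + l *: x'), ((1 - l) *: y + l *: y').
split; [exact: cA | exact: cB | ].
by rewrite !scalerDr !scalerA ![_ * a]mulrC ![_ * b]mulrC addrACA.
Qed.

Lemma mix_compact n (a b : R) (A B : set 'rV[R]_n) :
  compact A -> compact B -> compact (mix a b A B).
Proof.
move=> cA cB; pose h (z : 'rV[R]_n * 'rV[R]_n) := a *: z.1 + b *: z.2.
rewrite (_ : mix a b A B = h @` (A `*` B)).
  apply: continuous_compact; last exact: compact_setX.
  apply: continuous_subspaceT => z; apply: cvgD; apply: cvgZr.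
    exact: cvg_fst.
  exact: cvg_snd.
apply/seteqP; split => z.
  by move=> [x [y [Ax By ->]]]; exists (x, y).
by move=> [[x y] /= [Ax By] <-]; exists x, y.
Qed.

Lemma sect_cvx d (A : set 'rV[R]_d.+1) t : cvx A -> cvx (sect A t).
Proof.
move=> cA x y l Ax Ay l01; have := cA _ _ _ Ax Ay l01.
by rewrite -!vcons_scale -vcons_add -mulrDl subrK mul1r.
Qed.

Lemma mix_sect_sub d (A B : set 'rV[R]_d.+1) (a b s t : R) :
  mix a b (sect A s) (sect B t) `<=` sect (mix a b A B) (a * s + b * t).
Proof.
move=> _ [x [y [Ax By ->]]]; exists (vcons s x), (vcons t y).
by split => //; rewrite -!vcons_scale -vcons_add.
Qed.

Lemma cvx_sect_sub d (A : set 'rV[R]_d.+1) (l s t : R) : cvx A -> 0 <= l <= 1 ->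
  mix (1 - l) l (sect A s) (sect A t) `<=` sect A ((1 - l) * s + l * t).
Proof.
move=> cA l01; apply: subset_trans (@mix_sect_sub _ _ _ _ _ _ _) _.
by move=> y [x [x' [Ax Ax']]]; rewrite /sect/= => ->; exact: cA.
Qed.

Lemma homothety_compact n (A : set 'rV[R]_n) (r : R) (x : 'rV[R]_n) :
  compact A -> compact [set r *: y + x | y in A].
Proof.
move=> cA; apply: continuous_compact => //.
apply: continuous_subspaceT.
apply: (@lipschitz_continuous _ _ _ _ `|r|) => y z.
by rewrite opprD addrACA subrr addr0 -scalerBr normrZ.
Qed.

Lemma homothety_cvx (V : lmodType R) (A : set V) (r : R) (x : V) :
  cvx A -> cvx [set r *: y + x | y in A].
Proof.
move=> cA _ _ l [y Ay <-] [z Az <-] l01.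
exists ((1 - l) *: y + l *: z); first exact: cA.
rewrite !scalerDr !scalerA ![_ * r]mulrC addrACA; congr (_ + _).
by rewrite -scalerDl subrK scale1r.
Qed.

Lemma vol_homothety d (A : set 'rV[R]_d.+1) (r : R) (x : 'rV[R]_d.+1) :
  0 < r -> compact A ->
  vol [set r *: y + x | y in A] = r ^+ d.+1 * vol A.
Proof. by move=> r0 cA; rewrite {1}/vol volume_homothety// volE. Qed.

Lemma vol_gt0_nonempty d (A : set 'rV[R]_d.+1) : 0 < vol A -> A !=set0.
Proof.
move=> A0; apply/set0P/eqP => AE; move: A0.
by rewrite AE /vol volume0 ltxx.
Qed.

(* If [x] were in [B] but not in [A], a small homothetic copy of [B] at [x]
   would fit into [B] minus [A]. *)
Lemma eq_of_eq_vol d (A B : set 'rV[R]_d.+1) : compact A -> compact B -> cvx B ->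
  A `<=` B -> 0 < vol B -> vol B <= vol A -> A = B.
Proof.
move=> cA cB xB AB B0 BA; apply/seteqP; split => // x Bx; apply: contrapT => nAx.
have [M M0 BM] := compact_sub_cube cB.
have /nbhs_ballP[e /= e0 eA] : nbhs x (~` A).
  apply: open_nbhs_nbhs; split => //.
  by apply: closed_openC; exact: compact_rV_closed.
(* [B] lies in a cube of side [2 * M], so its copy shrunk by [r] towards [x] stays within [e / 2] of
   [x], away from [A]. *)
pose r := Num.min 1 (e / (4 * M)).
have r0 : 0 < r by rewrite lt_min ltr01/= divr_gt0// mulr_gt0.
have r1 : r <= 1 by rewrite ge_min lexx.
have re : r * (2 * M) < e.
  apply: (@le_lt_trans _ _ (e / (4 * M) * (2 * M))).
    by rewrite ler_pM2r ?mulr_gt0// ge_min lexx orbT.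
  rewrite [ltLHS](_ : _ = e / 2); last by field; rewrite gt_eqF.
  by rewrite gtr_pMr// invf_lt1// ltr1n.
pose C := [set r *: y + (1 - r) *: x | y in B].
have CB : C `<=` B.
  move=> _ [y By <-]; rewrite addrC; apply: xB => //.
  by rewrite ltW.
have CA : C `<=` ~` A.
  move=> z [y By yz]; apply: eA; rewrite -ball_normE/= -yz.
  have -> : x - (r *: y + (1 - r) *: x) = r *: (x - y).
    by rewrite scalerBr opprD addrCA -{1}[x]scale1r -scalerBl subKr addrC.
  rewrite normrZ (gtr0_norm r0); apply: le_lt_trans re.
  rewrite ler_pM2l//; apply: rV_norm_le => [|i]; first by rewrite mulr_ge0// ltW.
  have := BM _ Bx i; have := BM _ By i; rewrite !mxE ler_norml.
  by move=> /andP[? ?] /andP[? ?]; apply/andP; split; lra.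
have cC : compact C by exact: homothety_compact.
have := @vol_split R d C B (compact_rV_closed cC).
rewrite setIidr// (volE cB) (volE cC) => E.
have : (volume A <= volume (B `\` C))%E.
  by apply: le_volume => y Ay; split; [exact: AB | move=> /CA].
rewrite volE// => AC.
have : ((vol C)%:E + (vol A)%:E <= (vol B)%:E)%E by rewrite E; exact: leeD.
rewrite -EFinD lee_fin /C vol_homothety// => H.
have : 0 < r ^+ d.+1 * vol B by rewrite mulr_gt0// exprn_gt0.
by lra.
Qed.

Lemma coord_max n (A : set 'rV[R]_n) (i : 'I_n) : compact A -> A !=set0 ->
  exists2 x, A x & forall y, A y -> y ord0 i <= x ord0 i.
Proof.
move=> cA A0; have [|x /set_mem Ax H] := @EVT_max_rV R n (fun x => x ord0 i) A A0 cA.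
  by apply: continuous_subspaceT; exact: coord_continuous.
by exists x => // y Ay; apply: H; rewrite inE.
Qed.

Lemma coord_min n (A : set 'rV[R]_n) (i : 'I_n) : compact A -> A !=set0 ->
  exists2 x, A x & forall y, A y -> x ord0 i <= y ord0 i.
Proof.
move=> cA A0; have [|x /set_mem Ax H] := @EVT_min_rV R n (fun x => x ord0 i) A A0 cA.
  by apply: continuous_subspaceT; exact: coord_continuous.
by exists x => // y Ay; apply: H; rewrite inE.
Qed.

Definition extent {d} (A : set 'rV[R]_d.+1) (a b : R) : Prop :=
  [/\ sect A a !=set0, sect A b !=set0 &
      forall x, A x -> a <= x ord0 ord0 <= b].

Lemma extent_exists d (A : set 'rV[R]_d.+1) : compact A -> A !=set0 ->
  exists a b, extent A a b.
Proof.
move=> cA A0; have [x Ax xmin] := coord_min ord0 cA A0.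
have [y Ay ymax] := coord_max ord0 cA A0.
exists (x ord0 ord0), (y ord0 ord0); split.
- by exists (vtail x); apply/sectP.
- by exists (vtail y); apply/sectP.
- by move=> z Az; rewrite xmin// ymax.
Qed.

(** Some section has positive volume, as otherwise Fubini would make [A] null. Joining it to a point
    of an extreme section puts a homothetic copy of it into each section in between. *)
Lemma vol_sect_gt0 d (A : set 'rV[R]_d.+2) a b : compact A -> cvx A ->
  0 < vol A -> extent A a b -> forall t, a < t < b -> 0 < vol (sect A t).
Proof.
move=> cA xA A0 [Aa Ab Aab] t /andP[at_ tb].
have [t0 t0A] : exists t0, 0 < vol (sect A t0).
  apply: contrapT => nt0; move: A0; rewrite ltNge => /negP; apply.
  rewrite -lee_fin -volE//.
  have -> : 0%:E = (0 * (b - a))%:E :> \bar R by rewrite mul0r.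
  apply: volume_sect_le => // [|s _]; first by rewrite ltW// (lt_trans at_).
  rewrite volE ?lee_fin; last exact: sect_compact.
  by rewrite leNgt; apply/negP => s0; apply: nt0; exists s.
have pull s l : sect A s !=set0 -> 0 < l <= 1 -> t = (1 - l) * s + l * t0 ->
    0 < vol (sect A t).
  move=> [x Ax] /andP[l0 l1] ->.
  have cS := @sect_compact _ _ A t0 cA.
  apply: (@lt_le_trans _ _ (vol [set l *: y + (1 - l) *: x | y in sect A t0])).
    by rewrite vol_homothety// mulr_gt0// exprn_gt0.
  apply: le_vol; [exact: homothety_compact | exact: sect_compact | ].
  apply: subset_trans (cvx_sect_sub xA _); last by rewrite (ltW l0).
  by move=> _ [y Ay <-]; exists x, y; split => //; rewrite addrC.
have [y0 Ay0] := vol_gt0_nonempty t0A.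
have := Aab _ Ay0; rewrite vcons0E => /andP[at0 t0b].
case: (ltgtP t t0) => [tt0|t0t|->//].
  have h : 0 < t0 - a by lra.
  apply: (pull a ((t - a) / (t0 - a))) => //.
    by apply/andP; split; [apply: divr_gt0; lra | rewrite ler_pdivrMr// mul1r; lra].
  by field; rewrite gt_eqF.
have h : 0 < b - t0 by lra.
apply: (pull b ((b - t) / (b - t0))) => //.
  by apply/andP; split; [apply: divr_gt0; lra | rewrite ler_pdivrMr// mul1r; lra].
by field; rewrite gt_eqF.
Qed.

Lemma extent_lt d (A : set 'rV[R]_d.+2) a b : compact A ->
  0 < vol A -> extent A a b -> a < b.
Proof.
move=> cA A0 [Aa Ab Aab]; rewrite ltNge; apply/negP => ba.
have [x Ax] := vol_gt0_nonempty A0; have /andP[ax xb] := Aab _ Ax.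
have ab : a <= b by exact: le_trans xb.
have eab : b = a by apply/eqP; rewrite eq_le ba ab.
have [C C0 AC] := vol_sect_bounded cA.
have := @vol_slab_le _ _ A a b C cA ab (fun t _ => AC t).
rewrite eab subrr mulr0 leNgt => /negP; apply; rewrite (_ : slab A a a = A)//.
by apply/seteqP; split => [y []//|y Ay]; split => //; rewrite -{2}eab Aab.
Qed.

Lemma vol_below_lo d (A : set 'rV[R]_d.+2) a b : compact A -> extent A a b ->
  vol (below A a) = 0.
Proof.
move=> cA [_ _ Aab]; apply/eqP; rewrite eq_le vol_ge0 andbT.
have [C C0 AC] := vol_sect_bounded cA.
have := @vol_slab_le _ _ A a a C cA (lexx a) (fun t _ => AC t).
rewrite subrr mulr0; apply: le_trans; apply: le_vol.
- exact: below_compact.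
- exact: slab_compact.
- by move=> x [Ax xa]; split => //; rewrite xa andbT; have /andP[] := Aab _ Ax.
Qed.

Lemma vol_below_hi d (A : set 'rV[R]_d.+2) a b : extent A a b ->
  vol (below A b) = vol A.
Proof.
move=> [_ _ Aab]; congr vol; apply/seteqP; split => [x []//|x Ax]; split => //.
by have /andP[] := Aab _ Ax.
Qed.

(* Points of the two extreme sections are limits of points of inner ones. *)
Lemma inner_sections_dense d (A B : set 'rV[R]_d.+1) a b (v : 'rV[R]_d.+1) :
  cvx A -> extent A a b -> a < b -> closed B ->
  (forall x, A x -> a < x ord0 ord0 < b -> B (x + v)) ->
  forall x, A x -> B (x + v).
Proof.
move=> xA [[ya Aa] [yb Ab] Aab] ab cB AB x Ax.
(* A point at middle height: the points of the segment from [x] to [z], except possibly [x], have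
   inner height. *)
pose z := (1 - 2^-1) *: vcons a ya + 2^-1 *: vcons b yb.
have Az : A z by apply: xA => //; apply/andP; split; lra.
have z0 : z ord0 ord0 = (a + b) / 2 by rewrite !mxE unlift_none; field.
have /andP[ax xb] := Aab _ Ax.
pose u (e : R) := (1 - e) *: x + e *: z + v.
have uE : u 0 = x + v by rewrite /u subr0 scale1r scale0r addr0.
rewrite -uE; apply: (@closed_cvg _ _ (0 : R)^'+ _ u B cB).
  near=> e; have e0 : 0 < e by near: e; exact: nbhs_right_gt.
  have e1 : e < 1 by near: e; exact: nbhs_right_lt.
  apply: AB; first by apply: xA => //; rewrite !ltW.
  rewrite mxE [X in X + _]mxE [X in _ + X]mxE z0.
  have : 0 < e * (b - a) by rewrite mulr_gt0// subr_gt0.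
  have : 0 <= (1 - e) * (x ord0 ord0 - a) by rewrite mulr_ge0// subr_ge0// ltW.
  have : 0 <= (1 - e) * (b - x ord0 ord0) by rewrite mulr_ge0// subr_ge0// ltW.
  by move=> ? ? ?; apply/andP; split; lra.
apply: (@cvg_within_filter _ _ u (nbhs (0 : R)) _ _).
apply: cvgD; last exact: cvg_cst.
apply: cvgD; apply: cvgZl => //.
by apply: cvgB; [exact: cvg_cst | exact: cvg_id].
Unshelve. all: by end_near. Qed.

End convex_sets.

(** * Brunn-Minkowski inequality and equality case *)

Section brunn_minkowski.
Context {R : realType}.

Lemma root_exists n (v : R) : 0 < v -> exists2 p, 0 < p & p ^+ n.+1 = v.
Proof.
move=> v0; exists (v `^ n.+1%:R^-1); first exact: powR_gt0.
by rewrite -powR_mulrn ?powR_ge0// -powRrM mulVf ?pnatr_eq0// powRr1// ltW.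
Qed.

(** Volumes are given through their roots [p] and [q], so that only integer powers occur. *)
Definition brunn_minkowski_in d : Prop :=
  forall (A B : set 'rV[R]_d.+1) (a b p q : R),
  compact A -> cvx A -> compact B -> cvx B ->
  0 < a -> 0 < b -> 0 < p -> 0 < q ->
  vol A = p ^+ d.+1 -> vol B = q ^+ d.+1 ->
  (a * p + b * q) ^+ d.+1 <= vol (mix a b A B).

(** Midpoints of bodies of equal volume reproduce themselves in the induction, since the transport
    pairs sections of equal volume. *)
Definition brunn_minkowski_eq_in d : Prop :=
  forall A B : set 'rV[R]_d.+1, compact A -> cvx A -> compact B -> cvx B ->
  0 < vol A -> vol B = vol A -> vol (mix (1 - 2^-1) 2^-1 A B) <= vol A ->
  exists v, B = [set x + v | x in A].

Definition profile {d} (A : set 'rV[R]_d.+2) (t : R) : R :=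
  vol (sect A t) `^ d.+1%:R^-1.

Lemma profileE d (A : set 'rV[R]_d.+2) t : profile A t ^+ d.+1 = vol (sect A t).
Proof.
by rewrite -powR_mulrn ?powR_ge0// -powRrM mulVf ?pnatr_eq0// powRr1// vol_ge0.
Qed.

Lemma profile_gt0 d (A : set 'rV[R]_d.+2) t :
  0 < vol (sect A t) -> 0 < profile A t.
Proof. exact: powR_gt0. Qed.

Lemma half01 : 0 < (2^-1 : R) < 1.
Proof. by apply/andP; split; lra. Qed.

Lemma ltW_itv (x : R) : 0 < x < 1 -> 0 <= x <= 1.
Proof. by case/andP => x0 x1; rewrite !ltW. Qed.

Section profile_theory.
Variables (d : nat) (bm : brunn_minkowski_in d) (A : set 'rV[R]_d.+2) (a b : R).
Hypotheses (cA : compact A) (xA : cvx A).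
Hypothesis A_gt0 : forall t, a < t < b -> 0 < vol (sect A t).

(** Brunn's theorem: by convexity an intermediate section contains the Minkowski combination of two
    others. *)
Lemma profile_concave : concave_oo a b (profile A).
Proof.
move=> s t l /A_gt0 s0 /A_gt0 t0 l01; have /andP[l0 l1] := l01.
have l1' : 0 < 1 - l by rewrite subr_gt0.
have ps := profile_gt0 s0; have pt := profile_gt0 t0.
rewrite -(@ler_pXn2r _ d.+1)// ?nnegrE ?powR_ge0//; last first.
  by rewrite addr_ge0// mulr_ge0// ltW.
rewrite profileE; apply: le_trans (_ : vol (mix (1 - l) l (sect A s) (sect A t)) <= _).
  by apply: bm => //; rewrite ?profileE//; (exact: sect_compact || exact: sect_cvx).
apply: le_vol.
- by apply: mix_compact; exact: sect_compact.
- exact: sect_compact.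
- by apply: cvx_sect_sub => //; exact: ltW_itv.
Qed.

(** Continuity is inherited from the concave root; it is what [below_is_derive] asks for. *)
Lemma vol_sect_continuous t : a < t < b ->
  {for t, continuous (fun s => vol (sect A s))}.
Proof.
move=> tab; rewrite (_ : (fun s => _) = (fun s => profile A s ^+ d.+1)).
  apply: (@continuous_comp _ _ _ (profile A) (fun x : R => x ^+ d.+1)).
    exact: concave_continuous profile_concave tab.
  exact: exprn_continuous.
by apply/funext => s; rewrite profileE.
Qed.

Lemma below_is_derive_profile t : a < t < b ->
  is_derive t 1 (fun s => vol (below A s)) (profile A t ^+ d.+1).
Proof.
by move=> tab; rewrite profileE; apply: below_is_derive => //;
  exact: vol_sect_continuous.
Qed.

End profile_theory.

Lemma mix_inner_param (a0 b0 a1 b1 l r : R) : a0 < b0 -> a1 < b1 -> 0 < l < 1 ->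
  (1 - l) * a0 + l * a1 < r < (1 - l) * b0 + l * b1 ->
  exists s t, [/\ a0 < s < b0, a1 < t < b1 & r = (1 - l) * s + l * t].
Proof.
move=> ab0 ab1 /andP[l0 l1] /andP[r1 r2].
have l1' : 0 < 1 - l by rewrite subr_gt0.
have D0 : 0 < (1 - l) * (b0 - a0) + l * (b1 - a1).
  by rewrite addr_gt0// mulr_gt0// subr_gt0.
pose k := (r - ((1 - l) * a0 + l * a1)) / ((1 - l) * (b0 - a0) + l * (b1 - a1)).
have k0 : 0 < k by rewrite divr_gt0// subr_gt0.
have k1 : k < 1 by rewrite ltr_pdivrMr// mul1r; lra.
have kE : k * ((1 - l) * (b0 - a0) + l * (b1 - a1)) = r - ((1 - l) * a0 + l * a1).
  by rewrite divfK// gt_eqF.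
have in_ (a b : R) : a < b -> a < a + k * (b - a) < b.
  move=> ab; have : 0 < k * (b - a) by rewrite mulr_gt0// subr_gt0.
  have : 0 < (1 - k) * (b - a) by rewrite mulr_gt0// subr_gt0.
  by move=> ? ?; apply/andP; split; lra.
exists (a0 + k * (b0 - a0)), (a1 + k * (b1 - a1)); split; try exact: in_.
by rewrite -[LHS](subrK ((1 - l) * a0 + l * a1)) -kE; ring.
Qed.

Section induction_step.
Variables (d : nat) (bm : brunn_minkowski_in d) (K0 K1 : set 'rV[R]_d.+2).
Hypotheses (cK0 : compact K0) (xK0 : cvx K0) (cK1 : compact K1) (xK1 : cvx K1).
Hypotheses (vK0 : vol K0 = 1) (vK1 : vol K1 = 1).
Variables (a0 b0 a1 b1 : R).
Hypotheses (eK0 : extent K0 a0 b0) (eK1 : extent K1 a1 b1).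

Let K0_gt0 : forall t, a0 < t < b0 -> 0 < vol (sect K0 t).
Proof. by apply: vol_sect_gt0 => //; rewrite vK0. Qed.

Let K1_gt0 : forall t, a1 < t < b1 -> 0 < vol (sect K1 t).
Proof. by apply: vol_sect_gt0 => //; rewrite vK1. Qed.

Let ab0 : a0 < b0.
Proof. by apply: (extent_lt cK0) => //; rewrite vK0. Qed.

Let ab1 : a1 < b1.
Proof. by apply: (extent_lt cK1) => //; rewrite vK1. Qed.

(** This supplies the hypothesis [m_ge] of the transport argument. *)
Lemma mix_sect_ge (l s t : R) : 0 < l < 1 -> a0 < s < b0 -> a1 < t < b1 ->
  ((1 - l) * profile K0 s + l * profile K1 t) ^+ d.+1 <=
    vol (sect (mix (1 - l) l K0 K1) ((1 - l) * s + l * t)).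
Proof.
move=> /andP[l0 l1] s0 t1; have l1' : 0 < 1 - l by rewrite subr_gt0.
apply: le_trans (_ : vol (mix (1 - l) l (sect K0 s) (sect K1 t)) <= _).
  by apply: bm => //; rewrite ?profileE//;
    (exact: sect_compact || exact: sect_cvx || apply: profile_gt0; auto).
apply: le_vol.
- by apply: mix_compact; exact: sect_compact.
- by apply: sect_compact; exact: mix_compact.
- exact: mix_sect_sub.
Qed.

Lemma mix_transport (l : R) : 0 < l < 1 ->
  let M := mix (1 - l) l K0 K1 in
  1 <= vol M /\ (vol M <= 1 -> exists c, [/\ a1 = a0 + c, b1 = b0 + c &
    forall s, a0 < s < b0 -> profile K0 s = profile K1 (s + c) /\
      vol (sect M (s + l * c)) = profile K0 s ^+ d.+1]).
Proof.
move=> l01 M; have cM : compact M by exact: mix_compact.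
have xM : cvx M by exact: mix_cvx.
pose al := (1 - l) * a0 + l * a1; pose bl := (1 - l) * b0 + l * b1.
have M_gt0 r : al < r < bl -> 0 < vol (sect M r).
  move=> /(mix_inner_param ab0 ab1 l01)[s [t [s0 t1 ->]]].
  apply: lt_le_trans (mix_sect_ge l01 s0 t1).
  have /andP[l0 l1] := l01; have l1' : 0 < 1 - l by rewrite subr_gt0.
  by rewrite exprn_gt0// addr_gt0// mulr_gt0// profile_gt0; auto.
have bM (r : R) : al < r < bl ->
    is_derive r 1 (fun s => vol (below M s)) (vol (sect M r)).
  by move=> rab; rewrite -profileE; exact: (below_is_derive_profile bm cM xM M_gt0).
pose F (K : set 'rV[R]_d.+2) s := vol (below K s).
have [T1 T2] := @transport R l a0 b0 a1 b1 d (F K0) (F K1) (F M)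
  (profile K0) (profile K1) (fun r => vol (sect M r)) l01 ab0 ab1
  (below_continuous cK0) (below_continuous cK1)
  (vol_below_lo cK0 eK0) (etrans (vol_below_hi eK0) vK0)
  (vol_below_lo cK1 eK1) (etrans (vol_below_hi eK1) vK1)
  (fun s s0 => profile_gt0 (K0_gt0 s0)) (fun s s0 => profile_gt0 (K1_gt0 s0))
  (below_is_derive_profile bm cK0 xK0 K0_gt0)
  (below_is_derive_profile bm cK1 xK1 K1_gt0)
  (below_homo cM) bM (fun s t => mix_sect_ge l01).
have FM : F M bl - F M al <= vol M.
  rewrite lerBlDr; apply: (@le_trans _ _ (vol M)).
    by apply: le_vol => //; [exact: below_compact | move=> x []].
  by rewrite lerDl vol_ge0.
split; first exact: le_trans T1 FM.
by move=> M1; apply: T2; exact: le_trans FM M1.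
Qed.

Hypothesis bm_eq : brunn_minkowski_eq_in d.

Lemma brunn_minkowski_eq_step : vol (mix (1 - 2^-1) 2^-1 K0 K1) <= 1 ->
  exists v, K1 = [set x + v | x in K0].
Proof.
set M := mix _ _ _ _ => M1.
have cM : compact M by exact: mix_compact.
have [_ /(_ M1)[c [a1E b1E Hc]]] := mix_transport half01.
have shift s : a0 < s < b0 -> a1 < s + c < b1.
  by rewrite a1E b1E !ltrD2r.
have mixM s : a0 < s < b0 -> mix (1 - 2^-1) 2^-1 (sect K0 s) (sect K1 (s + c))
    `<=` sect M (s + 2^-1 * c).
  move=> s0; have := @mix_sect_sub R _ K0 K1 (1 - 2^-1) 2^-1 s (s + c).
  by rewrite (_ : (1 - 2^-1) * s + 2^-1 * (s + c) = s + 2^-1 * c)//; field.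
(* The translation between corresponding sections, from the equality case one dimension lower;
   outside the open interval its value is arbitrary. *)
have W_ex s : exists w, a0 < s < b0 ->
    sect K1 (s + c) = [set x + w | x in sect K0 s].
  have [s0|?] := boolP (a0 < s < b0); last by exists 0.
  have [E1 E2] := Hc s s0.
  have [|||||||w ->] := @bm_eq (sect K0 s) (sect K1 (s + c)); last by exists w.
  - exact: sect_compact.
  - exact: sect_cvx.
  - exact: sect_compact.
  - exact: sect_cvx.
  - exact: K0_gt0.
  - by rewrite -!profileE E1.
  - rewrite -profileE -E2; apply: le_vol; last exact: mixM.
      by apply: mix_compact; exact: sect_compact.
    exact: sect_compact.
have [W HW] := choice W_ex.
(* Equality of volumes makes the section of [M] equal to the midpoint of the two corresponding
   sections, hence to the section of [K0] moved by half of [W s]. *)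
have sectM s : a0 < s < b0 -> forall z, sect M (s + 2^-1 * c) z ->
    exists2 x, sect K0 s x & z = x + 2^-1 *: W s.
  move=> s0 z; have [E1 E2] := Hc s s0.
  rewrite -(eq_of_eq_vol _ _ _ (mixM _ s0)); last 5 first.
  - by apply: mix_compact; exact: sect_compact.
  - exact: sect_compact.
  - by apply: sect_cvx; exact: mix_cvx.
  - by rewrite E2 exprn_gt0// profile_gt0// K0_gt0.
  - have /andP[h0 h1] := half01; have h1' : 0 < 1 - 2^-1 :> R by rewrite subr_gt0.
    have := bm (sect_compact cK0) (sect_cvx xK0) (sect_compact cK1)
      (sect_cvx xK1) h1' h0 (profile_gt0 (K0_gt0 s0))
      (profile_gt0 (K1_gt0 (shift s s0))) (esym (profileE _ _))
      (esym (profileE _ _)).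
    by rewrite -E1 -mulrDl subrK mul1r E2.
  move=> [x [y [Kx]]]; rewrite HW// => -[y' Ky' <-] ->.
  exists ((1 - 2^-1) *: x + 2^-1 *: y'); last by rewrite scalerDr addrA.
  by apply: (sect_cvx xK0) => //; exact: ltW_itv half01.
(* For a coordinate [j], the maximum over the section of [K0] at height [r], attained at [X r], is a
   concave function of [r]; it plays the role of [h] in [midpoint_cst]. *)
have W_cst s t : a0 < s < b0 -> a0 < t < b0 -> W s = W t.
  move=> s0 t0; apply/rowP => j.
  have X_ex r : exists x, a0 < r < b0 -> sect K0 r x /\
      forall y, sect K0 r y -> y ord0 j <= x ord0 j.
    have [r0|?] := boolP (a0 < r < b0); last by exists 0.
    have [x Kx xmax] := coord_max j (@sect_compact _ _ _ r cK0)
      (vol_gt0_nonempty (K0_gt0 r0)).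
    by exists x.
  have [X HX] := choice X_ex.
  have X_in r : a0 < r < b0 -> sect K0 r (X r) by move=> /HX[].
  have X_max r y : a0 < r < b0 -> sect K0 r y -> y ord0 j <= X r ord0 j.
    by move=> /HX[_]; apply.
  have conv_in (x y l : R) : a0 < x < b0 -> a0 < y < b0 -> 0 < l < 1 ->
      a0 < (1 - l) * x + l * y < b0.
    move=> /andP[x1 x2] /andP[y1 y2] /andP[l0 l1].
    have l1' : 0 < 1 - l by rewrite subr_gt0.
    have := ltrD (mulr_gt0 l1' (_ : 0 < x - a0)) (mulr_gt0 l0 (_ : 0 < y - a0)).
    have := ltrD (mulr_gt0 l1' (_ : 0 < b0 - x)) (mulr_gt0 l0 (_ : 0 < b0 - y)).
    rewrite !subr_gt0 => /(_ x2 y2) ? /(_ x1 y1) ?.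
    by apply/andP; split; lra.
  apply: (@midpoint_cst _ a0 b0 (fun r => X r ord0 j) (fun r => W r ord0 j)) => //.
    move=> x y l x0 y0 l01; have xy0 := conv_in _ _ _ x0 y0 l01.
    have := X_max _ ((1 - l) *: X x + l *: X y) xy0; rewrite !mxE; apply.
    apply: (cvx_sect_sub xK0 (ltW_itv l01)).
    by exists (X x), (X y); split => //; exact: X_in.
  move=> x y x0 y0; have r0 : a0 < (x + y) / 2 < b0.
    have := conv_in _ _ _ x0 y0 half01.
    by rewrite (_ : _ * x + _ * y = (x + y) / 2)//; field.
  (* Half the sum of the maximizer at [x] and the translated maximizer at [y] lies in [M]; comparing
     it with the maximum at the middle height gives the midpoint inequality. *)
  have : sect M ((x + y) / 2 + 2^-1 * c)
      ((1 - 2^-1) *: X x + 2^-1 *: (X y + W y)).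
    have -> : (x + y) / 2 + 2^-1 * c = (1 - 2^-1) * x + 2^-1 * (y + c) by field.
    apply: mix_sect_sub; exists (X x), (X y + W y); split => //.
      exact: X_in.
    by rewrite HW//; exists (X y) => //; exact: X_in.
  move=> /(sectM _ r0)[z Kz] /rowP/(_ j); rewrite !mxE => E.
  have := X_max _ _ r0 Kz; lra.
pose m0 := (a0 + b0) / 2.
have m0_in : a0 < m0 < b0 by rewrite !midf_lt.
(* Both inclusions are checked on inner heights, where [W] is constant, and pass to the extreme
   sections by closure. *)
pose v := vcons c (W m0).
have vK x : K0 x -> K1 (x + v).
  move: x; apply: (inner_sections_dense xK0 eK0 ab0 (compact_rV_closed cK1)).
  move=> x K0x x0; rewrite -(vcons_tail x) -vcons_add.
  have : sect K1 (x ord0 ord0 + c) (vtail x + W m0).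
    rewrite HW// (W_cst m0 (x ord0 ord0))//.
    by exists (vtail x) => //; apply/sectP.
  by [].
have Kv x : K1 x -> K0 (x - v).
  move: x; apply: (inner_sections_dense xK1 eK1 ab1 (compact_rV_closed cK0)).
  move=> x K1x x1.
  have x0 : a0 < x ord0 ord0 - c < b0.
    by move: x1; rewrite a1E b1E ltrBrDr ltrBlDr.
  have : sect K1 (x ord0 ord0 - c + c) (vtail x) by rewrite subrK; apply/sectP.
  rewrite HW// => -[y Ky yE].
  rewrite -(vcons_tail x) -yE -[X in vcons X _](subrK c) vcons_add.
  by rewrite (W_cst _ m0 x0 m0_in) addrK.
exists v; apply/seteqP; split => [x /Kv Kx|_ [x /vK Kx <-]//].
by exists (x - v) => //; rewrite subrK.
Qed.

End induction_step.

End brunn_minkowski.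

(** * Normalization and induction on the dimension *)

Section brunn_minkowski_all.
Context {R : realType}.

(** Reduction to volume one and coefficients summing to one; the factor [s] taken out is the
    quantity whose power bounds the volume in Brunn-Minkowski. The terms [+ 0] keep the form of the
    homothety lemmas. *)
Lemma mix_rescale d (A B : set 'rV[R]_d) (a b p q : R) :
  0 < a -> 0 < b -> 0 < p -> 0 < q ->
  let s := a * p + b * q in let l := b * q / s in
  mix a b A B = [set s *: z + 0 |
    z in mix (1 - l) l [set p^-1 *: x + 0 | x in A] [set q^-1 *: x + 0 | x in B]].
Proof.
move=> a0 b0 p0 q0 s l.
have s0 : 0 < s by rewrite addr_gt0// mulr_gt0.
have ap : s * (1 - l) = a * p by rewrite /l /s; field; rewrite gt_eqF.
have bq : s * l = b * q by rewrite /l mulrCA divff ?gt_eqF// mulr1.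
apply/seteqP; split => [_ [x [y [Ax By ->]]]|_ [_ [_ [_ [[x Ax <-] [y By <-] ->]]] <-]].
  exists ((1 - l) *: (p^-1 *: x + 0) + l *: (q^-1 *: y + 0)).
    by do 2 eexists; split; [exists x | exists y | ].
  rewrite !addr0 scalerDr !scalerA ap bq -!mulrA !divff ?gt_eqF//.
  by rewrite !mulr1.
exists x, y; split => //.
by rewrite !addr0 scalerDr !scalerA ap bq -!mulrA !divff ?gt_eqF// !mulr1.
Qed.

Lemma vol_normalize d (A : set 'rV[R]_d.+1) p : compact A -> 0 < p ->
  vol A = p ^+ d.+1 -> vol [set p^-1 *: x + 0 | x in A] = 1.
Proof.
move=> cA p0 vA; rewrite vol_homothety ?invr_gt0// vA exprVn mulVf//.
by rewrite expf_eq0/= gt_eqF.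
Qed.

Lemma brunn_minkowski_step d : brunn_minkowski_in (R := R) d ->
  brunn_minkowski_in (R := R) d.+1.
Proof.
move=> bm A B a b p q cA xA cB xB a0 b0 p0 q0 vA vB.
rewrite (mix_rescale A B a0 b0 p0 q0)/=.
set s := a * p + b * q; set l := b * q / s.
set A' := [set p^-1 *: x + 0 | x in A]; set B' := [set q^-1 *: x + 0 | x in B].
have s0 : 0 < s by rewrite addr_gt0// mulr_gt0.
have l01 : 0 < l < 1.
  rewrite /l divr_gt0 ?mulr_gt0//= ltr_pdivrMr// mul1r /s ltrDr mulr_gt0//.
have cA' : compact A' by exact: homothety_compact.
have cB' : compact B' by exact: homothety_compact.
have xA' : cvx A' by exact: homothety_cvx.
have xB' : cvx B' by exact: homothety_cvx.
have vA' : vol A' = 1 by exact: vol_normalize.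
have vB' : vol B' = 1 by exact: vol_normalize.
have [|a0' [b0' eA]] := extent_exists cA'.
  by apply: vol_gt0_nonempty; rewrite vA'.
have [|a1' [b1' eB]] := extent_exists cB'.
  by apply: vol_gt0_nonempty; rewrite vB'.
rewrite vol_homothety//; last exact: mix_compact.
rewrite ler_peMr ?exprn_ge0 ?(ltW s0)//.
by have [] := mix_transport bm cA' xA' cB' xB' vA' vB' eA eB l01.
Qed.

Lemma brunn_minkowski_eq_step_scaled d : brunn_minkowski_in (R := R) d ->
  brunn_minkowski_eq_in (R := R) d -> brunn_minkowski_eq_in (R := R) d.+1.
Proof.
move=> bm bmeq A B cA xA cB xB A0 BA M1.
have [p p0 pE] := root_exists d.+1 A0.
set A' := [set p^-1 *: x + 0 | x in A]; set B' := [set p^-1 *: x + 0 | x in B].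
have cA' : compact A' by exact: homothety_compact.
have cB' : compact B' by exact: homothety_compact.
have xA' : cvx A' by exact: homothety_cvx.
have xB' : cvx B' by exact: homothety_cvx.
have vA' : vol A' = 1 by exact: vol_normalize.
have vB' : vol B' = 1 by apply: vol_normalize; rewrite // BA.
have [|a0' [b0' eA]] := extent_exists cA'.
  by apply: vol_gt0_nonempty; rewrite vA'.
have [|a1' [b1' eB]] := extent_exists cB'.
  by apply: vol_gt0_nonempty; rewrite vB'.
have [|v BE] := brunn_minkowski_eq_step bm cA' xA' cB' xB' vA' vB' eA eB bmeq.
  have h1 : 0 < 1 - 2^-1 :> R by have /andP[_] := half01 (R := R); rewrite subr_gt0.
  have h0 : 0 < 2^-1 :> R by have /andP[] := half01 (R := R).
  move: M1; rewrite (mix_rescale A B h1 h0 p0 p0)/=.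
  rewrite (_ : (1 - 2^-1) * p + 2^-1 * p = p); last by field.
  rewrite (_ : 2^-1 * p / p = 2^-1); last by field; rewrite gt_eqF.
  rewrite vol_homothety//; last exact: mix_compact.
  by rewrite pE ger_pMr.
exists (p *: v); apply/seteqP; split => [x Bx|_ [x Ax <-]].
  have : B' (p^-1 *: x + 0) by exists x.
  rewrite BE => -[_ [y Ay <-]] /(congr1 ( *:%R p)).
  rewrite !addr0 scalerDr !scalerA divff ?gt_eqF// !scale1r => <-.
  by exists y.
have : B' (p^-1 *: x + 0 + v) by rewrite BE; exists (p^-1 *: x + 0) => //; exists x.
move=> [y By] /(congr1 ( *:%R p)).
by rewrite !addr0 scalerDr !scalerA divff ?gt_eqF// !scale1r => <-.
Qed.

Lemma interval_rV1 (A : set 'rV[R]_1) : compact A -> cvx A -> A !=set0 ->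
  exists m M, [/\ m <= M, A = [set x | m <= x ord0 ord0 <= M] & vol A = M - m].
Proof.
move=> cA xA A0; have [x Ax xmin] := coord_min ord0 cA A0.
have [y Ay ymax] := coord_max ord0 cA A0.
have rV1P (u v : 'rV[R]_1) : u ord0 ord0 = v ord0 ord0 -> u = v.
  by move=> uv; apply/rowP => i; rewrite (ord1 i).
have xy := xmin _ Ay.
have AE : A = [set z | x ord0 ord0 <= z ord0 ord0 <= y ord0 ord0].
  apply/seteqP; split => z; first by move=> Az /=; rewrite xmin//= ymax.
  move=> /= /andP[xz zy]; have [E|xny] := eqVneq (x ord0 ord0) (y ord0 ord0).
    rewrite (_ : z = x)//; apply: rV1P; apply/eqP.
    by rewrite eq_le xz E zy.
  have d0 : 0 < y ord0 ord0 - x ord0 ord0 by rewrite subr_gt0 lt_neqAle xny.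
  pose l := (z ord0 ord0 - x ord0 ord0) / (y ord0 ord0 - x ord0 ord0).
  have -> : z = (1 - l) *: x + l *: y.
    by apply: rV1P; rewrite !mxE /l; field; rewrite gt_eqF.
  apply: xA => //; rewrite /l divr_ge0 ?subr_ge0 ?(ltW d0)//=.
  by rewrite ler_pdivrMr// mul1r lerD2r.
exists (x ord0 ord0), (y ord0 ord0); split => //.
have -> : A = box x y.
  rewrite AE; apply/seteqP; split => [z /= zxy i|z /(_ ord0)//].
  by rewrite (ord1 i).
rewrite /vol volume_box; last by move=> i /=; rewrite (ord1 i).
by rewrite /box_size big_ord1.
Qed.

Lemma vol_rV1_ge (A : set 'rV[R]_1) x y : compact A -> cvx A -> A x -> A y ->
  y ord0 ord0 - x ord0 ord0 <= vol A.
Proof.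
move=> cA xA Ax Ay; have [|m [M [mM AE ->]]] := interval_rV1 cA xA.
  by exists x.
by move: Ax Ay; rewrite AE /= => /andP[? ?] /andP[? ?]; lra.
Qed.

Lemma brunn_minkowski_base : brunn_minkowski_in (R := R) 0.
Proof.
move=> A B a b p q cA xA cB xB a0 b0 p0 q0 vA vB.
have [|m [M [mM AE AV]]] := interval_rV1 cA xA.
  by apply: vol_gt0_nonempty; rewrite vA exprn_gt0.
have [|m' [M' [mM' BE BV]]] := interval_rV1 cB xB.
  by apply: vol_gt0_nonempty; rewrite vB exprn_gt0.
have Mlo : mix a b A B (a *: const_mx m + b *: const_mx m').
  by exists (const_mx m), (const_mx m'); rewrite AE BE /= !mxE mM mM' !lexx.
have Mhi : mix a b A B (a *: const_mx M + b *: const_mx M').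
  by exists (const_mx M), (const_mx M'); rewrite AE BE /= !mxE mM mM' !lexx.
have := vol_rV1_ge (mix_compact cA cB) (mix_cvx xA xB) Mlo Mhi.
apply: le_trans; rewrite !mxE.
move: vA vB; rewrite !expr1 AV BV => <- <-.
by rewrite le_eqVlt; apply/orP; left; apply/eqP; ring.
Qed.

Lemma brunn_minkowski_eq_base : brunn_minkowski_eq_in (R := R) 0.
Proof.
move=> A B cA xA cB xB A0 BA _.
have [|m [M [mM AE AV]]] := interval_rV1 cA xA; first exact: vol_gt0_nonempty.
have [|m' [M' [mM' BE BV]]] := interval_rV1 cB xB.
  by apply: vol_gt0_nonempty; rewrite BA.
have E : M' - m' = M - m by rewrite -AV -BV.
exists (const_mx (m' - m)); rewrite BE AE; apply/seteqP; split => x /=.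
  move=> /andP[? ?]; exists (x - const_mx (m' - m)); last by rewrite subrK.
  by rewrite /= !mxE; apply/andP; split; lra.
by move=> [y /andP[? ?] <-]; rewrite !mxE; apply/andP; split; lra.
Qed.

Lemma brunn_minkowski d : brunn_minkowski_in (R := R) d.
Proof.
by elim: d => [|d]; [exact: brunn_minkowski_base | exact: brunn_minkowski_step].
Qed.

Lemma brunn_minkowski_eq d : brunn_minkowski_eq_in (R := R) d.
Proof.
elim: d => [|d]; first exact: brunn_minkowski_eq_base.
by apply: brunn_minkowski_eq_step_scaled; exact: brunn_minkowski.
Qed.

End brunn_minkowski_all.

(** * Hausdorff measure *)

Section hausdorff_theory.
Context {R : realType}.

Lemma lee_expe (x y : \bar R) n : (0 <= x)%E -> (x <= y)%E ->
  (x ^+ n <= y ^+ n)%E.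
Proof.
move=> x0 xy; elim: n => [|n IH]; first by rewrite !expe0.
by rewrite !expeS; apply: lee_pmul => //; exact: expe_ge0.
Qed.

Lemma expeMl (r : R) (x : \bar R) n :
  ((r%:E * x) ^+ n = (r ^+ n)%:E * x ^+ n)%E.
Proof.
elim: n => [|n IH]; first by rewrite !expe0 mul1e.
by rewrite !expeS IH exprS EFinM muleACA.
Qed.

Lemma dot_ge0 n (x : 'rV[R]_n) : 0 <= dot x x.
Proof. by apply: sumr_ge0 => i _; rewrite -expr2 sqr_ge0. Qed.

Lemma coord_le_enorm n (x : 'rV[R]_n) i : `|x ord0 i| <= enorm x.
Proof.
rewrite -sqrtr_sqr ler_wsqrtr// /dot (bigD1 i)//= expr2 lerDl.
by apply: sumr_ge0 => j _; rewrite -expr2 sqr_ge0.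
Qed.

Lemma enorm_le n (x : 'rV[R]_n) e : 0 <= e ->
  (forall i, `|x ord0 i| <= e) -> enorm x <= n%:R * e.
Proof.
move=> e0 xe; have ne0 : 0 <= n%:R * e by rewrite mulr_ge0.
rewrite -(ger0_norm ne0) -sqrtr_sqr ler_wsqrtr//.
apply: (@le_trans _ _ (n%:R * e ^+ 2)).
  rewrite mulr_natl -[X in _ *+ X]card_ord -sumr_const; apply: ler_sum => i _.
  by rewrite -expr2 -(real_normK (num_real _)) lerXn2r// nnegrE.
rewrite exprMn ler_wpM2r ?sqr_ge0// -natrX ler_nat.
by case: n {x xe ne0} => // n; rewrite leq_pmulr.
Qed.

Section diameter.
Context {n : nat}.
Implicit Types (A B : set 'rV[R]_n) (x : 'rV[R]_n).

Lemma diam_ge0 A : (0 <= diam A)%E.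
Proof. by apply: ereal_sup_ubound; left. Qed.

Lemma enorm_le_diam A x y : A x -> A y -> ((enorm (x - y))%:E <= diam A)%E.
Proof. by move=> Ax Ay; apply: ereal_sup_ubound; right; exists (x, y). Qed.

Lemma diam_le A (M : \bar R) : (0 <= M)%E ->
  (forall x y, A x -> A y -> ((enorm (x - y))%:E <= M)%E) -> (diam A <= M)%E.
Proof.
by move=> M0 AM; apply: ge_ereal_sup => _ [->//|[[x y] /= [Ax Ay] <-]]; exact: AM.
Qed.

Lemma diam0 : diam (set0 : set 'rV[R]_n) = 0%E.
Proof. by apply/eqP; rewrite eq_le diam_ge0 andbT; exact: diam_le. Qed.

End diameter.

Lemma hausdorff_deltaE n d (delta : R) (A : set 'rV[R]_n) :
  hausdorff_delta d delta A = cover_outer [set E | (diam E <= delta%:E)%E]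
    (fun E => (diam E ^+ d)%E) id A.
Proof.
rewrite /hausdorff_delta /cover_outer; congr (ereal_inf (_ @` _)).
by apply/seteqP; split => E [].
Qed.

Section raw.
Context {n : nat} (d : nat).
Implicit Types (A B : set 'rV[R]_n) (delta : R).

Lemma diamX_ge0 A : (0 <= diam A ^+ d)%E.
Proof. by apply: expe_ge0; exact: diam_ge0. Qed.

Lemma hausdorff_delta_ge0 delta A : (0 <= hausdorff_delta d delta A)%E.
Proof.
by rewrite hausdorff_deltaE; apply: cover_outer_ge0 => E _; exact: diamX_ge0.
Qed.

Lemma hausdorff_delta_le delta A (E : (set 'rV[R]_n)^nat) :
  A `<=` \bigcup_k E k -> (forall k, (diam (E k) <= delta%:E)%E) ->
  (hausdorff_delta d delta A <= \sum_(k <oo) (diam (E k) ^+ d)%E)%E.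
Proof. by move=> AE Ed; apply: ereal_inf_lbound; exists E. Qed.

Lemma hausdorff_delta_ge delta A (x : \bar R) :
  (forall E : (set 'rV[R]_n)^nat, A `<=` \bigcup_k E k ->
    (forall k, (diam (E k) <= delta%:E)%E) ->
    (x <= \sum_(k <oo) (diam (E k) ^+ d)%E)%E) ->
  (x <= hausdorff_delta d delta A)%E.
Proof.
by move=> H; apply: le_ereal_inf_tmp => _ [E [AE Ed] <-]; exact: H.
Qed.

Lemma hausdorff_delta_le_raw delta A : 0 < delta ->
  (hausdorff_delta d delta A <= hausdorff_raw d A)%E.
Proof. by move=> d0; apply: ereal_sup_ubound; exists delta. Qed.

Lemma hausdorff_raw_le A (M : \bar R) :
  (forall delta, 0 < delta -> (hausdorff_delta d delta A <= M)%E) ->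
  (hausdorff_raw d A <= M)%E.
Proof. by move=> AM; apply: ge_ereal_sup => _ [delta d0 <-]; exact: AM. Qed.

Lemma hausdorff_raw_ge0 A : (0 <= hausdorff_raw d A)%E.
Proof.
apply: le_trans (hausdorff_delta_ge0 1 A) _.
exact: hausdorff_delta_le_raw.
Qed.

Lemma hausdorff_raw_sigma_subadditive A (F : (set 'rV[R]_n)^nat) :
  subset_sigma_subadditive (hausdorff_raw d) A F.
Proof.
move=> AF; apply: hausdorff_raw_le => delta d0; rewrite hausdorff_deltaE.
apply: (le_trans (@cover_outer_sigma_subadditive _ _ _
  [set E | (diam E <= delta%:E)%E] (fun E => (diam E ^+ d)%E) id
  (fun E _ => diamX_ge0 E) _ _ AF)).
apply: lee_nneseries => [k _ _|k _].
  by apply: cover_outer_ge0 => E _; exact: diamX_ge0.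
by rewrite -hausdorff_deltaE; exact: hausdorff_delta_le_raw.
Qed.

End raw.

Lemma hausdorff_raw0 n d : hausdorff_raw d.+1 (set0 : set 'rV[R]_n) = 0%E.
Proof.
apply/eqP; rewrite eq_le hausdorff_raw_ge0 andbT.
apply: hausdorff_raw_le => delta d0.
apply: le_trans (@hausdorff_delta_le n d.+1 delta set0 (fun=> set0) _ _) _ => //.
  by move=> k; rewrite diam0 lee_fin ltW.
by rewrite eseries0// => k _ _; rewrite diam0 expeS mul0e.
Qed.

HB.instance Definition _ n d := isSubsetOuterMeasure.Build R 'rV[R]_n
  (@hausdorff_raw R n d.+1) (@hausdorff_raw0 n d) (@hausdorff_raw_ge0 n d.+1)
  (@hausdorff_raw_sigma_subadditive n d.+1).

(** * Hausdorff measure under similarities, possibly between spaces of different dimensions *)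

Section similarity.
Context {m n : nat} (phi : 'rV[R]_m -> 'rV[R]_n) (r : R) (d : nat).
Hypothesis r_gt0 : 0 < r.
Hypothesis phi_sim : forall x y, enorm (phi x - phi y) = r * enorm (x - y).

Lemma diam_image_le A : (diam (phi @` A) <= r%:E * diam A)%E.
Proof.
apply: diam_le; first by rewrite mule_ge0 ?diam_ge0// lee_fin ltW.
move=> _ _ [x Ax <-] [y Ay <-]; rewrite phi_sim EFinM.
by rewrite lee_pmul2l//; exact: enorm_le_diam.
Qed.

Lemma diam_preimage_le E : (r%:E * diam (phi @^-1` E) <= diam E)%E.
Proof.
rewrite -lee_pdivlMl//; apply: diam_le.
  by rewrite mule_ge0 ?diam_ge0// lee_fin invr_ge0 ltW.
by move=> x y Ex Ey; rewrite lee_pdivlMl// -EFinM -phi_sim; exact: enorm_le_diam.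
Qed.

(** Coverings are pushed forward for one inequality and pulled back for the other; the bound on
    diameters scales along with the sets. *)
Lemma hausdorff_delta_similar delta A :
  hausdorff_delta d (r * delta) (phi @` A) =
  ((r ^+ d)%:E * hausdorff_delta d delta A)%E.
Proof.
have rd0 : 0 < r ^+ d by rewrite exprn_gt0.
apply/eqP; rewrite eq_le; apply/andP; split.
  rewrite -lee_pdivrMl//; apply: hausdorff_delta_ge => E AE Ed.
  rewrite lee_pdivrMl// -nneseriesZl; last by move=> k _; exact: diamX_ge0.
  apply: le_trans (@hausdorff_delta_le _ _ _ _ (fun k => phi @` E k) _ _) _.
  - by move=> _ [x /AE[k _ Ekx] <-]; exists k => //; exists x.
  - move=> k; apply: le_trans (diam_image_le _) _.
    by rewrite EFinM lee_pmul2l//; exact: Ed.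
  apply: lee_nneseries => [k _ _|k _]; first exact: diamX_ge0.
  by rewrite -expeMl; apply: lee_expe; [exact: diam_ge0 | exact: diam_image_le].
apply: hausdorff_delta_ge => E AE Ed.
apply: (@le_trans _ _ ((r ^+ d)%:E *
    \sum_(k <oo) (diam (phi @^-1` E k) ^+ d)%E)%E).
  rewrite lee_pmul2l//; apply: hausdorff_delta_le.
    by move=> x Ax; have [|k _ Ek] := AE (phi x); [exists x | exists k].
  move=> k; rewrite -(@lee_pmul2l _ r%:E)// -EFinM.
  by apply: le_trans (diam_preimage_le _) (Ed k).
rewrite -nneseriesZl; last by move=> k _; exact: diamX_ge0.
apply: lee_nneseries => [k _ _|k _].
  by rewrite mule_ge0 ?diamX_ge0// lee_fin ltW.
rewrite -expeMl; apply: lee_expe; last exact: diam_preimage_le.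
by rewrite mule_ge0 ?diam_ge0// lee_fin ltW.
Qed.

Lemma hausdorff_raw_similar A :
  hausdorff_raw d (phi @` A) = ((r ^+ d)%:E * hausdorff_raw d A)%E.
Proof.
have rd0 : 0 < r ^+ d by rewrite exprn_gt0.
apply/eqP; rewrite eq_le; apply/andP; split.
  apply: hausdorff_raw_le => delta d0.
  rewrite -(divfK (lt0r_neq0 r_gt0) delta) mulrC hausdorff_delta_similar.
  by rewrite lee_pmul2l//; apply: hausdorff_delta_le_raw; rewrite divr_gt0.
rewrite -lee_pdivlMl//; apply: hausdorff_raw_le => delta d0.
rewrite lee_pdivlMl// -hausdorff_delta_similar.
by apply: hausdorff_delta_le_raw; rewrite mulr_gt0.
Qed.

End similarity.

(** * Comparison of Hausdorff measure with volume *)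

Lemma nneseries_le_nat (f : nat -> \bar R) m (x : R) :
  (forall k, (0 <= f k)%E) -> (forall k, (k < m)%N -> (f k <= x%:E)%E) ->
  (forall k, (m <= k)%N -> f k = 0%E) ->
  (\sum_(k <oo) f k <= (m%:R * x)%:E)%E.
Proof.
move=> f0 fx fm; rewrite (nneseries_split _ m); last by move=> *; exact: f0.
rewrite [X in (_ + X)%E]eseries0 ?adde0; last by move=> k; rewrite add0n => /fm.
rewrite add0n big_mkord; apply: (@le_trans _ _ (\sum_(k < m) x%:E)%E).
  by apply: lee_sum => k _; exact: fx.
by rewrite sumEFin sumr_const card_ord mulr_natl.
Qed.

(** Rounding up the number of cubes along a side overshoots its length by at most [e], whence the
    factors in the bound. *)
Lemma box_grid d (a b : 'rV[R]_d) (e : R) : 0 < e -> ordered_corners (a, b) ->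
  exists (m : nat) (c : nat -> 'rV[R]_d),
    box a b `<=` \bigcup_(k in `I_m) box (c k) (c k + const_mx e) /\
    m%:R * e ^+ d <= \prod_i (b ord0 i - a ord0 i + e).
Proof.
move=> e0; elim: d a b => [|d IH] a b oab.
  exists 1%N, (fun=> 0); split; last by rewrite big_ord0 expr0 mulr1.
  by move=> x _; exists 0%N => // -[].
have [|m [c [abc mc]]] := IH (vtail a) (vtail b).
  by move=> j; rewrite /= !mxE; exact: oab.
have l0 : 0 <= b ord0 ord0 - a ord0 ord0 by rewrite subr_ge0; exact: oab.
pose N := (Num.truncn ((b ord0 ord0 - a ord0 ord0) / e)).+1.
have Ne : N%:R * e <= b ord0 ord0 - a ord0 ord0 + e.
  rewrite /N -natr1 mulrDl mul1r lerD2r -ler_pdivlMr//.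
  by have /andP[] := truncn_itv (divr_ge0 l0 (ltW e0)).
(* The index [k] encodes a level [k %/ m] and a cube [k %% m] of the grid in the remaining
   coordinates. *)
exists (N * m)%N, (fun k => vcons (a ord0 ord0 + e * (k %/ m)%:R) (c (k %% m)%N)).
split; last first.
  rewrite natrM exprS mulrACA big_ord_recl; apply: ler_pM => //.
  - by rewrite mulr_ge0// ltW.
  - by rewrite mulr_ge0// exprn_ge0// ltW.
  - by apply: le_trans mc _; under [leLHS]eq_bigr do rewrite !mxE.
move=> x /box_consP[/andP[ax xb] /abc[k /= km ck]].
pose j := Num.truncn ((x ord0 ord0 - a ord0 ord0) / e).
have x0 : 0 <= x ord0 ord0 - a ord0 ord0 by rewrite subr_ge0.
have /andP[j1 j2] := truncn_itv (divr_ge0 x0 (ltW e0)).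
have jN : (j < N)%N by rewrite ltnS le_truncn// ler_pM2r ?invr_gt0// lerD2r.
have m0 : (0 < m)%N by exact: leq_ltn_trans km.
exists (j * m + k)%N => /=.
  by apply: (@leq_trans (j.+1 * m)); [rewrite mulSn addnC ltn_add2r | rewrite leq_mul2r jN orbT].
rewrite divnMDl// divn_small// addn0 modnMDl modn_small//.
apply/box_consP; rewrite !mxE unlift_none; split.
  move: j1 j2; rewrite -/j -natr1 ler_pdivlMr// ltr_pdivrMr// => j1 j2.
  by apply/andP; split; lra.
rewrite vtail_cons (_ : vtail _ = c k + const_mx e)//.
by apply/rowP => i; rewrite !mxE liftK.
Qed.

Definition unit_box {d} : set 'rV[R]_d := box 0 (const_mx 1).

(** Shown below to be finite and positive, so that [fine] and the division in [hausdorff] are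
    harmless. *)
Definition hausdorff_const d : R :=
  fine (hausdorff_raw d.+1 (@unit_box d.+1)).

Lemma diam_box_le d (c : 'rV[R]_d) (e : R) : 0 <= e ->
  (diam (box c (c + const_mx e)) <= (d%:R * e)%:E)%E.
Proof.
move=> e0; apply: diam_le; first by rewrite lee_fin mulr_ge0.
move=> x y xc yc; rewrite lee_fin; apply: enorm_le => // i.
have := xc i; have := yc i; rewrite !mxE => /andP[? ?] /andP[? ?].
by rewrite ler_norml; apply/andP; split; lra.
Qed.

(** With [n = d.+1], a cube of side [e] has diameter at most [n * e], and the grid has at most
    [((1 + e) / e) ^+ n] cubes; as [e <= 1], the sum is at most [(2 * n) ^+ n]. *)
Lemma hausdorff_unit_box_lty d :
  (hausdorff_raw d.+1 (@unit_box d.+1) < +oo)%E.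
Proof.
apply: (@le_lt_trans _ _ ((2 * d.+1%:R) ^+ d.+1)%:E); last exact: ltry.
apply: hausdorff_raw_le => delta delta0.
have m0 : 0 < Num.min 1 (delta / d.+1%:R) by rewrite lt_min ltr01 divr_gt0.
set e := Num.min 1 (delta / d.+1%:R) in m0.
have e1 : e <= 1 by rewrite ge_min lexx.
have ed : d.+1%:R * e <= delta.
  by rewrite -ler_pdivlMl// mulrC ge_min lexx orbT.
have o01 : ordered_corners (0 : 'rV[R]_d.+1, const_mx 1 : 'rV[R]_d.+1).
  by move=> i; rewrite !mxE.
have [m [c [cov me]]] := box_grid m0 o01.
pose E k := if (k < m)%N then box (c k) (c k + const_mx e) else set0.
apply: le_trans (_ : (\sum_(k <oo) (diam (E k) ^+ d.+1)%E <= _)%E).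
  apply: hausdorff_delta_le => [x /cov[k /= km xk]|k].
    by exists k => //; rewrite /E km.
  rewrite /E; case: ifP => _; last by rewrite diam0 lee_fin ltW.
  by apply: le_trans (diam_box_le _ (ltW m0)) _; rewrite lee_fin.
apply: le_trans (@nneseries_le_nat _ m ((d.+1%:R * e) ^+ d.+1) _ _ _) _.
- by move=> k; exact: diamX_ge0.
- move=> k km; rewrite /E km EFin_expe; apply: lee_expe; first exact: diam_ge0.
  exact: diam_box_le (ltW m0).
- by move=> k; rewrite leqNgt /E => /negbTE ->; rewrite diam0 expeS mul0e.
rewrite lee_fin [in leRHS]exprMn [in leLHS]exprMn mulrCA [leRHS]mulrC.
rewrite ler_wpM2l ?exprn_ge0//; apply: le_trans me _.
rewrite -[X in _ ^+ X]card_ord -prodr_const; apply: ler_prod => i _.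
by rewrite !mxE subr0 addr_ge0 ?(ltW m0)//= lerD2l.
Qed.

Lemma hausdorff_constE d :
  hausdorff_raw d.+1 (@unit_box d.+1) =
  (hausdorff_const d)%:E.
Proof.
by rewrite fineK// ge0_fin_numE ?hausdorff_raw_ge0// hausdorff_unit_box_lty.
Qed.

(** A set of diameter [r] lies in a cube of side [2 * r]. The crude factor is enough for
    [hausdorff_const_gt0]. *)
Lemma volume_le_hausdorff_raw d (A : set 'rV[R]_d.+1) :
  (volume A <= (2 ^+ d.+1)%:E * hausdorff_raw d.+1 A)%E.
Proof.
apply: (@le_trans _ _ ((2 ^+ d.+1)%:E * hausdorff_delta d.+1 1 A)%E); last first.
  by rewrite lee_pmul2l ?exprn_gt0//; exact: hausdorff_delta_le_raw.
rewrite -lee_pdivrMl ?exprn_gt0//; apply: hausdorff_delta_ge => E AE Ed.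
rewrite lee_pdivrMl ?exprn_gt0// -nneseriesZl; last by move=> k _; exact: diamX_ge0.
apply: le_trans (volume_sigma_subadditive AE) _.
apply: lee_nneseries => [k _ _|k _]; first exact: volume_ge0.
have [->|/set0P[x Ex]] := eqVneq (E k) set0.
  by rewrite volume0 mule_ge0 ?diamX_ge0// lee_fin exprn_ge0.
have := Ed k; have := diam_ge0 (E k).
have := enorm_le_diam Ex; case: (diam (E k)) => // r H r0 _.
rewrite -expeMl -EFinM -EFin_expe; move: r0; rewrite lee_fin => r0.
apply: (@le_trans _ _ (volume (box (x - const_mx r) (x + const_mx r)))).
  apply: le_volume => y Ey i; have := H _ Ey; rewrite lee_fin.
  move=> /(le_trans (coord_le_enorm _ i)); rewrite !mxE ler_norml.
  by move=> /andP[? ?]; apply/andP; split; lra.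
rewrite volume_box; last by move=> i; rewrite /= !mxE; lra.
rewrite lee_fin -[X in _ ^+ X]card_ord -prodr_const le_eqVlt; apply/orP; left.
by apply/eqP; apply: eq_bigr => i _; rewrite !mxE; ring.
Qed.

Lemma hausdorff_const_gt0 d : 0 < hausdorff_const d.
Proof.
have := @volume_le_hausdorff_raw d unit_box.
rewrite hausdorff_constE volume_box; last by move=> i; rewrite !mxE.
rewrite -EFinM lee_fin /box_size big1; last by move=> i _; rewrite !mxE subr0.
by move=> H; rewrite -(pmulr_rgt0 _ (exprn_gt0 d.+1 (ltr0Sn R 1))) (lt_le_trans ltr01).
Qed.

Lemma enorm_scale n (r : R) (x : 'rV[R]_n) : 0 <= r -> enorm (r *: x) = r * enorm x.
Proof.
move=> r0; rewrite /enorm (_ : dot _ _ = r ^+ 2 * dot x x).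
  by rewrite sqrtrM ?sqr_ge0// sqrtr_sqr ger0_norm.
by rewrite /dot mulr_sumr; apply: eq_bigr => i _; rewrite !mxE; ring.
Qed.

Lemma hausdorff_homothety n d (A : set 'rV[R]_n) (r : R) (x : 'rV[R]_n) : 0 < r ->
  hausdorff_raw d [set r *: y + x | y in A] = ((r ^+ d)%:E * hausdorff_raw d A)%E.
Proof.
move=> r0; apply: (@hausdorff_raw_similar _ _ (fun y => r *: y + x)) => // y z.
by rewrite opprD addrACA subrr addr0 -scalerBr enorm_scale// ltW.
Qed.

Lemma box_homothety d (c : 'rV[R]_d) (e : R) : 0 < e ->
  box c (c + const_mx e) = [set e *: y + c | y in unit_box].
Proof.
move=> e0; apply/seteqP; split => [x xc|_ [y y01 <-] i].
  exists (e^-1 *: (x - c)); last by rewrite scalerA divff ?gt_eqF// scale1r subrK.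
  move=> i; have := xc i; rewrite !mxE => /andP[x1 x2].
  by rewrite mulr_ge0 ?invr_ge0 ?(ltW e0) ?subr_ge0//= ler_pdivrMl// mulr1 lerBlDl.
have := y01 i; rewrite !mxE => /andP[y0 y1].
have := mulr_ge0 (ltW e0) y0; have : e * y ord0 i <= e by rewrite ger_pMr.
by move=> ? ?; apply/andP; split; lra.
Qed.

Lemma hausdorff_cube d (c : 'rV[R]_d.+1) (e : R) : 0 < e ->
  hausdorff_raw d.+1 (box c (c + const_mx e)) =
  (e ^+ d.+1 * hausdorff_const d)%:E.
Proof.
by move=> e0; rewrite box_homothety// hausdorff_homothety// hausdorff_constE.
Qed.

(** Cubes have a known measure, being homothetic to the unit cube, and a grid of them covers the
    box; the excess [e] then tends to 0 in [hausdorff_box_le]. *)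
Lemma hausdorff_box_le_eps d (a b : 'rV[R]_d.+1) (e : R) : 0 < e ->
  ordered_corners (a, b) ->
  (hausdorff_raw d.+1 (box a b) <=
    (hausdorff_const d * \prod_i (b ord0 i - a ord0 i + e))%:E)%E.
Proof.
move=> e0 oab; have [m [c [cov me]]] := box_grid e0 oab.
pose E k := if (k < m)%N then box (c k) (c k + const_mx e) else set0.
apply: (@le_trans _ _ (\sum_(k <oo) hausdorff_raw d.+1 (E k))%E).
  apply: hausdorff_raw_sigma_subadditive => x /cov[k /= km xk].
  by exists k => //; rewrite /E km.
apply: le_trans (@nneseries_le_nat _ m (e ^+ d.+1 * hausdorff_const d) _ _ _) _.
- by move=> k; exact: hausdorff_raw_ge0.
- by move=> k km; rewrite /E km hausdorff_cube.
- by move=> k; rewrite leqNgt /E => /negbTE ->; rewrite hausdorff_raw0.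
rewrite lee_fin mulrA mulrC ler_wpM2l//.
by rewrite ltW// hausdorff_const_gt0.
Qed.

Lemma hausdorff_box_le d (a b : 'rV[R]_d.+1) : ordered_corners (a, b) ->
  (hausdorff_raw d.+1 (box a b) <= (hausdorff_const d * box_size (a, b))%:E)%E.
Proof.
move=> oab; have H := fun e e0 => @hausdorff_box_le_eps d a b e e0 oab.
have fin : hausdorff_raw d.+1 (box a b) \is a fin_num.
  rewrite ge0_fin_numE ?hausdorff_raw_ge0//.
  by apply: le_lt_trans (H 1 ltr01) _; exact: ltry.
move: H; rewrite -(fineK fin); set x := fine _ => H; rewrite lee_fin.
pose u (e : R) := hausdorff_const d * \prod_i (b ord0 i - a ord0 i + e).
apply: (@closed_cvg _ _ (0 : R)^'+ _ u (fun y => x <= y) (@closed_ge R x)).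
  near=> e; rewrite -lee_fin; apply: H; near: e; exact: nbhs_right_gt.
rewrite (_ : box_size _ = \prod_i (b ord0 i - a ord0 i + 0)); last first.
  by apply: eq_bigr => i _; rewrite addr0.
apply: cvg_at_right_filter; apply: cvgMr.
apply: (@cvg_big R _ ( *%R) 1); first exact: mul_continuous.
by move=> i _; apply: cvgD; [exact: cvg_cst | exact: cvg_id].
Unshelve. all: by end_near. Qed.

Lemma hausdorff_raw_le_volume d (A : set 'rV[R]_d.+1) :
  (hausdorff_raw d.+1 A <= (hausdorff_const d)%:E * volume A)%E.
Proof.
rewrite -lee_pdivrMl ?hausdorff_const_gt0//; apply: volume_ge => ab oab Aab.
rewrite lee_pdivrMl ?hausdorff_const_gt0//.
rewrite -nneseriesZl; last by move=> k _; exact: box_size_ge0.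
apply: (le_trans (@hausdorff_raw_sigma_subadditive _ d.+1 _ _ Aab)).
apply: lee_nneseries => [k _ _|k _]; first exact: hausdorff_raw_ge0.
have := @hausdorff_box_le d (ab k).1 (ab k).2.
by rewrite -surjective_pairing -EFinM; apply; exact: oab.
Qed.

Lemma hausdorff_rawE d (A : set 'rV[R]_d.+1) : compact A ->
  hausdorff_raw d.+1 A = (hausdorff_const d * vol A)%:E.
Proof.
move=> cA; apply/eqP; rewrite eq_le; apply/andP; split.
  by rewrite EFinM -volE//; exact: hausdorff_raw_le_volume.
have [M M0 AM] := compact_sub_cube cA.
have M20 : 0 < 2 * M by rewrite mulr_gt0.
have cubeE : cube d.+1 M = box (const_mx (- M)) (const_mx (- M) + const_mx (2 * M)).
  by congr box; apply/rowP => i; rewrite !mxE; ring.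
have HC : hausdorff_raw d.+1 (cube d.+1 M) =
    (hausdorff_const d * (2 * M) ^+ d.+1)%:E.
  by rewrite cubeE hausdorff_cube// mulrC.
have VC := volume_cube d (ltW M0).
have := vol_split (cube d.+1 M) (compact_rV_closed cA).
rewrite setIidr// VC volE// => VE.
have fin : volume (cube d.+1 M `\` A) = (vol (cube d.+1 M `\` A))%:E.
  by apply: (@sub_cube_volE _ _ _ M); [exact: ltW | move=> x []].
move: VE; rewrite fin -EFinD => -[VE].
have sub : (hausdorff_raw d.+1 (cube d.+1 M) <=
    hausdorff_raw d.+1 A + hausdorff_raw d.+1 (cube d.+1 M `\` A))%E.
  apply: le_trans (outer_measureU2 _ _ _).
  by apply: le_outer_measure; rewrite setDUK.
have rest := hausdorff_raw_le_volume (cube d.+1 M `\` A).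
move: sub; rewrite HC VE mulrDr => sub.
have := le_trans sub (leeD (lexx _) rest).
by rewrite fin -EFinM EFinD leeD2rE.
Qed.

Lemma vol_isometry d (Q : 'rV[R]_d.+1 -> 'rV[R]_d.+1) (A : set 'rV[R]_d.+1) :
  (forall x y, enorm (Q x - Q y) = enorm (x - y)) -> compact A ->
  compact (Q @` A) -> vol (Q @` A) = vol A.
Proof.
move=> iQ cA cQA.
have : hausdorff_raw d.+1 (Q @` A) = hausdorff_raw d.+1 A.
  rewrite (@hausdorff_raw_similar _ _ Q 1)// ?expr1n ?mul1e// => x y.
  by rewrite iQ mul1r.
rewrite !hausdorff_rawE// => -[/mulfI]; apply.
by rewrite gt_eqF// hausdorff_const_gt0.
Qed.

(** The zero is appended at the end, unlike in [vcons], because [unit_cube d] occupies the first [d]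
    coordinates. *)
Definition vsnoc {d} (y : 'rV[R]_d) : 'rV[R]_d.+1 :=
  \row_i (if insub (i : nat) : option 'I_d is Some j then y ord0 j else 0).

Lemma dot_vsnoc d (x : 'rV[R]_d) : dot (vsnoc x) (vsnoc x) = dot x x.
Proof.
rewrite /dot big_ord_recr/= !mxE insubF ?ltnn// mulr0 addr0.
by apply: eq_bigr => i _; rewrite !mxE/= valK.
Qed.

Lemma unit_cubeE d : unit_cube d =
  vsnoc @` unit_box :> set 'rV[R]_d.+1.
Proof.
apply/seteqP; split => [x x01|_ [y y01 <-] i]; last first.
  rewrite mxE; case: insubP => [j -> _|/negbTE ->//].
  by have := y01 j; rewrite !mxE.
exists (\row_(j < d) x ord0 (widen_ord (leqnSn d) j)).
  by move=> j; have := x01 (widen_ord (leqnSn d) j); rewrite !mxE/= ltn_ord.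
apply/rowP => i; rewrite mxE; case: insubP => [j _ ji|/negbTE nid].
  by rewrite mxE; congr (x _ _); apply: val_inj.
by have := x01 i; rewrite nid => /eqP.
Qed.

(** The normalizing unit cube is also an isometric copy of a set of dimension [d.+1], so
    [hausdorff_const] cancels. *)
Lemma hausdorff_isometric_image d (phi : 'rV[R]_d.+1 -> 'rV[R]_d.+2)
    (A : set 'rV[R]_d.+1) :
  (forall x y, enorm (phi x - phi y) = enorm (x - y)) -> compact A ->
  hausdorff d.+1 (phi @` A) = (vol A)%:E.
Proof.
move=> iphi cA; rewrite /hausdorff unit_cubeE.
rewrite (@hausdorff_raw_similar _ _ vsnoc 1)//; last first.
  move=> x y; rewrite mul1r (_ : vsnoc x - vsnoc y = vsnoc (x - y)).
    by rewrite /enorm dot_vsnoc.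
  by apply/rowP => i; rewrite !mxE; case: insub => [j|]; rewrite ?mxE// subr0.
rewrite (@hausdorff_raw_similar _ _ phi 1)//; last by move=> x y; rewrite iphi mul1r.
rewrite expr1n !mul1e hausdorff_constE hausdorff_rawE//= -EFinM mulrA mulVf ?mul1r//.
by rewrite gt_eqF// hausdorff_const_gt0.
Qed.

End hausdorff_theory.

(** * Cone volume of a face and the function phi *)

Section integral_point.
Import HBNNSimple.
Context d (T : measurableType d) (R : realType).
Variables (mu : set T -> \bar R) (x : T).
Hypotheses (mx : measurable [set x]) (mu0 : mu set0 = 0%E).
Hypothesis mu_ge0 : forall A, (0 <= mu A)%E.

Lemma sintegral_point (h : T -> R) : (forall y, y <> x -> h y = 0) ->
  sintegral mu h = ((h x)%:E * mu [set x])%E.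
Proof.
move=> hx; rewrite /sintegral -(fsbig_widen [set h x])//.
  rewrite fsbig_set1; have [->|hx0] := eqVneq (h x) 0; first by rewrite !mul0e.
  congr (_ * mu _)%E; apply/seteqP; split => [y /= yx|_ ->//].
  by apply: contrapT => /hx hy; move: hx0; rewrite -yx hy eqxx.
move=> r [_ /= rhx]; have [->|r0] := eqVneq r 0; first by rewrite mul0e.
rewrite (_ : h @^-1` [set r] = set0) ?mu0 ?mule0//.
apply/seteqP; split => // y /= yr.
have [yx|/hx hy] := pselect (y = x); first by apply: rhx; rewrite -yr yx.
by move: r0; rewrite -yr hy eqxx.
Qed.

(* [mu] need not be a measure here: only its values on the empty set and on
   the singleton enter the integral. *)
Lemma integral_set1_outer (f : T -> R) : 0 <= f x ->
  (\int[mu]_(y in [set x]) (f y)%:E = (f x)%:E * mu [set x])%E.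
Proof.
move=> fx0.
have nnint (g : T -> \bar R) (c : R) : 0 <= c -> g x = c%:E ->
    (forall y, y <> x -> g y = 0%E) ->
    ereal_sup [set sintegral mu h | h in
      [set h : {nnsfun T >-> R} | forall y, ((h y)%:E <= g y)%E]] =
    (c%:E * mu [set x])%E.
  move=> c0 gx gy; apply/eqP; rewrite eq_le; apply/andP; split.
    apply: ge_ereal_sup => _ [h hg <-]; rewrite sintegral_point.
      by rewrite lee_wpmul2r//; have := hg x; rewrite gx.
    move=> y /gy y0; have := hg y; rewrite y0 lee_fin => h0.
    by apply/eqP; rewrite eq_le h0 fun_ge0.
  (* The supremum is attained at a multiple of the indicator of the point. *)
  pose h := scale_nnsfun (indic_nnsfun R mx) c0.
  have hE y : h y = c * \1_[set x] y by [].
  have hx : h x = c by rewrite hE indicE mem_set// mulr1.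
  have hy y : y <> x -> h y = 0 by move=> yx; rewrite hE indicE memNset// mulr0.
  apply: ereal_sup_ubound; exists h.
    move=> y; have [->|yx] := pselect (y = x); first by rewrite gx hx.
    by rewrite gy// hy.
  by rewrite sintegral_point// hx.
have pE : ((fun y => (f y)%:E) \_ [set x]) x = (f x)%:E.
  by rewrite patchE mem_set.
have nE y : y <> x -> ((fun y => (f y)%:E) \_ [set x]) y = 0%E.
  by move=> yx; rewrite patchE memNset.
rewrite /integral (nnint _ (f x) fx0) ?(nnint _ 0 (lexx 0)).
- by rewrite mul0e sube0.
- by rewrite funenegE pE -EFinN -EFin_max max_r// oppr_le0.
- by move=> y /nE yE; rewrite funenegE yE oppe0 maxxx.
- by rewrite funeposE pE -EFin_max max_l.
- by move=> y /nE yE; rewrite funeposE yE maxxx.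
Qed.

End integral_point.

Section cone_volume.
Context {R : realType} {d : nat}.
Implicit Types (K : set 'rV[R]_d.+2) (u : 'rV[R]_d.+2).

Lemma hausdorff0 : hausdorff d.+1 (set0 : set 'rV[R]_d.+2) = 0%E.
Proof. by rewrite /hausdorff hausdorff_raw0 mule0. Qed.

Lemma hausdorff_ge0 (A : set 'rV[R]_d.+2) : (0 <= hausdorff d.+1 A)%E.
Proof.
rewrite /hausdorff mule_ge0 ?hausdorff_raw_ge0// lee_fin invr_ge0 fine_ge0//.
exact: hausdorff_raw_ge0.
Qed.

Lemma cone_volume_measure_set1 K u : unit_sphere u -> 0 <= support_fun K u ->
  cone_volume_measure K [set u] =
  ((support_fun K u / d.+2%:R)%:E * hausdorff d.+1 (face K u))%E.
Proof.
move=> u1 hu0; rewrite /cone_volume_measure.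
rewrite (@integral_set1_outer _ (@borel_rV R d.+2) R (surface_area_measure K) u
  _ _ _ (fun v => support_fun K v / d.+2%:R)).
- congr (_ * hausdorff _ _)%E; apply/seteqP; split => [x [_ [-> _]//]|x Fx].
  by exists u.
- have mo : measurable (~` [set u] : set (@borel_rV R d.+2)).
    apply: sub_gen_smallest; apply: closed_openC; apply: compact_rV_closed.
    exact: compact_set1.
  by rewrite -[[set u]]setCK; exact: measurableC.
- rewrite /surface_area_measure (_ : reverse_spherical_image _ _ = set0).
    exact: hausdorff0.
  by apply/seteqP; split => // x [v []].
- by move=> A; exact: hausdorff_ge0.
- by rewrite divr_ge0.
Qed.

End cone_volume.

(** * The function phi and its minimizer *)

Section phi_theory.
Context {R : realType}.
Implicit Types (alpha beta rho : R).

Lemma exprz_sub_nat rho (m k : nat) : rho != 0 ->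
  rho ^ (m%:Z - k%:Z) = rho ^+ m / rho ^+ k.
Proof. by move=> r0; rewrite expfzDr// -invr_expz. Qed.

(** The symmetric form of the objective, whose term [i = 0] is [alpha + beta]; it allows estimates
    summand by summand. *)
Lemma phi_objectiveE alpha beta n rho : 0 < rho ->
  phi_objective alpha beta n.+1 rho = \sum_(i < n.+1)
    (alpha * (rho ^+ i)^-1 ^+ 2 + beta * (rho ^+ i) ^+ 2).
Proof.
move=> rho0; have r0 : rho != 0 by rewrite gt_eqF.
have X0 k : rho ^+ k != 0 by rewrite expf_neq0.
rewrite /phi_objective /= mulrDl [RHS]big_split/=; congr (_ + _).
  rewrite mulr_sumr; apply: eq_bigr => i _; rewrite exprz_sub_nat// mulnC exprM.
  by field; rewrite !X0.
(* The [beta] part runs through the exponents in the opposite order. *)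
rewrite mulr_sumr [RHS](reindex_inj rev_ord_inj); apply: eq_bigr => i _.
rewrite exprz_sub_nat//= subSS mulnC exprM -mulrA; congr (_ * _).
have -> : rho ^+ n = rho ^+ (n - i) * rho ^+ i.
  by rewrite -exprD subnK// -ltnS.
by field; rewrite !X0.
Qed.

Lemma phi_objective_ge0 alpha beta n rho : 0 < alpha -> 0 < beta -> 0 < rho ->
  0 <= phi_objective alpha beta n.+1 rho.
Proof.
move=> a0 b0 r0; rewrite phi_objectiveE//; apply: sumr_ge0 => i _.
by rewrite addr_ge0// mulr_ge0 ?sqr_ge0// ltW.
Qed.

Lemma phi_le alpha beta n rho : 0 < alpha -> 0 < beta -> 0 < rho ->
  phi alpha beta n.+1 <= phi_objective alpha beta n.+1 rho.
Proof.
move=> a0 b0 r0; apply: ge_inf; last by exists rho.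
by exists 0 => _ [r /= r1 <-]; exact: phi_objective_ge0.
Qed.

Lemma phi_argminE alpha beta n rho : 0 < alpha -> 0 < beta ->
  phi_argmin alpha beta n.+1 rho ->
  phi alpha beta n.+1 = phi_objective alpha beta n.+1 rho.
Proof.
move=> a0 b0 [r0 rmin]; apply/eqP; rewrite eq_le phi_le//=.
apply: lb_le_inf; first by exists (phi_objective alpha beta n.+1 rho), rho.
by move=> _ [r /= r1 <-]; exact: rmin.
Qed.

Lemma phi_argmin_homogeneous alpha beta n rho : 0 < beta ->
  phi_argmin (alpha / beta) 1 n rho <-> phi_argmin alpha beta n rho.
Proof.
move=> b0; have E r : phi_objective alpha beta n r =
    beta * phi_objective (alpha / beta) 1 n r.
  rewrite /phi_objective mulrA; congr (_ * _); rewrite mulrDr mul1r; congr (_ + _).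
  by rewrite !mulrA [beta * _]mulrC mulfK// gt_eqF.
by split=> -[r0 rmin]; split=> // r r1; have := rmin r r1; rewrite !E ler_pM2l.
Qed.

(* The geometric mean of two minimizers would have a smaller value, by AM-GM
   in each summand. *)
Lemma phi_argmin_unique alpha beta n r s : 0 < alpha -> 0 < beta ->
  phi_argmin alpha beta n.+2 r -> phi_argmin alpha beta n.+2 s -> r = s.
Proof.
move=> a0 b0 [r0 rmin] [s0 smin]; apply: contrapT => /eqP rs.
pose q := Num.sqrt (r * s).
have q0 : 0 < q by rewrite sqrtr_gt0 mulr_gt0.
have qX i : (q ^+ i) ^+ 2 = r ^+ i * s ^+ i.
  by rewrite exprAC sqr_sqrtr ?exprMn// mulr_ge0 ?ltW.
have amgm (x y : R) : x * y <= (x ^+ 2 + y ^+ 2) / 2.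
  by have := sqr_ge0 (x - y); rewrite sqrrB; lra.
have amgm_lt (x y : R) : x != y -> x * y < (x ^+ 2 + y ^+ 2) / 2.
  move=> xy; have : 0 < (x - y) ^+ 2 by rewrite exprn_even_gt0//= subr_eq0.
  by rewrite sqrrB; lra.
have qV i : (q ^+ i)^-1 ^+ 2 = (r ^+ i)^-1 * (s ^+ i)^-1.
  by rewrite exprVn qX invfM.
have E : phi_objective alpha beta n.+2 r = phi_objective alpha beta n.+2 s.
  by apply/eqP; rewrite eq_le rmin// smin.
have : phi_objective alpha beta n.+2 q < phi_objective alpha beta n.+2 r.
  rewrite (_ : phi_objective alpha beta n.+2 r =
    (phi_objective alpha beta n.+2 r + phi_objective alpha beta n.+2 s) / 2).
    rewrite !phi_objectiveE// -big_split/= mulr_suml.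
    (* The summand of index 1, present because there are at least two, gives the strict inequality
       through its [beta] term. *)
    pose i1 : 'I_n.+2 := lift ord0 ord0.
    rewrite [ltLHS](bigD1 i1)//= [ltRHS](bigD1 i1)//=; apply: ltr_leD.
      rewrite !qX !qV -[bump 0 0]/1%N !expr1.
      have := ltr_pM2l b0 (r * s) ((r ^+ 2 + s ^+ 2) / 2); rewrite amgm_lt// => B.
      have := ler_pM2l a0 (r^-1 * s^-1) ((r^-1 ^+ 2 + s^-1 ^+ 2) / 2).
      by rewrite amgm => A; lra.
    apply: ler_sum => i _; rewrite qX qV.
    set x := r ^+ i; set y := s ^+ i.
    have := ler_pM2l b0 (x * y) ((x ^+ 2 + y ^+ 2) / 2); rewrite amgm => B.
    have := ler_pM2l a0 (x^-1 * y^-1) ((x^-1 ^+ 2 + y^-1 ^+ 2) / 2).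
    by rewrite amgm => A; lra.
  by rewrite -E; field.
by rewrite ltNge rmin.
Qed.

(** The default value of [xget] is 0, so a nonzero value certifies a minimizer. *)
Lemma rho0_argmin t n : rho0 t n != 0 :> R -> phi_argmin t 1 n (rho0 t n).
Proof.
by rewrite /rho0; case: xgetP => //; rewrite eqxx.
Qed.

Lemma rho0_unique t n rho : 0 < t -> phi_argmin t 1 n.+2 rho -> rho0 t n.+2 = rho.
Proof.
move=> t0 rmin; rewrite /rho0; case: xgetP => [r _ rmin'|/(_ rho)//].
exact: phi_argmin_unique ltr01 rmin' rmin.
Qed.

End phi_theory.

(** * Comparison with a frustum *)

Section frustum.
Context {R : realType}.

(** The integrand is a power of an affine function; the sum is the quotient of
    [f ^+ n.+1 - g ^+ n.+1] by [f - g]. If [f = g] the slope vanishes and the integrand is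
    constant. *)
Lemma power_antiderivative (g f lo hi : R) n : lo < hi ->
  exists Psi : R -> R,
  (forall t, let l := (t - lo) / (hi - lo) in
     is_derive t 1 Psi (((1 - l) * g + l * f) ^+ n)) /\
  Psi hi - Psi lo = (hi - lo) / n.+1%:R * \sum_(i < n.+1) f ^+ (n - i) * g ^+ i.
Proof.
move=> lohi; have L0 : hi - lo != 0 by rewrite gt_eqF// subr_gt0.
have [->|fg] := eqVneq f g.
  exists (fun t => t * g ^+ n); split => [t l|].
    rewrite -mulrDl subrK mul1r.
    have := is_derive_affine (g ^+ n) 0 (is_derive_id t (1 : R)).
    rewrite mul0r addr0; congr (is_derive _ _ _ _).
    by apply/funext => s; rewrite mul0r addr0 mulrC.
  rewrite (eq_bigr (fun=> g ^+ n)) => [|i _].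
    rewrite sumr_const card_ord -mulr_natr; field.
    by rewrite addrC natr1 pnatr_eq0.
  by rewrite -exprD subnK// -ltnS.
pose k := (f - g) / (hi - lo).
have k0 : k != 0 by rewrite mulf_neq0 ?invr_eq0// subr_eq0.
have n0 : n.+1%:R != 0 :> R by rewrite pnatr_eq0.
pose p t := (g - k * lo) + k * t.
have pE t : let l := (t - lo) / (hi - lo) in (1 - l) * g + l * f = p t.
  by rewrite /p /k; field.
exists (fun t => p t ^+ n.+1 / (n.+1%:R * k)); split => [t l|].
  rewrite pE.
  have dp : is_derive t 1 p k.
    have := is_derive_affine k 0 (is_derive_id t (1 : R)).
    move=> /(is_deriveD (is_derive_cst (g - k * lo) t (1 : R))).
    rewrite add0r mul0r addr0; congr (is_derive _ _ _ _).
    by apply/funext => s; rewrite /p !fctE/= mul0r addr0.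
  have := is_deriveZ (n.+1%:R * k)^-1 (is_deriveX n.+1 dp).
  rewrite [X in is_derive _ _ _ X -> _](_ : _ = p t ^+ n); last first.
    rewrite /GRing.scale/=; field; rewrite k0/=.
    by rewrite addrC natr1.
  congr (is_derive _ _ _ _); apply/funext => s.
  by rewrite /= exprfctE [RHS]mulrC.
have -> : p hi = f by rewrite -pE divff// subrr mul0r mul1r add0r.
have -> : p lo = g by rewrite -pE subrr mul0r subr0 mul1r mul0r addr0.
rewrite -mulrBl subrXX /k; field.
by rewrite L0 subr_eq0 fg addrC natr1 n0.
Qed.

Section core.
Variables (d : nat) (K : set 'rV[R]_d.+2) (lo hi f g : R).
Hypotheses (cK : compact K) (xK : cvx K) (vK : vol K = 1).
Hypotheses (eK : extent K lo hi).
Let F := sect K hi.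
Let G := sect K lo.
Hypotheses (f0 : 0 < f) (g0 : 0 < g).
Hypotheses (vF : vol F = f ^+ d.+1) (vG : vol G = g ^+ d.+1).

Let lohi : lo < hi.
Proof. by apply: (extent_lt cK) => //; rewrite vK. Qed.

Let L0 : 0 < hi - lo. Proof. by rewrite subr_gt0. Qed.

Let th t := (t - lo) / (hi - lo).

Let thE t : (1 - th t) * lo + th t * hi = t.
Proof. by rewrite /th; field; rewrite gt_eqF. Qed.

Let th01 t : lo < t < hi -> 0 < th t < 1.
Proof.
move=> /andP[lt th_]; rewrite /th divr_gt0 ?subr_gt0//=.
by rewrite ltr_pdivrMr// mul1r ltrD2r.
Qed.

Let cF : compact F. Proof. exact: sect_compact. Qed.
Let cG : compact G. Proof. exact: sect_compact. Qed.
Let xF : cvx F. Proof. exact: sect_cvx. Qed.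
Let xG : cvx G. Proof. exact: sect_cvx. Qed.

(* The integral of [frustum_section] from [lo] to [hi]. *)
Definition frustum_volume : R :=
  (hi - lo) / d.+2%:R * \sum_(i < d.+2) f ^+ (d.+1 - i) * g ^+ i.

Definition frustum_section (t : R) : R :=
  ((1 - (t - lo) / (hi - lo)) * g + (t - lo) / (hi - lo) * f) ^+ d.+1.

Lemma frustum_mix_sub t : lo < t < hi -> mix (1 - th t) (th t) G F `<=` sect K t.
Proof.
move=> tl; rewrite -{3}(thE t); apply: cvx_sect_sub => //.
by apply: ltW_itv; exact: th01.
Qed.

Lemma frustum_mix_vol t : lo < t < hi ->
  frustum_section t <= vol (mix (1 - th t) (th t) G F).
Proof.
move=> tl; have /andP[t0 t1] := th01 tl.
by apply: brunn_minkowski => //; rewrite subr_gt0.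
Qed.

Lemma frustum_section_le t : lo < t < hi -> frustum_section t <= vol (sect K t).
Proof.
move=> tl; apply: le_trans (frustum_mix_vol tl) _.
apply: le_vol; [exact: mix_compact | exact: sect_compact | exact: frustum_mix_sub].
Qed.

(** The volume of [K] below a height minus the antiderivative [Psi] is nondecreasing with total
    increase [1 - frustum_volume]; this increase vanishes exactly if the derivative does on the open
    interval. *)
Lemma frustum_volume_le :
  frustum_volume <= 1 /\ (frustum_volume = 1 <->
    forall t, lo < t < hi -> vol (sect K t) = frustum_section t).
Proof.
have K_gt0 : forall t, lo < t < hi -> 0 < vol (sect K t).
  by apply: vol_sect_gt0 => //; rewrite vK.
have [Psi [dPsi PsiE]] := power_antiderivative g f d.+1 lohi.
pose D := (fun t => vol (below K t)) - Psi.
have dD t : lo < t < hi -> is_derive t 1 D (vol (sect K t) - frustum_section t).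
  move=> tl; apply: is_deriveB.
  by rewrite -profileE;
    exact: (below_is_derive_profile (brunn_minkowski (d := d)) cK xK K_gt0).
have cD : continuous D.
  move=> t; apply: cvgB; first exact: below_continuous.
  by have := is_derive_continuous (dPsi t).
have D_ends : D hi - D lo = 1 - frustum_volume.
  rewrite /frustum_volume -PsiE /D !fctE (vol_below_lo cK eK) (vol_below_hi eK) vK.
  by ring.
have D_ndecr s t : lo <= s -> s <= t -> t <= hi -> D s <= D t.
  apply: ger0_derive1_ndecr.
  - by move=> x; rewrite in_itv/= => /dD[].
  - move=> x; rewrite in_itv/= => xl; rewrite derive1E.
    by rewrite (@derive_val _ _ _ _ _ _ _ (dD _ xl)) subr_ge0 frustum_section_le.
  - exact: continuous_subspaceT.
have Dlohi : D lo <= D hi by apply: D_ndecr => //; exact: ltW.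
split; first by move: Dlohi; rewrite -subr_ge0 D_ends subr_ge0.
split=> [V1 t tl|sectE].
  have Dcst s : lo < s < hi -> D s = D lo.
    move=> /andP[ls sh]; apply/eqP; rewrite eq_le.
    have := D_ndecr s hi (ltW ls) (ltW sh) (lexx _).
    move: D_ends; rewrite V1 subrr => /subr0_eq -> ->.
    by apply: D_ndecr => //; exact: ltW.
  have : is_derive t 1 D 0.
    apply: near_eq_is_derive (is_derive_cst (D lo) t (1 : R)).
    by near=> s; rewrite Dcst//; near: s; exact: near_itvoo.
  move=> [_ D0]; have [_] := dD t tl; rewrite D0 => /esym/eqP.
  by rewrite subr_eq0 => /eqP.
have D_nincr s t : lo <= s -> s <= t -> t <= hi -> D t <= D s.
  apply: ler0_derive1_nincr.
  - by move=> x; rewrite in_itv/= => /dD[].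
  - move=> x; rewrite in_itv/= => xl; rewrite derive1E.
    by rewrite (@derive_val _ _ _ _ _ _ _ (dD _ xl)) sectE// subrr.
  - exact: continuous_subspaceT.
have := D_nincr lo hi (lexx _) (ltW lohi) (lexx _).
move=> H; apply/eqP; rewrite eq_sym -subr_eq0 -D_ends subr_eq0 eq_le H.
exact: Dlohi.
Unshelve. all: by end_near. Qed.

Lemma frustum_sect_eq t : lo < t < hi -> vol (sect K t) = frustum_section t ->
  sect K t = mix (1 - th t) (th t) G F.
Proof.
move=> tl tE; apply/esym; apply: eq_of_eq_vol.
- exact: mix_compact.
- exact: sect_compact.
- exact: sect_cvx.
- exact: frustum_mix_sub.
- by apply: (vol_sect_gt0 cK xK _ eK) => //; rewrite vK.
- by rewrite tE; exact: frustum_mix_vol.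
Qed.

(** The weight [h] is chosen so that [(1 - h) * g = h * f]: at the corresponding height the section
    is the midpoint of rescaled faces [A] and [B] of equal volume, to which the equality case
    applies. *)
Lemma frustum_homothetic :
  (forall t, lo < t < hi -> vol (sect K t) = frustum_section t) ->
  exists (l : R) (v : 'rV[R]_d.+1), 0 < l /\ F = [set l *: x + v | x in G].
Proof.
move=> sectE; have fg0 : 0 < f + g by rewrite addr_gt0.
pose h := g / (f + g).
have h0 : 0 < h by rewrite divr_gt0.
have h1E : 1 - h = f / (f + g) by rewrite /h; field; rewrite gt_eqF.
have h1 : 0 < 1 - h by rewrite h1E divr_gt0.
pose t := (1 - h) * lo + h * hi.
have tE : (t - lo) / (hi - lo) = h by rewrite /t; field; rewrite gt_eqF.
have tl : lo < t < hi.
  rewrite -subr_gt0 -[X in _ && X]subr_gt0.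
  have -> : t - lo = h * (hi - lo) by rewrite /t; ring.
  have -> : hi - t = (1 - h) * (hi - lo) by rewrite /t; ring.
  by apply/andP; split; exact: mulr_gt0.
have := frustum_sect_eq tl (sectE t tl); have := sectE t tl.
rewrite /th /frustum_section !tE => vt tmix.
pose A := [set (2 * (1 - h)) *: x + 0 | x in G].
pose B := [set (2 * h) *: x + 0 | x in F].
have A0 : 0 < 2 * (1 - h) by rewrite mulr_gt0.
have B0 : 0 < 2 * h by rewrite mulr_gt0.
have vA : vol A = (2 * (1 - h) * g) ^+ d.+1.
  by rewrite vol_homothety// vG -exprMn.
have vB : vol B = (2 * h * f) ^+ d.+1.
  by rewrite vol_homothety// vF -exprMn.
have hfg : (1 - h) * g = h * f by rewrite h1E /h; field; rewrite gt_eqF.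
have mixE : mix (1 - 2^-1) 2^-1 A B = sect K t.
  rewrite tmix; apply/seteqP; split.
    move=> _ [_ [_ [[x Gx <-] [y Fy <-] ->]]]; exists x, y; split => //.
    rewrite !addr0 !scalerA; congr (_ *: _ + _ *: _); first by field.
    by field.
  move=> _ [x [y [Gx Fy ->]]]; exists ((2 * (1 - h)) *: x + 0), ((2 * h) *: y + 0).
  split; [by exists x | by exists y | ].
  rewrite !addr0 !scalerA; congr (_ *: _ + _ *: _); first by field.
  by field.
have [|||||||v BE] := @brunn_minkowski_eq R d A B.
- exact: homothety_compact.
- exact: homothety_cvx.
- exact: homothety_compact.
- exact: homothety_cvx.
- by rewrite vA exprn_gt0// mulr_gt0.
- by rewrite vA vB -mulrA -hfg mulrA.
- by rewrite mixE vt vA -hfg -mulrA mulr_natl mulr2n.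
exists ((1 - h) / h), ((2 * h)^-1 *: v); split; first by rewrite divr_gt0.
apply/seteqP; split => [y Fy|_ [x Gx <-]].
  have : B ((2 * h) *: y + 0) by exists y.
  rewrite BE => -[_ [x Gx <-]] /(congr1 ( *:%R (2 * h)^-1)).
  rewrite !addr0 scalerDr !scalerA mulVf ?gt_eqF// scale1r => <-.
  by exists x => //; congr (_ *: _ + _); field; rewrite gt_eqF.
have : B ((2 * (1 - h)) *: x + 0 + v).
  by rewrite BE; exists ((2 * (1 - h)) *: x + 0) => //; exists x.
move=> [y Fy] /(congr1 ( *:%R (2 * h)^-1)).
rewrite !addr0 scalerDr !scalerA mulVf ?gt_eqF// scale1r => yE.
rewrite (_ : (1 - h) / h = (2 * h)^-1 * (2 * (1 - h))); last by field; rewrite gt_eqF.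
by rewrite -yE.
Qed.

(** By convexity of [G], multiples of [G] add like their factors, so the combination is a homothetic
    copy of [G] with ratio [1 - th t + th t * l]; comparing volumes gives [l * g = f]. *)
Lemma frustum_section_homothetic (l : R) (v : 'rV[R]_d.+1) t : 0 < l ->
  F = [set l *: x + v | x in G] -> lo < t < hi ->
  sect K t = mix (1 - th t) (th t) G F -> vol (sect K t) = frustum_section t.
Proof.
move=> l0 FE tl ->; have /andP[t0 t1] := th01 tl.
have lf : l * g = f.
  apply: (@pexpIrn _ d.+1) => //; rewrite ?nnegrE ?mulr_ge0 ?ltW//.
  by rewrite exprMn -vG -vF FE vol_homothety.
have s0 : 0 < 1 - th t + th t * l by apply: addr_gt0; [rewrite subr_gt0 | exact: mulr_gt0].
have -> : mix (1 - th t) (th t) G F =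
    [set (1 - th t + th t * l) *: x + th t *: v | x in G].
  rewrite FE; apply/seteqP; split => [_ [x [_ [Gx [y Gy <-] ->]]]|_ [x Gx <-]].
    have k01 : 0 <= th t * l / (1 - th t + th t * l) <= 1.
      apply/andP; split; last by rewrite ler_pdivrMr// mul1r lerDr subr_ge0 ltW.
      by apply: divr_ge0; [apply: mulr_ge0|]; exact: ltW.
    exists ((1 - th t * l / (1 - th t + th t * l)) *: x +
      (th t * l / (1 - th t + th t * l)) *: y); first exact: xG.
    rewrite !scalerDr !scalerA addrA; congr (_ *: _ + _ *: _ + _).
      by field; rewrite gt_eqF.
    by field; rewrite gt_eqF.
  exists x, (l *: x + v); split => //; first by exists x.
  by rewrite scalerDr scalerA scalerDl addrA.
rewrite vol_homothety// vG -exprMn /frustum_section -/(th t) -lf.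
by congr (_ ^+ _); ring.
Qed.

End core.

End frustum.

(** * Reduction to the vertical direction *)

Section reflection.
Context {R : realType} {n : nat}.
Implicit Types (x y w : 'rV[R]_n) (c : R).

Lemma dotC x y : dot x y = dot y x.
Proof. by apply: eq_bigr => i _; rewrite mulrC. Qed.

Lemma dotBl x x' y : dot (x - x') y = dot x y - dot x' y.
Proof. by rewrite /dot -sumrB; apply: eq_bigr => i _; rewrite !mxE mulrBl. Qed.

Lemma dotZl c x y : dot (c *: x) y = c * dot x y.
Proof. by rewrite /dot mulr_sumr; apply: eq_bigr => i _; rewrite !mxE mulrA. Qed.

Lemma dotBr x y y' : dot x (y - y') = dot x y - dot x y'.
Proof. by rewrite ![dot x _]dotC dotBl. Qed.

Lemma dotZr c x y : dot x (c *: y) = c * dot x y.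
Proof. by rewrite ![dot x _]dotC dotZl. Qed.

Lemma dot_eq0 x : dot x x = 0 -> x = 0.
Proof.
move=> x0; apply/rowP => i; rewrite mxE; apply/eqP; rewrite -normr_le0.
by apply: le_trans (coord_le_enorm x i) _; rewrite /enorm x0 sqrtr0.
Qed.

(* The quotient is [0] if [w = 0], and the reflection is then the identity. *)
Definition reflection w x : 'rV[R]_n := x - (2 * dot x w / dot w w) *: w.

Lemma reflectionK w x : reflection w (reflection w x) = x.
Proof.
rewrite /reflection; have [w0|w0] := eqVneq (dot w w) 0.
  by rewrite (dot_eq0 w0) !scaler0 !subr0.
rewrite dotBl dotZl -addrA -opprD -scalerDl.
rewrite [X in X *: w](_ : _ = 0) ?scale0r ?subr0//; field.
exact: w0.
Qed.

Lemma reflectionB w x y : reflection w x - reflection w y = reflection w (x - y).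
Proof.
by apply/rowP => i; rewrite !mxE dotBl; ring.
Qed.

Lemma reflectionD w x y : reflection w (x + y) = reflection w x + reflection w y.
Proof.
apply/eqP; rewrite -subr_eq reflectionB addrK; exact/eqP.
Qed.

Lemma reflectionZ w c x : reflection w (c *: x) = c *: reflection w x.
Proof. by rewrite /reflection dotZl scalerBr scalerA !mulrA [c * 2]mulrC. Qed.

Lemma dot_reflection w x y : dot (reflection w x) y = dot x (reflection w y).
Proof. by rewrite /reflection dotBl dotBr dotZl dotZr [dot w y]dotC; ring. Qed.

Lemma enorm_reflection w x : enorm (reflection w x) = enorm x.
Proof. by rewrite /enorm dot_reflection reflectionK. Qed.

Lemma reflection_isometry w x y :
  enorm (reflection w x - reflection w y) = enorm (x - y).
Proof. by rewrite reflectionB enorm_reflection. Qed.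

Lemma reflection_continuous w : continuous (reflection w).
Proof.
apply: (@lipschitz_continuous _ _ _ _ n%:R) => x y; rewrite reflectionB.
apply: rV_norm_le => [|i]; first by rewrite mulr_ge0.
apply: le_trans (coord_le_enorm _ i) _; rewrite enorm_reflection.
by apply: enorm_le => // j; exact: coord_le_norm.
Qed.

Lemma reflection_swap (e u : 'rV[R]_n) : dot e e = 1 -> dot u u = 1 ->
  reflection (e - u) e = u.
Proof.
move=> e1 u1; rewrite /reflection; have [w0|w0] := eqVneq (dot (e - u) (e - u)) 0.
  by have /subr0_eq -> := dot_eq0 w0; rewrite subrr scaler0 subr0.
have E : dot (e - u) (e - u) = 2 * dot e (e - u).
  by rewrite dotBl !dotBr e1 u1 (dotC u e); ring.
by rewrite -E divff// scale1r subKr.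
Qed.

End reflection.

Lemma dot_vcons {R : realType} d (s t : R) (x y : 'rV[R]_d) :
  dot (vcons s x) (vcons t y) = s * t + dot x y.
Proof.
rewrite /dot big_ord_recl !vcons0E; congr (_ + _).
by apply: eq_bigr => i _; rewrite !vconsSE.
Qed.

Lemma sup_max {R : realType} (S : set R) (m : R) : S m -> ubound S m -> sup S = m.
Proof.
move=> Sm mS; apply/eqP; rewrite eq_le; apply/andP; split.
  by apply: ge_sup => //; exists m.
by apply: ub_le_sup => //; exists m.
Qed.

(** After substituting [f = g * rho ^+ 2], each term [f ^+ (d.+1 - i) * g ^+ i] is
    [(g * rho) ^+ d.+1] times [rho] to the power [d.+1 - 2 * i], and the common factor turns the
    height [a + b] into the first factor of the objective. *)
Lemma frustum_volume_phi {R : realType} d (alpha beta a b f g rho : R) :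
  0 < f -> 0 < g -> 0 < rho -> f = g * rho ^+ 2 ->
  alpha = a / d.+2%:R * f ^+ d.+1 -> beta = b / d.+2%:R * g ^+ d.+1 ->
  (a + b) / d.+2%:R * (\sum_(i < d.+2) f ^+ (d.+1 - i) * g ^+ i) =
  phi_objective alpha beta d.+2 rho.
Proof.
move=> f0 g0 rho0 fE -> ->; rewrite /phi_objective.
have r0 : rho != 0 by rewrite gt_eqF.
have g0' : g != 0 by rewrite gt_eqF.
have X0 k : rho ^+ k != 0 by rewrite expf_neq0.
have Y0 k : g ^+ k != 0 by rewrite expf_neq0.
have -> : \sum_(i < d.+2) f ^+ (d.+1 - i) * g ^+ i =
    (g * rho) ^+ d.+1 * \sum_(i < d.+2) rho ^ (d.+1%:Z - (2 * i)%:Z).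
  rewrite mulr_sumr; apply: eq_bigr => i _; rewrite exprz_sub_nat// fE.
  have id : (i <= d.+1)%N by rewrite -ltnS.
  have fX k : (g * rho ^+ 2) ^+ k = g ^+ k * rho ^+ (2 * k).
    by rewrite exprMn -exprM.
  rewrite fX [(g * rho) ^+ _]exprMn mulrAC -exprD subnK// -mulrA; congr (_ * _).
  apply: (mulIf (X0 (2 * i)%N)); rewrite -exprD -mulnDr subnK//.
  by rewrite mulrA divfK// mul2n -addnn exprD.
rewrite mulrA; congr (_ * _).
have gf : f ^+ d.+1 = g ^+ d.+1 * (rho ^+ d.+1) ^+ 2 by rewrite fE exprMn exprAC.
rewrite gf exprMn mulrDl -[d.+2.-1]/d.+1; field.
by rewrite X0 /= -natrD pnatr_eq0.
Qed.

Lemma cvx_combine {R : realType} {V : lmodType R} (A : set V) (p q : R) x y :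
  cvx A -> A x -> A y -> 0 <= p -> 0 <= q ->
  exists2 z, A z & p *: x + q *: y = (p + q) *: z.
Proof.
move=> cA Ax Ay p0 q0; have [pq0|pq0] := eqVneq (p + q) 0.
  have pE : p = 0 by lra.
  exists x => //; have qE : q = 0 by lra.
  by rewrite pq0 pE qE !scale0r addr0.
have pq : 0 < p + q by rewrite lt_neqAle eq_sym pq0 addr_ge0.
exists ((1 - q / (p + q)) *: x + (q / (p + q)) *: y).
  apply: cA => //; apply/andP; split; first by rewrite divr_ge0// ltW.
  by rewrite ler_pdivrMr// mul1r lerDr.
by rewrite scalerDr !scalerA; congr (_ *: _ + _ *: _); field; rewrite pq0.
Qed.

(** For nonempty convex [A] and [B], the convex hull of their union with its points made
    explicit. *)
Definition segment_join {R : realType} {V : lmodType R} (A B : set V) : set V :=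
  [set z | exists t, 0 <= t <= 1 /\ mix (1 - t) t A B z].

Lemma segment_join_cvx {R : realType} {V : lmodType R} (A B : set V) :
  cvx A -> cvx B -> cvx (segment_join A B).
Proof.
move=> cA cB z z' l [s [/andP[s0 s1] [x [y [Ax By ->]]]]].
move=> [t [/andP[t0 t1] [x' [y' [Ax' By' ->]]]]] /andP[l0 l1] {z z'}.
have l0' : 0 <= 1 - l by rewrite subr_ge0.
have s0' : 0 <= 1 - s by rewrite subr_ge0.
have t0' : 0 <= 1 - t by rewrite subr_ge0.
have [x2 Ax2 xE] := cvx_combine cA Ax Ax' (mulr_ge0 l0' s0') (mulr_ge0 l0 t0').
have [y2 By2 yE] := cvx_combine cB By By' (mulr_ge0 l0' s0) (mulr_ge0 l0 t0).
exists ((1 - l) * s + l * t); split.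
  have := mulr_ge0 l0' s0; have := mulr_ge0 l0 t0.
  have := mulr_ge0 l0' s0'; have := mulr_ge0 l0 t0'.
  by move=> ? ? ? ?; apply/andP; split; lra.
exists x2, y2; split => //; rewrite -yE.
rewrite (_ : 1 - ((1 - l) * s + l * t) = (1 - l) * (1 - s) + l * (1 - t));
  last by ring.
by rewrite -xE !scalerDr !scalerA addrACA.
Qed.

(** * Faces, cone volumes and hull of the reflected body *)

Section vertical_direction.
Context {R : realType} {d : nat}.
Variables (K : set 'rV[R]_d.+2) (u : 'rV[R]_d.+2).
Hypotheses (cK : compact K) (xK : cvx K) (K0 : interior K 0).
Hypotheses (vK : volume K = 1%E) (u1 : unit_sphere u).

Let e0 : 'rV[R]_d.+2 := vcons 1 0.
(** [Q] exchanges [e0] and [u], so that heights in [K'] are the values of [dot] with [u] on [K]. *)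
Let Q := reflection (e0 - u).
Let K' := Q @` K.

Let uu : dot u u = 1.
Proof.
have := u1; rewrite /unit_sphere/= /enorm => /(congr1 (fun x => x ^+ 2)).
by rewrite sqr_sqrtr ?dot_ge0// expr1n.
Qed.

Let e0e0 : dot e0 e0 = 1.
Proof.
rewrite /e0 dot_vcons mul1r /dot big1 ?addr0// => i _.
by rewrite mxE mul0r.
Qed.

Let Qe0 : Q e0 = u.
Proof. exact: reflection_swap. Qed.

Let QK x : Q (Q x) = x.
Proof. exact: reflectionK. Qed.

Let dotQ x : dot (Q x) u = x ord0 ord0.
Proof.
rewrite dot_reflection -/Q -Qe0 QK /e0 -[in LHS](vcons_tail x) dot_vcons mulr1.
by rewrite /dot big1 ?addr0// => i _; rewrite [X in _ * X]mxE mulr0.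
Qed.

Let K'P x : K' x <-> K (Q x).
Proof. by split=> [[y Ky <-]|KQx]; [rewrite QK | exists (Q x) => //; rewrite QK]. Qed.

Let K'Q x : K x -> K' (Q x).
Proof. by move=> Kx; exists x. Qed.

Let cK' : compact K'.
Proof.
apply: continuous_compact => //; apply: continuous_subspaceT.
exact: reflection_continuous.
Qed.

Let xK' : cvx K'.
Proof.
move=> x y l /K'P Kx /K'P Ky l01; apply/K'P.
by rewrite /Q reflectionD !reflectionZ; exact: xK.
Qed.

Let vK' : vol K' = 1.
Proof.
rewrite /K' vol_isometry//; last exact: reflection_isometry.
by rewrite /vol vK.
Qed.

Variables (lo hi : R).
Hypothesis eK : extent K' lo hi.

Let support_hi : support_fun K u = hi.
Proof.
have [_ [y Ky] Kb] := eK; apply: sup_max.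
  exists (Q (vcons hi y)); first exact/K'P.
  by rewrite dotQ vcons0E.
move=> _ [x Kx <-]; rewrite -[x]QK dotQ.
by have /andP[] := Kb _ (K'Q Kx).
Qed.

Let dotN x : dot x (- u) = - dot x u.
Proof. by rewrite -scaleN1r dotZr mulN1r. Qed.

Let support_lo : support_fun K (- u) = - lo.
Proof.
have [[y Ky] _ Kb] := eK; apply: sup_max.
  exists (Q (vcons lo y)); first exact/K'P.
  by rewrite dotN dotQ vcons0E.
move=> _ [x Kx <-]; rewrite dotN -[x]QK dotQ lerN2.
by have /andP[] := Kb _ (K'Q Kx).
Qed.

Let face_hi : face K u = (fun y => Q (vcons hi y)) @` sect K' hi.
Proof.
apply/seteqP; split => [x [Kx]|_ [y /K'P Ky <-]].
  rewrite support_hi -[x]QK dotQ => xE; exists (vtail (Q x)).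
    by rewrite /sect/= -xE vcons_tail; exact: K'Q.
  by rewrite -xE vcons_tail QK.
by split => //; rewrite dotQ support_hi vcons0E.
Qed.

Let face_lo : face K (- u) = (fun y => Q (vcons lo y)) @` sect K' lo.
Proof.
apply/seteqP; split => [x [Kx]|_ [y /K'P Ky <-]].
  rewrite support_lo dotN -[x]QK dotQ => /oppr_inj xE; exists (vtail (Q x)).
    by rewrite /sect/= -xE vcons_tail; exact: K'Q.
  by rewrite -xE vcons_tail QK.
by split => //; rewrite dotN dotQ support_lo vcons0E.
Qed.

Let scaled_in_K : exists2 e, 0 < e & K (e *: u) /\ K (- e *: u).
Proof.
have /nbhs_ballP[r /= r0 rK] := K0.
(* Here [|u|] is the sup norm, which need not be 1. *)
pose e := r / 2 / (`|u| + 1).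
have u0 : 0 < `|u| + 1 by rewrite ltr_wpDl.
have e0' : 0 < e by rewrite !divr_gt0.
have eu : `|e *: u| < r.
  rewrite normrZ gtr0_norm// /e mulrAC ltr_pdivrMr//.
  have : 0 <= r * `|u| by rewrite mulr_ge0// ltW.
  by lra.
by exists e => //; split; apply: rK; rewrite -ball_normE/= sub0r ?scaleNr ?opprK ?normrN.
Qed.

Let hi_gt0 : 0 < hi.
Proof.
have [e e0' [Ke _]] := scaled_in_K; have [_ _ Kb] := eK.
have /andP[_] := Kb _ (K'Q Ke).
by apply: lt_le_trans; rewrite -dotQ QK dotZl uu mulr1.
Qed.

Let lo_lt0 : lo < 0.
Proof.
have [e e0' [_ Ke]] := scaled_in_K; have [_ _ Kb] := eK.
have /andP[+ _] := Kb _ (K'Q Ke).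
by move/le_lt_trans; apply; rewrite -dotQ QK dotZl uu mulr1 oppr_lt0.
Qed.

Let embed_isometry (t : R) (x y : 'rV[R]_d.+1) :
  enorm (Q (vcons t x) - Q (vcons t y)) = enorm (x - y).
Proof.
rewrite reflection_isometry -scaleN1r -vcons_scale -vcons_add mulN1r subrr.
by rewrite scaleN1r /enorm dot_vcons mul0r add0r.
Qed.

Let cone_hi : cone_volume_measure K [set u] =
  (hi / d.+2%:R * vol (sect K' hi))%:E.
Proof.
rewrite cone_volume_measure_set1 ?support_hi ?(ltW hi_gt0)// face_hi.
by rewrite hausdorff_isometric_image//; exact: sect_compact.
Qed.

Let cone_lo : cone_volume_measure K [set - u] =
  (- lo / d.+2%:R * vol (sect K' lo))%:E.
Proof.
rewrite cone_volume_measure_set1 ?support_lo ?oppr_ge0 ?(ltW lo_lt0)//.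
  by rewrite face_lo hausdorff_isometric_image//; exact: sect_compact.
by rewrite /unit_sphere/= /enorm -scaleN1r dotZl dotZr !mulN1r opprK uu sqrtr1.
Qed.

Let F := sect K' hi.
Let G := sect K' lo.

Let homothetic_faces : homothetic (face K u) (face K (- u)) <->
  exists (l : R) (v : 'rV[R]_d.+1), 0 < l /\ F = [set l *: x + v | x in G].
Proof.
rewrite face_hi face_lo; split => [[l [v [l0 E]]]|[l [v [l0 FE]]]].
  exists l, (vtail (Q v)); split => //; apply/seteqP; split => [y Fy|_ [x Gx <-]].
    have [_ [x Gx <-] /(congr1 Q)] : [set l *: x + v |
        x in (fun y => Q (vcons lo y)) @` sect K' lo] (Q (vcons hi y)).
      by rewrite -E; exists y.
    rewrite QK /Q reflectionD reflectionZ -!/Q QK => /(congr1 vtail).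
    by rewrite vtail_add vtail_scale !vtail_cons => yE; exists x.
  have [y Fy /(congr1 Q)] : ((fun y => Q (vcons hi y)) @` sect K' hi)
      (l *: Q (vcons lo x) + v).
    by rewrite E; exists (Q (vcons lo x)) => //; exists x.
  rewrite QK /Q reflectionD reflectionZ -!/Q QK => /(congr1 vtail).
  by rewrite vtail_add vtail_scale !vtail_cons => <-.
(* The height of the translation is forced: scaling by [l] followed by it must carry height [lo] to
   [hi]. *)
exists l, (Q (vcons (hi - l * lo) v)); split => //.
have QE x : Q (vcons hi (l *: x + v)) = l *: Q (vcons lo x) + Q (vcons (hi - l * lo) v).
  rewrite /Q -reflectionZ -reflectionD -vcons_scale -vcons_add.
  by rewrite [l * lo + _]addrC subrK.
apply/seteqP; split => [_ [y + <-]|_ [_ [x Gx <-] <-]].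
  rewrite -/F FE => -[x Gx <-]; exists (Q (vcons lo x)); first by exists x.
  by rewrite QE.
by exists (l *: x + v); [rewrite -/F FE; exists x | rewrite QE].
Qed.

Let th t := (t - lo) / (hi - lo).

Let lohi : lo < hi.
Proof. exact: lt_trans lo_lt0 hi_gt0. Qed.

Let cvx_face v : cvx (face K v).
Proof.
move=> x y l [Kx xv] [Ky yv] l01; split; first exact: xK.
by rewrite -[_ *: y]opprK -scaleNr dotBl !dotZl xv yv; ring.
Qed.

(** Points of the hull lie on segments between the two faces, and the height of a point fixes its
    position on the segment. *)
Let sect_of_hull : K = convex_hull (face K u `|` face K (- u)) ->
  forall t, lo < t < hi -> sect K' t = mix (1 - th t) (th t) G F.
Proof.
move=> KE t tl; apply/seteqP; split; last exact: frustum_mix_sub.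
have KJ : K `<=` segment_join (face K (- u)) (face K u).
  rewrite {1}KE; apply: smallest_sub.
    by apply/convex_setP; apply: segment_join_cvx; exact: cvx_face.
  have [[x0 Gx0] [y0 Fy0] _] := eK.
  have F0 : face K u (Q (vcons hi y0)) by rewrite face_hi; exists y0.
  have G0 : face K (- u) (Q (vcons lo x0)) by rewrite face_lo; exists x0.
  move=> x [Fx|Gx].
    exists 1; split; first by rewrite ler01 lexx.
    exists (Q (vcons lo x0)), x; split => //.
    by rewrite subrr scale0r scale1r add0r.
  exists 0; split; first by rewrite ler01 lexx.
  exists x, (Q (vcons hi y0)); split => //.
  by rewrite subr0 scale0r scale1r addr0.
move=> y /K'P /KJ [l [_ [z1 [z2 []]]]].
rewrite face_hi face_lo => -[x Gx <-] [z Fz <-] /(congr1 Q).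
rewrite QK /Q reflectionD !reflectionZ -!/Q !QK -!vcons_scale -vcons_add => E.
have tE : t = (1 - l) * lo + l * hi.
  by have := congr1 (fun v : 'rV[R]_d.+2 => v ord0 ord0) E; rewrite !vcons0E.
have lE : th t = l by rewrite /th tE; field; rewrite gt_eqF// subr_gt0.
have := congr1 vtail E; rewrite !vtail_cons lE => ->.
by exists x, z.
Qed.

Let hull_of_sect :
  (forall t, lo < t < hi -> sect K' t = mix (1 - th t) (th t) G F) ->
  K = convex_hull (face K u `|` face K (- u)).
Proof.
move=> sE; apply/seteqP; split; last first.
  by apply: smallest_sub; [exact/convex_setP | move=> x [[]|[]]].
move=> x Kx C [/convex_setP cC FC]; have [_ _ Kb] := eK.
have Kx' := K'Q Kx.
have C_hi y : sect K' hi y -> C (Q (vcons hi y)).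
  by move=> Fy; apply: FC; left; rewrite face_hi; exists y.
have C_lo y : sect K' lo y -> C (Q (vcons lo y)).
  by move=> Gy; apply: FC; right; rewrite face_lo; exists y.
have := Kb _ Kx'; have := vcons_tail (Q x).
set t := Q x ord0 ord0; set y := vtail (Q x) => xE.
have yK : sect K' t y by rewrite /sect/= xE.
have -> : x = Q (vcons t y) by rewrite xE QK.
rewrite !le_eqVlt => /andP[/predU1P[tlo|lt]]; first by move: yK; rewrite -tlo => /C_lo.
case/predU1P => [thi|th_]; first by move: yK; rewrite thi => /C_hi.
have tl : lo < t < hi by rewrite lt.
move: yK; rewrite sE// => -[x' [y' [Gx' Fy' ->]]].
have hl : hi - lo != 0 by rewrite gt_eqF// subr_gt0.
have {1}-> : t = (1 - th t) * lo + th t * hi by rewrite /th; field.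
rewrite vcons_add !vcons_scale /Q reflectionD !reflectionZ -!/Q.
apply: cC; [exact: C_lo | exact: C_hi | ].
rewrite /th divr_ge0 ?subr_ge0 ?(ltW lt) ?(ltW lohi)//=.
by rewrite ler_pdivrMr ?subr_gt0// mul1r lerD2r ltW.
Qed.

(** In the chain from [phi] through [frustum_volume] to 1, equality in the second link amounts to
    the two geometric conditions, and equality in the first to [rho] being the minimizer, which the
    ratio of support values expresses. *)
Lemma cone_volume_bound_extent alpha beta :
  cone_volume_measure K [set u] = alpha%:E -> 0 < alpha ->
  cone_volume_measure K [set - u] = beta%:E -> 0 < beta ->
  phi alpha beta d.+2 <= 1 /\
  (phi alpha beta d.+2 = 1 <->
    [/\ homothetic (face K u) (face K (- u)),
        K = convex_hull (face K u `|` face K (- u)) &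
        support_fun K u / support_fun K (- u) =
          alpha / beta * rho0 (alpha / beta) d.+2 ^- (2 * d.+2.-1)]).
Proof.
rewrite cone_hi cone_lo => -[aE] a0 -[bE] b0.
have n0 : 0 < d.+2%:R :> R by rewrite ltr0n.
have vF0 : 0 < vol F.
  by move: a0; rewrite -aE pmulr_rgt0// divr_gt0.
have vG0 : 0 < vol G.
  by move: b0; rewrite -bE pmulr_rgt0// divr_gt0// oppr_gt0.
have [f f0 fE] := root_exists d vF0; have [g g0 gE] := root_exists d vG0.
pose rho := Num.sqrt (f / g).
have rho_gt0 : 0 < rho by rewrite sqrtr_gt0 divr_gt0.
have rho2 : rho ^+ 2 = f / g by rewrite sqr_sqrtr// divr_ge0// ltW.
have fgrho : f = g * rho ^+ 2 by rewrite rho2 mulrCA divff ?mulr1// gt_eqF.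
have alphaE : alpha = hi / d.+2%:R * f ^+ d.+1 by rewrite fE.
have betaE : beta = - lo / d.+2%:R * g ^+ d.+1 by rewrite gE.
have V_phi : frustum_volume d lo hi f g = phi_objective alpha beta d.+2 rho.
  exact: frustum_volume_phi f0 g0 rho_gt0 fgrho alphaE betaE.
have [V1 VP] := frustum_volume_le cK' xK' vK' eK f0 g0 (esym fE) (esym gE).
have phi_V := phi_le d.+1 a0 b0 rho_gt0.
(* This holds whether or not there is equality, so the third condition compares a power of [rho]
   with the same power of [rho0]. *)
have ratioE : hi / - lo = alpha / beta * (rho ^+ (2 * d.+1))^-1.
  rewrite exprM rho2 expr_div_n alphaE betaE; field.
  apply/and4P; split; [by rewrite expf_neq0// gt_eqF | by rewrite expf_neq0// gt_eqF
    | by rewrite -natrD pnatr_eq0 | by rewrite lt_eqF].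
split; first by apply: le_trans phi_V _; rewrite -V_phi.
rewrite support_hi support_lo.
split => [phi1|[/homothetic_faces[l [v [l0 FE]]] KE ratio]].
  have Veq1 : frustum_volume d lo hi f g = 1.
    by apply/eqP; rewrite eq_le V1 V_phi -phi1 phi_V.
  have sE := VP.1 Veq1.
  split.
  - apply/homothetic_faces.
    exact: (frustum_homothetic cK' xK' vK' eK f0 g0 (esym fE) (esym gE) sE).
  - apply: hull_of_sect => t tl.
    exact: (frustum_sect_eq cK' xK' vK' eK f0 g0 (esym fE) (esym gE) tl (sE t tl)).
  - rewrite ratioE; congr (_ * _^-1).
    rewrite (@rho0_unique _ (alpha / beta) d rho) ?divr_gt0//.
    apply/phi_argmin_homogeneous => //; split => // r r0.
    by rewrite -V_phi Veq1 -phi1; exact: phi_le.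
have Veq1 : frustum_volume d lo hi f g = 1.
  apply/VP => t tl.
  by apply: (frustum_section_homothetic cK' xK' vK' eK f0 g0 (esym fE) (esym gE)
    l0 FE tl); exact: sect_of_hull.
pose r0 := rho0 (alpha / beta) d.+2.
have ab0 : 0 < alpha / beta by rewrite divr_gt0.
have powE : r0 ^+ (2 * d.+1) = rho ^+ (2 * d.+1).
  apply: invr_inj; apply: (mulfI (lt0r_neq0 ab0)).
  by rewrite -ratioE -/r0 in ratio *; rewrite ratio.
(* The default value 0 is excluded, since its power would vanish while that of [rho] is positive. *)
have r0_neq0 : r0 != 0.
  apply/eqP => r00; move: powE; rewrite r00 expr0n/= => /esym/eqP.
  by rewrite expf_eq0/= gt_eqF.
have r0_min := rho0_argmin r0_neq0.
have r0E : r0 = rho.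
  have r0_gt0 : 0 < r0 by case: r0_min.
  by apply: (@pexpIrn _ (2 * d.+1)) powE => //; rewrite nnegrE ltW.
have : phi_argmin alpha beta d.+2 rho.
  by rewrite -r0E; apply/phi_argmin_homogeneous.
by move=> /(phi_argminE a0 b0) ->; rewrite -V_phi.
Qed.

End vertical_direction.

Theorem theorem1p1 (R : realType) (n : nat) (K : set 'rV[R]_n) (u : 'rV[R]_n)
    (alpha beta : R) (hn : (2 <= n)%N)
    (hK : convex_body K) (h0 : interior K 0) (hV : volume K = 1%E)
    (hu : unit_sphere u)
    (halpha : cone_volume_measure K [set u] = alpha%:E) (alpha_gt0 : 0 < alpha)
    (hbeta : cone_volume_measure K [set - u] = beta%:E) (beta_gt0 : 0 < beta) :
  phi alpha beta n <= 1 /\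
  (phi alpha beta n = 1 <->
    [/\ homothetic (face K u) (face K (- u)),
        K = convex_hull (face K u `|` face K (- u)) &
        support_fun K u / support_fun K (- u) =
          alpha / beta * rho0 (alpha / beta) n ^- (2 * n.-1)]).
Proof.
case: n K u hn hK h0 hV hu halpha hbeta => [//|[//|d]] K u _.
move=> [/convex_setP xK cK _] h0 hV hu ha hb.
pose w : 'rV[R]_d.+2 := vcons 1 0 - u.
have cK' : compact (reflection w @` K).
  apply: continuous_compact => //; apply: continuous_subspaceT.
  exact: reflection_continuous.
have [|lo [hi eK]] := extent_exists cK'.
  by exists (reflection w 0), 0 => //; exact: nbhs_singleton h0.
exact: (cone_volume_bound_extent cK xK h0 hV hu eK ha alpha_gt0 hb beta_gt0).
Qed.
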